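(* Let $\Omega\subset\mathbb{C}$ be a simply connected domain with non-empty boundary and let $\varphi:\Omega\to\mathbb{D}$ be a conformal homeomorphism of $\Omega$ onto the unit disc. Let $\alpha_0\in(-2,0)$, suppose that the Inverse Brennan's Conjecture holds for the interval $[\alpha_0,2/3)$, and let $p\in\bigl(\frac{|\alpha_0|+2}{|\alpha_0|+1},2\bigr)$. Then the inverse mapping $\varphi^{-1}$ induces a bounded composition operator $$(\varphi^{-1})^*:L_p^1(\Omega)\to L_q^1(\mathbb{D}),\qquad (\varphi^{-1})^*(f)=f\circ\varphi^{-1},$$ for any $q$ such that $$1\le q\le\frac{p|\alpha_0|}{2+|\alpha_0|-p}<\frac{2p}{4-p}.$$
   Context: $\mu$ is Lebesgue measure on $\mathbb{C}\cong\mathbb{R}^2$; $\mathbb{D}$ is the open unit disc. Functions are real-valued. ''The Inverse Brennan's Conjecture holds for the interval $[\alpha_0,2/3)$'' means: for every conformal homeomorphism $\psi$ of $\mathbb{D}$ onto a simply connected plane domain with non-empty boundary, $\int_{\mathbb{D}}|\psi'(w)|^{\alpha}\,d\mu<+\infty$ for all $\alpha\in[\alpha_0,2/3)$. For a domain $\Omega$ and $1\le p<\infty$, $L_p^1(\Omega)$ is the homogeneous seminormed Sobolev space of weakly differentiable functions $f:\Omega\to\mathbb{R}$ with finite seminorm $\|f\mid L_p^1(\Omega)\|=\bigl(\int_\Omega|\nabla f|^p\,d\mu\bigr)^{1/p}$. The composition operator $(\varphi^{-1})^*:L_p^1(\Omega)\to L_q^1(\mathbb{D})$ is bounded if for every $f\in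 L_p^1(\Omega)$ one has $f\circ\varphi^{-1}\in L_q^1(\mathbb{D})$ and there is a constant $K<\infty$ independent of $f$ with $\|f\circ\varphi^{-1}\mid L_q^1(\mathbb{D})\|\le K\|f\mid L_p^1(\Omega)\|$. *)

(* Defs.v *)
From HB Require Import structures.
From mathcomp Require Export all_boot all_order all_algebra.
From mathcomp Require Export all_classical all_reals all_analysis.
From mathcomp.real_closed Require Export complex.
Import Order.TTheory GRing.Theory Num.Theory.
Import numFieldNormedType.Exports.

Set Implicit Arguments.
Unset Strict Implicit.
Unset Printing Implicit Defensive.

Local Open Scope classical_set_scope.
Local Open Scope ring_scope.

(* [R[i]^o] is the complex plane with its topology and its structure of normed
   space over itself, so that [derivable f z 1] and [derive1 f z] are complex
   differentiability and the complex derivative.  Maps defined on a part of the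
   plane are represented by total functions; their values elsewhere are never
   used. *)
Notation Cplane R := ((complex R)^o).

Section Plane.
Context {R : realType}.
Local Notation C := (Cplane R).
Local Notation normc := ComplexField.Normc.normc.
Implicit Types (A B : set C).

Definition toC (p : R * R) : C := Complex p.1 p.2.

Definition ofC (z : C) : R * R := (complex.Re z, complex.Im z).

Definition lebesgue2 :
    {measure set (measurableTypeR R * measurableTypeR R) -> \bar R} :=
  (lebesgue_measure \x lebesgue_measure)%E.

Definition area_integral A (F : C -> \bar R) : \bar R :=
  (\int[lebesgue2]_(p in toC @^-1` A) F (toC p))%E.

Definition unit_disc : set C := [set z | normc z < 1].

Definition frontier A : set C := closure A `\` interior A.

Definition loop_in A (gamma : R -> C) : Prop :=
  [/\ {within `[0, 1], continuous gamma},
      (forall t, 0 <= t <= 1 -> A (gamma t)) & gamma 0 = gamma 1].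

Definition null_homotopic_in A (gamma : R -> C) : Prop :=
  exists H : R * R -> C,
    [/\ {within `[0, 1] `*` `[0, 1], continuous H},
        (forall s t, 0 <= s <= 1 -> 0 <= t <= 1 -> A (H (s, t))),
        (forall t, 0 <= t <= 1 -> H (0, t) = gamma t),
        (forall t, 0 <= t <= 1 -> H (1, t) = gamma 0) &
        (forall s, 0 <= s <= 1 -> H (s, 0) = gamma 0 /\ H (s, 1) = gamma 0)].

Definition domain A : Prop := [/\ open A, connected A & A !=set0].

(* Path-connectedness is automatic for open connected subsets of the plane. *)
Definition simply_connected_domain A : Prop :=
  domain A /\ forall gamma, loop_in A gamma -> null_homotopic_in A gamma.

Definition inv_on A (f : C -> C) : C -> C := 'pinv_(fun=> 0) A f.

Definition homeomorphism A B (f : C -> C) : Prop :=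
  [/\ set_bij A B f, {within A, continuous f} &
      {within B, continuous (inv_on A f)}].

Definition conformal_homeomorphism A B (f : C -> C) : Prop :=
  homeomorphism A B f /\
  forall z, A z -> derivable f z 1 /\ derive1 f z != 0.

Definition inverse_brennan (alpha0 : R) : Prop :=
  forall (B : set C) (psi : C -> C),
    simply_connected_domain B -> frontier B !=set0 ->
    conformal_homeomorphism unit_disc B psi ->
    forall alpha : R, alpha0 <= alpha < 2 / 3 ->
      (area_integral unit_disc
         (fun w => (normc (derive1 psi w) `^ alpha)%:E) < +oo)%E.

Definition axis (b : bool) : R * R := if b then (0, 1) else (1, 0).

(* [partial false] is d/dx and [partial true] is d/dy. *)
Definition partial (b : bool) (h : C -> R) : C -> R :=
  fun z => 'D_(axis b) (h \o toC) (ofC z).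

Definition smooth (h : C -> R) : Prop :=
  forall s : seq bool, let k := foldr partial h s in
    continuous (k : C -> R) /\
    forall (b : bool) (z : C), derivable (k \o toC) (ofC z) (axis b).

Definition test_function A (eta : C -> R) : Prop :=
  let supp := closure [set z : C | eta z != 0] in
  [/\ smooth eta, compact supp & supp `<=` A].

(* The measurable sets of [lebesgue2] are the Borel sets; a function is
   Lebesgue measurable iff it is almost everywhere equal to a Borel one.  On
   such functions [\int[lebesgue2]] is the Lebesgue integral, because it is
   defined through suprema over Borel simple functions below the positive and
   negative parts. *)
Definition lebesgue_measurable_fun A (f : C -> R) : Prop :=
  exists2 g : measurableTypeR R * measurableTypeR R -> R,
    measurable_fun (toC @^-1` A) g &
    {ae lebesgue2, forall p, A (toC p) -> f (toC p) = g p}.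

Definition loc_integrable A (f : C -> R) : Prop :=
  lebesgue_measurable_fun A f /\
  forall K : set C, K `<=` A -> compact K ->
    (area_integral K (fun z => `|f z|%:E) < +oo)%E.

Definition is_weak_partial (b : bool) A (f g : C -> R) : Prop :=
  loc_integrable A g /\
  forall eta, test_function A eta ->
    area_integral A (fun z => (f z * partial b eta z)%:E) =
    (- area_integral A (fun z => (g z * eta z)%:E))%E.

Definition is_weak_gradient A (f : C -> R) (g : C -> R * R) : Prop :=
  [/\ loc_integrable A f,
      is_weak_partial false A f (fst \o g) &
      is_weak_partial true A f (snd \o g)].

Definition weakly_differentiable A (f : C -> R) : Prop :=
  exists g, is_weak_gradient A f g.

Definition weak_gradient A (f : C -> R) : C -> R * R :=
  xget (fun=> (0, 0)) (is_weak_gradient A f).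

Definition euclidean_norm (v : R * R) : R := Num.sqrt (v.1 ^+ 2 + v.2 ^+ 2).

Definition sobolev_energy A (p : R) (f : C -> R) : \bar R :=
  area_integral A (fun z => (euclidean_norm (weak_gradient A f z) `^ p)%:E).

Definition sobolev_seminorm A (p : R) (f : C -> R) : \bar R :=
  (sobolev_energy A p f `^ p^-1)%E.

Definition in_L1p A (p : R) (f : C -> R) : Prop :=
  weakly_differentiable A f /\ (sobolev_seminorm A p f < +oo)%E.

Definition bounded_composition A B (p q : R) (h : C -> C) : Prop :=
  exists K : R, forall f : C -> R, in_L1p A p f ->
    in_L1p B q (f \o h) /\
    (sobolev_seminorm B q (f \o h) <= K%:E * sobolev_seminorm A p f)%E.

End Plane.

(* Main.v *)
From HB Require Import structures.
Require Import Defs.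
From mathcomp Require Import ring lra measurable_realfun measurable_fun_approximation.
Import Order.TTheory GRing.Theory Num.Theory.
Import numFieldNormedType.Exports.
Set Implicit Arguments.
Unset Strict Implicit.
Unset Printing Implicit Defensive.
Local Open Scope classical_set_scope.
Local Open Scope ring_scope.

(** Let psi be the inverse of phi, a conformal map of the disc D onto Omega.
    By the chain rule the gradient of f o psi has length
    |grad f (psi w)| |psi' w| at w.  Write this product to the power q as
    (|grad f (psi w)| |psi' w|^(2/p))^q times (|psi' w|^(1 - 2/p))^q.
    Hoelder's inequality with exponents p/q and p/(p - q), followed by the
    change of variables z = psi w, whose Jacobian is |psi' w|^2, gives
    for the Sobolev seminorms
      ||f o psi||_q <= ||f||_p (int_D |psi'|^beta)^((p - q)/(p q)),
      where beta = q (p - 2) / (p - q),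
    which is [energy_pullback].  The upper bound on q says precisely that
    alpha0 <= beta < 0 ([exponent_bounds]), so the hypothesis on psi' makes the
    constant finite.

    Two facts carry this computation.

    The weak chain rule ([is_weak_gradient_pullback]).  As f is only weakly
    differentiable, the rule is proved by duality.  For a test function eta on D
    and g = phi' (or g = - i phi' for the y-derivative) the Cauchy-Riemann
    equations for phi and g give
      (d eta)(phi) |phi'|^2 = d_x (Re g . eta o phi) - d_y (Im g . eta o phi),
    see [chain_rule_pointwise].  The two functions on the right are test
    functions on Omega, so the definition of the weak gradient of f applies to
    them, and a change of variables brings both sides back to D.  That they are
    smooth requires phi to be infinitely differentiable although it is only
    assumed to be differentiable at each point: [goursat] leads to Cauchy's
    formula for the derivative ([cauchy_deriv]), and this to [cder_deriv].

    The area formula ([conformal_change]).  Near each point a conformal map is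
    almost affine, so the measure E |-> area (psi E) and the measure with
    density |psi'|^2 have equal densities at every point of D along small
    rectangles.  Their difference is then an additive function of rectangles
    with density 0, and such a function vanishes, by repeated bisection
    ([additive_rect_eq0]).  The same bisection proves [goursat].

    Finally the seminorm is defined from a chosen weak gradient, so weak
    gradients have to be unique almost everywhere ([weak_partial_unique]).  This
    is obtained by testing against explicit bump functions that increase to
    the indicator of a rectangle. *)

(** * The complex modulus and derivatives in epsilon-delta form *)

Section modulus.
Context {R : realType}.
Local Notation C := (Cplane R).
Local Notation N := (@ComplexField.Normc.normc R).
Implicit Types (z w : C).

Lemma normr_cnorm z : `|z| = (N z)%:C%C.
Proof. by rewrite normc_def; case: z. Qed.

Lemma cnorm_ge0 z : 0 <= N z.
Proof. by case: z => a b; rewrite /= sqrtr_ge0. Qed.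

Lemma ler_cnormD z w : N (z + w) <= N z + N w.
Proof. exact: le_normcD. Qed.

Lemma cnormN z : N (- z) = N z.
Proof. exact: normcN. Qed.

Lemma cnorm_distC z w : N (z - w) = N (w - z).
Proof. by rewrite -cnormN opprB. Qed.

Lemma cnormM z w : N (z * w) = N z * N w.
Proof. exact: ComplexField.Normc.normcM. Qed.

Lemma cnormV z : N z^-1 = (N z)^-1.
Proof. exact: ComplexField.Normc.normcV. Qed.

Lemma cnorm0 : N 0 = 0.
Proof. exact: ComplexField.Normc.normc0. Qed.

Lemma cnorm_eq0 z : (N z == 0) = (z == 0).
Proof.
by apply/eqP/eqP => [/ComplexField.Normc.eq0_normc//|->]; exact: cnorm0.
Qed.

Lemma cnorm_gt0 z : (0 < N z) = (z != 0).
Proof. by rewrite lt_def cnorm_ge0 andbT cnorm_eq0. Qed.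

Lemma cnormE z : N z = Num.sqrt (complex.Re z ^+ 2 + complex.Im z ^+ 2).
Proof. by case: z. Qed.

Lemma sqr_cnorm z : N z ^+ 2 = complex.Re z ^+ 2 + complex.Im z ^+ 2.
Proof. by rewrite cnormE sqr_sqrtr// addr_ge0// sqr_ge0. Qed.

Lemma ler_Re_cnorm z : `|complex.Re z| <= N z.
Proof.
by rewrite -[leLHS]sqrtr_sqr cnormE ler_wsqrtr// lerDl sqr_ge0.
Qed.

Lemma ler_Im_cnorm z : `|complex.Im z| <= N z.
Proof.
by rewrite -[leLHS]sqrtr_sqr cnormE ler_wsqrtr// lerDr sqr_ge0.
Qed.

Lemma ler_cnorm_ReIm z : N z <= `|complex.Re z| + `|complex.Im z|.
Proof.
rewrite -(@ler_pXn2r _ 2)// ?nnegrE ?cnorm_ge0 ?addr_ge0//.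
rewrite sqr_cnorm sqrrD !real_normK ?num_real//.
by rewrite lerD2r lerDl mulrn_wge0// mulr_ge0.
Qed.

Lemma cReD z w : complex.Re (z + w) = complex.Re z + complex.Re w.
Proof. by case: z; case: w. Qed.
Lemma cImD z w : complex.Im (z + w) = complex.Im z + complex.Im w.
Proof. by case: z; case: w. Qed.
Lemma cReN z : complex.Re (- z) = - complex.Re z.
Proof. by case: z. Qed.
Lemma cImN z : complex.Im (- z) = - complex.Im z.
Proof. by case: z. Qed.
Lemma cReM z w : complex.Re (z * w) =
  complex.Re z * complex.Re w - complex.Im z * complex.Im w.
Proof. by case: z; case: w. Qed.
Lemma cImM z w : complex.Im (z * w) =
  complex.Re z * complex.Im w + complex.Im z * complex.Re w.
Proof. by case: z => a b; case: w => c d /=; rewrite addrC. Qed.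
Definition ReImE := (cReD, cImD, cReN, cImN, cReM, cImM).

Lemma complex_ext z w :
  complex.Re z = complex.Re w -> complex.Im z = complex.Im w -> z = w.
Proof. by case: z => a b; case: w => c d /= -> ->. Qed.

Lemma toCK : cancel (@toC R) (@ofC R). Proof. by case. Qed.
Lemma ofCK : cancel (@ofC R) (@toC R). Proof. by case. Qed.

Lemma cnbhsP z (P : set C) :
  nbhs z P <-> exists2 e : R, 0 < e & forall w, N (w - z) < e -> P w.
Proof.
rewrite -nbhs_ballE; split.
- move=> [e /= e0 eP]; exists (complex.Re e).
    by move: e0; case: (e) => a b; rewrite ltcE => /= /andP[].
  move=> w Nw; apply: eP; rewrite -ball_normE /ball_/= distrC normr_cnorm.
  move: e0 Nw; case: (e) => a b; rewrite !ltcE /= => /andP[/eqP <- _] Nw.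
  by rewrite eqxx.
- move=> [e e0 eP]; exists e%:C%C; first by rewrite /= ltcE /= eqxx e0.
  move=> w; rewrite -ball_normE /ball_/= distrC normr_cnorm ltcR; exact: eP.
Qed.

Lemma open_discP (A : set C) : open A <->
  forall z, A z -> exists2 e : R, 0 < e & forall w, N (w - z) < e -> A w.
Proof.
rewrite openE; split.
- by move=> oA z Az; apply/cnbhsP; exact: oA.
- by move=> oA z Az; apply/cnbhsP; exact: oA.
Qed.

Lemma continuousCP (f : C -> C) z : {for z, continuous f} <->
  forall e : R, 0 < e -> exists2 d : R, 0 < d &
    forall w, N (w - z) < d -> N (f w - f z) < e.
Proof.
split.
- move=> cf e e0; have : nbhs (f z) [set y | N (y - f z) < e].
    by apply/cnbhsP; exists e.
  by move=> /cf/cnbhsP.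
- move=> H P /cnbhsP[e e0 eP]; have [d d0 dP] := H e e0.
  by apply/cnbhsP; exists d => // w /dP; exact: eP.
Qed.

Lemma continuousRP (f : C -> R) z : {for z, continuous f} <->
  forall e : R, 0 < e -> exists2 d : R, 0 < d &
    forall w, N (w - z) < d -> `|f w - f z| < e.
Proof.
split.
- move=> cf e e0; have : nbhs (f z) [set y | `|y - f z| < e].
    by apply/nbhs_ballP; exists e => // y; rewrite -ball_normE /= distrC.
  by move=> /cf/cnbhsP.
- move=> H P /nbhs_ballP[e /= e0 eP]; have [d d0 dP] := H e e0.
  apply/cnbhsP; exists d => // w /dP; rewrite distrC => ?.
  by apply: eP; rewrite -ball_normE.
Qed.

Lemma toC_continuous : continuous (@toC R).
Proof.
move=> p P /cnbhsP[e e0 eP].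
have e20 : 0 < e / 2 by rewrite divr_gt0.
exists (ball p.1 (e/2), ball p.2 (e/2)) => /=.
  by split; apply: nbhsx_ballx.
move=> [x y] /= [] ; rewrite -!ball_normE /= => h1 h2; apply: eP.
apply: (le_lt_trans (ler_cnorm_ReIm _)); rewrite /toC/=.
by rewrite [e]splitr ltrD// distrC.
Qed.

(** The increment form of complex differentiability at z: it is linear in f
    and needs no punctured neighbourhood, and both facts shorten the estimates
    below. *)
Definition cder (f : C -> C) z (c : C) := forall e : R, 0 < e ->
  exists2 d : R, 0 < d & forall h : C, N h < d ->
    N (f (z + h) - f z - c * h) <= e * N h.

(** Total differentiability of a real function of two real variables, with
    partial derivatives a and b. *)
Definition rdiff (k : C -> R) z (a b : R) := forall e : R, 0 < e ->
  exists2 d : R, 0 < d & forall h : C, N h < d ->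
    `|k (z + h) - k z - (a * complex.Re h + b * complex.Im h)| <= e * N h.

Lemma cder_derive1 f z : derivable f z 1 -> cder f z (derive1 f z).
Proof.
rewrite derive1E /derivable /derive; set l := lim _ => dfz e e0.
have : nbhs l [set y : C | N (y - l) < e] by apply/cnbhsP; exists e.
move=> /dfz /cnbhsP[d d0 dP]; exists d => // h hd.
have [->|h0] := eqVneq h 0; first by rewrite addr0 subrr mulr0 subrr cnorm0 mulr0.
have := dP h; rewrite subr0 => /(_ hd h0) /= /ltW.
rewrite -[leRHS](mulfK (_ : N h != 0)) ?cnorm_eq0// ler_pdivlMr ?cnorm_gt0//.
rewrite -cnormM mulrBl /GRing.scale /= mulr1 mulrAC mulVf// mul1r.
by rewrite [z + h]addrC.
Qed.

Lemma derive1_cder f z c : cder f z c -> derivable f z 1 /\ derive1 f z = c.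
Proof.
move=> fc.
have cv : (fun h : C => h^-1 *: (f (h *: (1:C) + z) - f z)) @ 0^' --> c.
  move=> P /cnbhsP[e e0 eP].
  have [d d0 dP] := fc (e / 2) (divr_gt0 e0 (ltr0n _ 2)).
  apply/cnbhsP; exists d => // h; rewrite subr0 => hd h0; apply: eP.
  have hn : 0 < N h by rewrite cnorm_gt0.
  rewrite -(ltr_pM2r hn) -cnormM mulrBl /GRing.scale /= mulr1 mulrAC mulVf// mul1r.
  rewrite [h + z]addrC; apply: le_lt_trans (dP _ hd) _.
  by rewrite ltr_pM2r// ltr_pdivrMr// ltr_pMr// ltr1n.
split; first by apply/cvg_ex; exists c.
by rewrite derive1E; apply/cvg_lim.
Qed.

End modulus.

(** * Calculus of real and complex differentials *)

Section calculus.
Context {R : realType}.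
Local Notation C := (Cplane R).
Local Notation N := (@ComplexField.Normc.normc R).
Local Notation Re := (@complex.Re R).
Local Notation Im := (@complex.Im R).
Implicit Types (z w h : C) (r s k : C -> R) (f g : C -> C).

(** The remainders negligible with respect to the increment; differentiation
    rules become closure properties of this class. *)
Definition small r := forall e : R, 0 < e -> \forall h \near (0 : C), `|r h| <= e * N h.

Lemma near0P (P : set C) : (\forall h \near (0 : C), P h) <->
  exists2 d : R, 0 < d & forall h, N h < d -> P h.
Proof.
split=> [/cnbhsP[d d0 dP]|[d d0 dP]].
  by exists d => // h hd; apply: dP; rewrite subr0.
by apply/cnbhsP; exists d => // h; rewrite subr0; exact: dP.
Qed.

Lemma near0T (P : set C) : (forall h, P h) -> \forall h \near (0 : C), P h.
Proof. by move=> Ph; apply/near0P; exists 1. Qed.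

Lemma rdiffE k z a b : rdiff k z a b <->
  small (fun h => k (z + h) - k z - (a * Re h + b * Im h)).
Proof. by split=> H e /H/near0P. Qed.

Lemma small_le r s (M : R) : (\forall h \near (0 : C), `|r h| <= M * `|s h|) ->
  small s -> small r.
Proof.
move=> rs ss e e0; have M1 : 0 < `|M| + 1 by rewrite ltr_wpDl.
have ss' := ss (e / (`|M| + 1)) (divr_gt0 e0 M1).
apply: filterS2 rs ss' => h rh sh; apply: (le_trans rh).
apply: (@le_trans _ _ ((`|M| + 1) * `|s h|)).
  by apply: ler_wpM2r => //; rewrite (le_trans (ler_norm _))// lerDl.
by rewrite -ler_pdivlMl// mulrA [_^-1 * _]mulrC.
Qed.

Lemma smallD r s : small r -> small s -> small (fun h => r h + s h).
Proof.
move=> sr ss e e0; have e20 : 0 < e / 2 by rewrite divr_gt0.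
apply: filterS2 (sr _ e20) (ss _ e20) => h rh sh.
by rewrite (le_trans (ler_normD _ _))// [e]splitr mulrDl lerD.
Qed.

Lemma small_quad r (M : R) : (\forall h \near (0 : C), `|r h| <= M * N h ^+ 2) ->
  small r.
Proof.
move=> rM e e0; have M1 : 0 < `|M| + 1 by rewrite ltr_wpDl.
have : \forall h \near (0 : C), N h < e / (`|M| + 1).
  by apply/near0P; exists (e / (`|M| + 1)) => //; rewrite divr_gt0.
move=> H; apply: filterS2 rM H => h rh; rewrite ltr_pdivlMr// => hd.
apply: (le_trans rh); rewrite expr2 mulrA ler_wpM2r ?cnorm_ge0//.
apply: le_trans (ltW hd); rewrite mulrC ler_wpM2l ?cnorm_ge0//.
by rewrite (le_trans (ler_norm _))// lerDl.
Qed.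

Lemma small_eq r s : r =1 s -> small r -> small s.
Proof. by move=> rs sr e /sr; apply: filterS => h; rewrite rs. Qed.

Lemma lin_le (a b : R) h : `|a * Re h + b * Im h| <= (`|a| + `|b|) * N h.
Proof.
rewrite (le_trans (ler_normD _ _))// mulrDl !normrM lerD//.
  by apply: ler_wpM2l => //; exact: ler_Re_cnorm.
by apply: ler_wpM2l => //; exact: ler_Im_cnorm.
Qed.

Lemma rdiff_lip k z a b : rdiff k z a b -> exists2 M : R, 0 < M &
  \forall h \near (0 : C), `|k (z + h) - k z| <= M * N h.
Proof.
move=> /rdiffE/(_ 1 ltr01) H; exists (`|a| + `|b| + 1); first by rewrite ltr_wpDl.
apply: filterS H => h kh.
rewrite -[X in `|X|](subrK (a * Re h + b * Im h)) (le_trans (ler_normD _ _))//.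
by rewrite mulrDl addrC lerD// lin_le.
Qed.

Lemma rdiff_cont k z a b : rdiff k z a b -> {for z, continuous k}.
Proof.
move=> /rdiff_lip[M M0 /near0P[d d0 dP]]; apply/continuousRP => e e0.
exists (Order.min d (e / M)); first by rewrite lt_min d0 divr_gt0.
move=> w; rewrite lt_min => /andP[wd we].
have := dP _ wd; rewrite [z + _]addrC subrK => /le_lt_trans; apply.
by rewrite mulrC -ltr_pdivlMr.
Qed.

Lemma rdiff_near k l z a b : (\forall w \near z, k w = l w) ->
  rdiff k z a b -> rdiff l z a b.
Proof.
move=> /cnbhsP[d d0 kl] /rdiffE rk; apply/rdiffE => e /rk re.
have H : \forall h \near (0 : C), N h < d by apply/near0P; exists d.
apply: filterS2 re H => h kh hd; rewrite -!kl//; first by rewrite subrr cnorm0.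
by rewrite addrAC subrr add0r.
Qed.

Lemma rdiff_cst (c : R) z : rdiff (fun=> c) z 0 0.
Proof.
apply/rdiffE => e e0; apply: near0T => h.
by rewrite !mul0r addr0 subrr subr0 normr0 mulr_ge0 ?cnorm_ge0// ltW.
Qed.

Lemma rdiff_Re z : rdiff Re z 1 0.
Proof.
apply/rdiffE => e e0; apply: near0T => h; rewrite cReD.
rewrite (_ : _ - _ - _ = 0) ?normr0 ?mulr_ge0 ?cnorm_ge0// ?ltW//; ring.
Qed.

Lemma rdiff_Im z : rdiff Im z 0 1.
Proof.
apply/rdiffE => e e0; apply: near0T => h; rewrite cImD.
rewrite (_ : _ - _ - _ = 0) ?normr0 ?mulr_ge0 ?cnorm_ge0// ?ltW//; ring.
Qed.

Lemma rdiffD k l z a b a' b' : rdiff k z a b -> rdiff l z a' b' ->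
  rdiff (fun w => k w + l w) z (a + a') (b + b').
Proof.
move=> /rdiffE rk /rdiffE rl; apply/rdiffE.
by apply: small_eq (smallD rk rl) => h; ring.
Qed.

Lemma rdiffM k l z a b a' b' : rdiff k z a b -> rdiff l z a' b' ->
  rdiff (fun w => k w * l w) z (a * l z + k z * a') (b * l z + k z * b').
Proof.
move=> rk0 rl0; have [M M0 lipM] := rdiff_lip rk0.
move: rk0 rl0 => /rdiffE rk /rdiffE rl; apply/rdiffE.
pose rk1 h := k (z + h) - k z - (a * Re h + b * Im h).
pose rl1 h := l (z + h) - l z - (a' * Re h + b' * Im h).
have b1 : \forall h \near (0 : C), N h < 1 by apply/near0P; exists 1.
have s1 : small (fun h => k (z + h) * rl1 h).
  apply: (@small_le _ rl1 (`|k z| + M)) => //; apply: filterS2 lipM b1 => h kh h1.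
  rewrite normrM ler_wpM2r//; apply: (@le_trans _ _ (`|k z| + M * N h)).
    by rewrite -[k (z + h)](subrKC (k z)) (le_trans (ler_normD _ _))// lerD2l.
  by rewrite lerD2l ler_piMr ?ltW.
have s2 : small (fun h => rk1 h * (l z + (a' * Re h + b' * Im h))).
  apply: (@small_le _ rk1 (`|l z| + (`|a'| + `|b'|))) => //.
  apply: filterS b1 => h h1; rewrite normrM mulrC ler_wpM2r//.
  rewrite (le_trans (ler_normD _ _))// lerD2l (le_trans (lin_le _ _ _))//.
  by rewrite ler_piMr ?addr_ge0// ltW.
have s3 : small (fun h => (a * Re h + b * Im h) * (a' * Re h + b' * Im h)).
  apply: (@small_quad _ ((`|a| + `|b|) * (`|a'| + `|b'|))); apply: near0T => h.
  rewrite normrM expr2 mulrACA ler_pM//; exact: lin_le.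
by apply: small_eq (smallD s1 (smallD s2 s3)) => h; rewrite /rk1 /rl1; ring.
Qed.

(** The remainder of the composite is the remainder of k at the increment of f,
    small because f is Lipschitz at z, plus the remainders of the two components
    of f multiplied by constants. *)
Lemma rdiff_comp k f z a b u1 u2 v1 v2 :
  rdiff (Re \o f) z u1 u2 -> rdiff (Im \o f) z v1 v2 ->
  rdiff k (f z) a b ->
  rdiff (k \o f) z (a * u1 + b * v1) (a * u2 + b * v2).
Proof.
move=> ru0 rv0; have [M M0 lipM] := rdiff_lip ru0; have [M' M'0 lipM'] := rdiff_lip rv0.
move: ru0 rv0 => /rdiffE ru /rdiffE rv rk; apply/rdiffE.
have lipf : \forall h \near (0 : C), N (f (z + h) - f z) <= (M + M') * N h.
  apply: filterS2 lipM lipM' => h h1 h2; rewrite (le_trans (ler_cnorm_ReIm _))//.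
  by rewrite mulrDl cReD cImD cReN cImN lerD.
have MM : 0 < M + M' by rewrite addr_gt0.
have s1 : small (fun h => k (f (z + h)) - k (f z) -
   (a * Re (f (z + h) - f z) + b * Im (f (z + h) - f z))).
  move=> e e0; have [d d0 dP] := rk (e / (M + M')) (divr_gt0 e0 MM).
  have b1 : \forall h \near (0 : C), N h < d / (M + M').
    by apply/near0P; exists (d / (M + M')) => //; rewrite divr_gt0.
  apply: filterS2 lipf b1 => h fh; rewrite ltr_pdivlMr// => hd.
  have fd : N (f (z + h) - f z) < d by apply: le_lt_trans fh _; rewrite mulrC.
  have := dP _ fd; rewrite (subrKC (f z)) => /le_trans; apply.
  by rewrite -mulrA ler_pM2l// ler_pdivrMl.
have s2 : small (fun h => a * (Re (f (z + h)) - Re (f z) - (u1 * Re h + u2 * Im h))).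
  by apply: (@small_le _ _ `|a|) ru; apply: near0T => h /=; rewrite normrM.
have s3 : small (fun h => b * (Im (f (z + h)) - Im (f z) - (v1 * Re h + v2 * Im h))).
  by apply: (@small_le _ _ `|b|) rv; apply: near0T => h /=; rewrite normrM.
apply: small_eq (smallD s1 (smallD s2 s3)) => h.
by rewrite /= !cReD !cImD !cReN !cImN; ring.
Qed.

(** The Cauchy-Riemann equations, which reduce every rule for complex
    derivatives to the rules for real differentials. *)
Lemma cderP f z c : cder f z c <->
  rdiff (Re \o f) z (Re c) (- Im c) /\ rdiff (Im \o f) z (Im c) (Re c).
Proof.
split=> [fc|[/rdiffE ru /rdiffE rv]].
  split=> e /fc[d d0 dP]; exists d => // h /dP; apply: le_trans => /=.
    apply: le_trans (ler_Re_cnorm _); rewrite !ReImE.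
    by rewrite le_eqVlt; apply/orP; left; apply/eqP; congr `|_|; ring.
  apply: le_trans (ler_Im_cnorm _); rewrite !ReImE.
  by rewrite le_eqVlt; apply/orP; left; apply/eqP; congr `|_|; ring.
move=> e e0; apply/near0P; have e20 : 0 < e / 2 by rewrite divr_gt0.
apply: filterS2 (ru _ e20) (rv _ e20) => h hu hv.
rewrite (le_trans (ler_cnorm_ReIm _))// [e]splitr mulrDl lerD//.
  apply: le_trans hu; rewrite !ReImE /=.
  by rewrite le_eqVlt; apply/orP; left; apply/eqP; congr `|_|; ring.
apply: le_trans hv; rewrite !ReImE /=.
by rewrite le_eqVlt; apply/orP; left; apply/eqP; congr `|_|; ring.
Qed.

Lemma rdiff_val k z a b a' b' : a = a' -> b = b' -> rdiff k z a b -> rdiff k z a' b'.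
Proof. by move=> -> ->. Qed.

Lemma rdiff_ext k l z a b : k =1 l -> rdiff k z a b -> rdiff l z a b.
Proof. by move=> /funext ->. Qed.

Lemma rdiffZ k z (c a b : R) : rdiff k z a b -> rdiff (fun w => c * k w) z (c * a) (c * b).
Proof.
by move=> /(rdiffM (rdiff_cst c z)); apply: rdiff_val; ring.
Qed.

Lemma rdiff_compc k f z a b c : cder f z c -> rdiff k (f z) a b ->
  rdiff (k \o f) z (a * Re c + b * Im c) (b * Re c - a * Im c).
Proof.
move=> /cderP[ru rv] rk; apply: rdiff_val (rdiff_comp ru rv rk) => //; ring.
Qed.

Lemma cder_comp f g z c c' : cder f z c -> cder g (f z) c' ->
  cder (g \o f) z (c' * c).
Proof.
move=> fc /cderP[gu gv]; apply/cderP; split.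
  by apply: rdiff_val (rdiff_compc fc gu); rewrite !ReImE; ring.
by apply: rdiff_val (rdiff_compc fc gv); rewrite !ReImE; ring.
Qed.

Lemma cderD f g z c c' : cder f z c -> cder g z c' ->
  cder (fun w => f w + g w) z (c + c').
Proof.
move=> /cderP[fu fv] /cderP[gu gv]; apply/cderP; split.
  apply: rdiff_ext (rdiff_val _ _ (rdiffD fu gu)) => [w|//|]; rewrite /= ?ReImE//; ring.
apply: rdiff_ext (rdiff_val _ _ (rdiffD fv gv)) => [w|//|]; rewrite /= ?ReImE//; ring.
Qed.

Lemma cderM f g z c c' : cder f z c -> cder g z c' ->
  cder (fun w => f w * g w) z (c * g z + f z * c').
Proof.
move=> /cderP[fu fv] /cderP[gu gv]; apply/cderP; split.
  apply: rdiff_ext (rdiff_val _ _ (rdiffD (rdiffM fu gu) (rdiffZ (-1) (rdiffM fv gv)))).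
  - by move=> w; rewrite /= ?ReImE; ring.
  - by rewrite /= ?ReImE; ring.
  - by rewrite /= ?ReImE; ring.
apply: rdiff_ext (rdiff_val _ _ (rdiffD (rdiffM fu gv) (rdiffM fv gu))).
- by move=> w; rewrite /= ?ReImE; ring.
- by rewrite /= ?ReImE; ring.
- by rewrite /= ?ReImE; ring.
Qed.

Lemma cder_cst c z : cder (fun=> c) z 0.
Proof.
by apply/cderP; split; apply: rdiff_val (rdiff_cst _ _) => //=; rewrite oppr0.
Qed.

Lemma cder_id z : cder id z 1.
Proof.
apply/cderP; split.
  by apply: rdiff_val (rdiff_Re _) => //=; rewrite oppr0.
exact: rdiff_Im.
Qed.

Lemma cder_val f z c c' : c = c' -> cder f z c -> cder f z c'.
Proof. by move=> ->. Qed.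

Lemma cder_ext f g z c : f =1 g -> cder f z c -> cder g z c.
Proof. by move=> /funext ->. Qed.

Lemma cderZ f z a c : cder f z c -> cder (fun w => a * f w) z (a * c).
Proof. by move=> /(cderM (cder_cst a z)); apply: cder_val; rewrite mul0r add0r. Qed.

Lemma cder_lip f z c : cder f z c -> exists2 M : R, 0 < M &
  \forall h \near (0 : C), N (f (z + h) - f z) <= M * N h.
Proof.
move=> /cderP[/rdiff_lip[M M0 lipM] /rdiff_lip[M' M'0 lipM']].
exists (M + M'); first by rewrite addr_gt0.
apply: filterS2 lipM lipM' => h h1 h2; rewrite (le_trans (ler_cnorm_ReIm _))//.
by rewrite mulrDl cReD cImD cReN cImN lerD.
Qed.

Lemma cder_cont f z c : cder f z c -> {for z, continuous f}.
Proof.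
move=> /cder_lip[M M0 /near0P[d d0 dP]]; apply/continuousCP => e e0.
exists (Order.min d (e / M)); first by rewrite lt_min d0 divr_gt0.
move=> w; rewrite lt_min => /andP[wd we].
have := dP _ wd; rewrite [z + _]addrC subrK => /le_lt_trans; apply.
by rewrite mulrC -ltr_pdivlMr.
Qed.

Lemma rdiff_line k z v a b (t0 : R) : rdiff k (z + t0%:C%C * v) a b ->
  is_derive t0 1 (fun t : R => k (z + t%:C%C * v)) (a * Re v + b * Im v).
Proof.
move=> rk.
have cv : (fun h : R => h^-1 *: (k (z + (h *: (1:R) + t0)%:C%C * v) - k (z + t0%:C%C * v))) @ 0^'
    --> a * Re v + b * Im v.
  move=> P /nbhs_ballP[e /= e0 eP].
  have v1 : 0 < N v + 1 by rewrite ltr_wpDl ?cnorm_ge0.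
  have e2 : 0 < e / (N v + 1) / 2 by rewrite !divr_gt0.
  have [d d0 dP] := rk _ e2.
  apply/nbhs_ballP; exists (d / (N v + 1)) => /=; first by rewrite divr_gt0.
  move=> h; rewrite -ball_normE /= sub0r normrN => hd h0; apply: eP.
  rewrite -ball_normE /= distrC.
  have Nh : N (h%:C%C * v) = `|h| * N v.
    by rewrite cnormM; congr (_ * _); rewrite cnormE /= expr0n addr0 sqrtr_sqr.
  have hv : N (h%:C%C * v) < d.
    rewrite Nh; rewrite ltr_pdivlMr// in hd; apply: le_lt_trans hd.
    by rewrite ler_wpM2l// lerDl.
  have := dP _ hv; rewrite Nh.
  have -> : z + t0%:C%C * v + h%:C%C * v = z + (h *: (1:R) + t0)%:C%C * v.
    by rewrite /GRing.scale/= mulr1 -addrA -mulrDl -rmorphD [h + t0]addrC.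
  set D := k _ - k _ => HD.
  have h00 : 0 < `|h| by rewrite normr_gt0.
  rewrite -(ltr_pM2l h00) -normrM mulrBr.
  have -> : h * (h^-1 *: D) = D by rewrite /GRing.scale /= mulrA divff// mul1r.
  have -> : h * (a * Re v + b * Im v) = a * Re (h%:C%C * v) + b * Im (h%:C%C * v).
    by rewrite !ReImE /=; ring.
  apply: (le_lt_trans HD); rewrite mulrCA ltr_pM2l//.
  have E : e = e / (N v + 1) * (N v + 1) by rewrite divfK// lt0r_neq0.
  have q0 : 0 < e / (N v + 1) by rewrite divr_gt0.
  have n0 := cnorm_ge0 v; rewrite [X in _ < X]E.
  by move: q0 n0 {E HD hv Nh hd e2}; set q := e / _; set n := N v => q0 n0; nra.
apply: DeriveDef; first by apply/cvg_ex; exists (a * Re v + b * Im v).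
by apply/cvg_lim.
Qed.

End calculus.

(** * Additive functions of rectangles *)

(** If mu of the rectangle [a, b] x [c, d] were nonzero, then at each stage of
    a repeated division into quarters one of them would keep its share,
    |mu Q| > e |Q| for a fixed e > 0.  These quarters shrink to a point that
    they all contain, which contradicts the density 0 of mu at that point.
    Only rectangles similar to the initial one occur, and [loc] speaks of no
    others. *)
Section bisection.
Context {R : realType}.
Variables (mu : R -> R -> R -> R -> R) (a b c d : R).
Hypotheses (ab : a < b) (cd : c < d).
Hypothesis addx : forall x1 x2 x3 y1 y2,
  a <= x1 -> x1 < x2 -> x2 < x3 -> x3 <= b -> c <= y1 -> y1 < y2 -> y2 <= d ->
  mu x1 x3 y1 y2 = mu x1 x2 y1 y2 + mu x2 x3 y1 y2.
Hypothesis addy : forall x1 x2 y1 y2 y3,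
  a <= x1 -> x1 < x2 -> x2 <= b -> c <= y1 -> y1 < y2 -> y2 < y3 -> y3 <= d ->
  mu x1 x2 y1 y3 = mu x1 x2 y1 y2 + mu x1 x2 y2 y3.
Hypothesis loc : forall x y, a <= x <= b -> c <= y <= d ->
  forall e, 0 < e -> exists2 r : R, 0 < r & forall t x1 y1, 0 < t < r ->
    a <= x1 -> x1 <= x -> x <= x1 + (b - a) * t -> x1 + (b - a) * t <= b ->
    c <= y1 -> y1 <= y -> y <= y1 + (d - c) * t -> y1 + (d - c) * t <= d ->
    `|mu x1 (x1 + (b - a) * t) y1 (y1 + (d - c) * t)| <= e * t ^+ 2.

Let h (n : nat) : R := 2 ^- n.
Let inb n (p : R * R) := [/\ a <= p.1, p.1 + (b - a) * h n <= b,
  c <= p.2 & p.2 + (d - c) * h n <= d].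
Let bad e n p := inb n p /\
  e * h n ^+ 2 < `|mu p.1 (p.1 + (b - a) * h n) p.2 (p.2 + (d - c) * h n)|.

Let h_gt0 n : 0 < h n. Proof. by rewrite invr_gt0 exprn_gt0. Qed.
Let hS n : h n = h n.+1 * 2.
Proof. by rewrite /h exprS invfM mulrAC mulVf ?mul1r// pnatr_eq0. Qed.

Let step e n p : 0 < e -> bad e n p -> exists p', bad e n.+1 p' /\
  [/\ p.1 <= p'.1, p'.1 + (b - a) * h n.+1 <= p.1 + (b - a) * h n,
      p.2 <= p'.2 & p'.2 + (d - c) * h n.+1 <= p.2 + (d - c) * h n].
Proof.
rewrite /bad /inb; case: p => x y e0 [[/= ax xb cy yd]]; rewrite !(hS n) in xb yd *.
have := h_gt0 n.+1; move: (h n.+1) xb yd => t xb yd t0 muL.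
have bt : 0 < (b - a) * t by rewrite mulr_gt0 ?subr_gt0.
have dt : 0 < (d - c) * t by rewrite mulr_gt0 ?subr_gt0.
set s := (b - a) * t in bt *; set u := (d - c) * t in dt *.
rewrite !mulrA -/s -/u in muL xb yd *.
have E : mu x (x + s * 2) y (y + u * 2) =
  mu x (x + s) y (y + u) + mu (x + s) (x + s + s) y (y + u) +
  (mu x (x + s) (y + u) (y + u + u) + mu (x + s) (x + s + s) (y + u) (y + u + u)).
  rewrite (_ : x + s * 2 = x + s + s); last by ring.
  rewrite (_ : y + u * 2 = y + u + u); last by ring.
  rewrite (@addy _ _ y (y + u)); [|lra..].
  have E1 : mu x (x + s + s) y (y + u) = mu x (x + s) y (y + u) +
    mu (x + s) (x + s + s) y (y + u) by apply: addx; lra.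
  have E2 : mu x (x + s + s) (y + u) (y + u + u) = mu x (x + s) (y + u) (y + u + u) +
    mu (x + s) (x + s + s) (y + u) (y + u + u) by apply: addx; lra.
  by rewrite E1 E2.
have key : [\/ e * t ^+ 2 < `|mu x (x + s) y (y + u)|,
  e * t ^+ 2 < `|mu (x + s) (x + s + s) y (y + u)|,
  e * t ^+ 2 < `|mu x (x + s) (y + u) (y + u + u)| |
  e * t ^+ 2 < `|mu (x + s) (x + s + s) (y + u) (y + u + u)|].
  have [k1|k1] := ltP (e * t ^+ 2) `|mu x (x + s) y (y + u)|; first exact: Or41.
  have [k2|k2] := ltP (e * t ^+ 2) `|mu (x + s) (x + s + s) y (y + u)|;
    first exact: Or42.
  have [k3|k3] := ltP (e * t ^+ 2) `|mu x (x + s) (y + u) (y + u + u)|;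
    first exact: Or43.
  apply: Or44; rewrite ltNge; apply/negP => k4.
  move: muL; rewrite ltNge => /negP; apply.
  rewrite E (_ : e * t * 2 * t * 2 = e * t ^+ 2 + e * t ^+ 2 + (e * t ^+ 2 + e * t ^+ 2));
    last by ring.
  rewrite (le_trans (ler_normD _ _))// lerD//;
    by rewrite (le_trans (ler_normD _ _))// lerD.
case: key => k; rewrite expr2 mulrA in k.
- by exists (x, y); split; [split; [split|]|split] => //=; lra.
- by exists (x + s, y); split; [split; [split|]|split] => //=; lra.
- by exists (x, y + u); split; [split; [split|]|split] => //=; lra.
- by exists (x + s, y + u); split; [split; [split|]|split] => //=; lra.
Qed.

(** The corners of the successive bad quarters increase in both coordinates, so
    they converge to their suprema, a point that belongs to all the
    quarters. *)
Lemma additive_rect_eq0 : mu a b c d = 0.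
Proof.
apply/eqP/negPn/negP => mu0; set e := `|mu a b c d| / 2.
have e0 : 0 < e by rewrite divr_gt0// normr_gt0.
have bad0 : bad e 0 (a, c).
  rewrite /bad /inb /h /= expr0 invr1 !mulr1 !subrKC expr1n mulr1; split => //.
  by rewrite /e ltr_pdivrMr// ltr_pMr ?normr_gt0// ltr1n.
have /choice[f fP] : forall np : nat * (R * R), exists p', bad e np.1 np.2 ->
   bad e np.1.+1 p' /\
  [/\ np.2.1 <= p'.1, p'.1 + (b - a) * h np.1.+1 <= np.2.1 + (b - a) * h np.1,
      np.2.2 <= p'.2 & p'.2 + (d - c) * h np.1.+1 <= np.2.2 + (d - c) * h np.1].
  move=> np; have [/step-/(_ e0)[p' ?]|nb] := pselect (bad e np.1 np.2); first by exists p'.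
  by exists (0, 0).
pose fix u (n : nat) : R * R := if n is m.+1 then f (m, u m) else (a, c).
have badu n : bad e n (u n).
  by elim: n => [|n IH]; [exact: bad0|have [] := fP (n, u n) IH].
have mono n m : (n <= m)%N -> [/\ (u n).1 <= (u m).1,
   (u m).1 + (b - a) * h m <= (u n).1 + (b - a) * h n,
   (u n).2 <= (u m).2 & (u m).2 + (d - c) * h m <= (u n).2 + (d - c) * h n].
  elim: m => [|m IH]; first by rewrite leqn0 => /eqP ->.
  rewrite leq_eqVlt => /predU1P[->//|/IH[i1 i2 i3 i4]].
  have [_ /= [j1 j2 j3 j4]] := fP (m, u m) (badu m).
  by split; [exact: le_trans j1|exact: le_trans i2|exact: le_trans j3|exact: le_trans i4].
have ba : 0 < b - a by rewrite subr_gt0.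
have dc : 0 < d - c by rewrite subr_gt0.
have cross n m : (u n).1 <= (u m).1 + (b - a) * h m /\ (u n).2 <= (u m).2 + (d - c) * h m.
  have [nm|mn] := leqP n m.
    have [i1 _ i3 _] := mono _ _ nm.
    by split; [apply: (le_trans i1)|apply: (le_trans i3)]; rewrite lerDl mulr_ge0// ltW.
  have [_ i2 _ i4] := mono _ _ (ltnW mn).
  split; [apply: le_trans i2|apply: le_trans i4]; by rewrite lerDl mulr_ge0// ltW.
pose X := sup (range (fun n => (u n).1)); pose Y := sup (range (fun n => (u n).2)).
have uX n : (u n).1 <= X <= (u n).1 + (b - a) * h n.
  apply/andP; split.
    apply: ub_le_sup; last by exists n.
    by exists ((u 0%N).1 + (b - a) * h 0) => _ [m _ <-]; have [] := cross m 0%N.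
  apply: ge_sup; first by exists (u 0%N).1, 0%N.
  by move=> _ [m _ <-]; have [] := cross m n.
have uY n : (u n).2 <= Y <= (u n).2 + (d - c) * h n.
  apply/andP; split.
    apply: ub_le_sup; last by exists n.
    by exists ((u 0%N).2 + (d - c) * h 0) => _ [m _ <-]; have [] := cross m 0%N.
  apply: ge_sup; first by exists (u 0%N).2, 0%N.
  by move=> _ [m _ <-]; have [] := cross m n.
have Xab : a <= X <= b.
  have /andP[x1 x2] := uX 0%N; have [[/= ax xb _ _] _] := badu 0%N.
  by rewrite (le_trans ax)// (le_trans x2).
have Ycd : c <= Y <= d.
  have /andP[x1 x2] := uY 0%N; have [[/= _ _ ax xb] _] := badu 0%N.
  by rewrite (le_trans ax)// (le_trans x2).
have [r r0 rP] := loc Xab Ycd e0.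
have [n hn] : exists n, h n < r.
  have /cvgrPdist_lt/(_ _ r0)[n _ nP] : (fun n => h n) @ \oo --> (0 : R).
    have -> : h = (fun n => (1 / 2 : R) ^+ n).
      by apply/funext => m; rewrite /h -exprVn div1r.
    by apply: cvg_expr; rewrite ger0_norm ?divr_ge0// ltr_pdivrMr// mul1r ltr1n.
  exists n; have := nP n (leqnn n); rewrite /= sub0r normrN ger0_norm//.
  exact/ltW/h_gt0.
have [[k1 k2 k3 k4]] := badu n.
have /andP[x1 x2] := uX n; have /andP[y1 y2] := uY n.
by rewrite ltNge rP// h_gt0.
Qed.

End bisection.

(** * Goursat's theorem on rectangles *)

Section segment_integral.
Context {R : realType}.
Implicit Types (f g : R -> R) (a b c : R).

Definition segint f a b : R := Rintegral (@lebesgue_measure R) `[a, b] f.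

Definition conton f a b := {within `[a, b], continuous (f : R -> R)}.

Lemma conton_integrable f a b : conton f a b ->
  (@lebesgue_measure R).-integrable `[a, b] (EFin \o f).
Proof. by move=> cf; apply: continuous_compact_integrable => //; exact: segment_compact. Qed.

Lemma contonS f a b a' b' : a <= a' -> b' <= b -> conton f a b -> conton f a' b'.
Proof.
move=> aa bb; apply: continuous_subspaceW => x /=.
by rewrite !in_itv/= => /andP[h1 h2]; rewrite (le_trans aa)// (le_trans h2).
Qed.

Lemma segint_cat f a b c : a <= b -> b <= c -> conton f a c ->
  segint f a c = segint f a b + segint f b c.
Proof.
move=> ab bc cf.
have := Rintegral_itvB (conton_integrable cf) (x := b); rewrite !bnd_simp.
move=> /(_ ab bc) E; rewrite -(subrKC (segint f a b) (segint f a c)); congr (_ + _).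
rewrite /segint E Rintegral_itv_obnd_cbnd//.
apply: integrableS (conton_integrable cf) => //=.
by apply: subset_itvScc; rewrite bnd_simp.
Qed.

Lemma segintB f g a b : conton f a b -> conton g a b ->
  segint (fun x => f x - g x) a b = segint f a b - segint g a b.
Proof.
by move=> cf cg; rewrite /segint RintegralB//; exact: conton_integrable.
Qed.

Lemma segintD f g a b : conton f a b -> conton g a b ->
  segint (fun x => f x + g x) a b = segint f a b + segint g a b.
Proof.
by move=> cf cg; rewrite /segint RintegralD//; exact: conton_integrable.
Qed.

Lemma segintZ f (k : R) a b : conton f a b ->
  segint (fun x => k * f x) a b = k * segint f a b.
Proof.
by move=> cf; rewrite /segint RintegralZl//; exact: conton_integrable.
Qed.

Lemma segint_cst (k : R) a b : a <= b -> segint (fun=> k) a b = k * (b - a).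
Proof.
move=> ab; rewrite /segint Rintegral_cst//; congr (_ * _).
have := @lebesgue_measure_itv R `[a, b]; rewrite /= => ->.
by rewrite lte_fin; case: ltgtP ab => // ->; rewrite subrr.
Qed.

Lemma conton_cst (k a b : R) : conton (fun=> k) a b.
Proof. by apply: continuous_subspaceT => x; exact: cvg_cst. Qed.

Lemma le_segint f g a b : conton f a b -> conton g a b ->
  (forall x, a <= x <= b -> f x <= g x) -> segint f a b <= segint g a b.
Proof.
move=> cf cg fg; apply: le_Rintegral => //; try exact: conton_integrable.
Qed.

Lemma eq_segint f g a b : (forall x, a <= x <= b -> f x = g x) ->
  segint f a b = segint g a b.
Proof.
by move=> fg; apply: eq_Rintegral => x; rewrite inE/= in_itv/=; exact: fg.
Qed.

Lemma segint_le (M : R) f a b : a <= b -> conton f a b ->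
  (forall x, a <= x <= b -> `|f x| <= M) -> `|segint f a b| <= M * (b - a).
Proof.
move=> ab cf fM; rewrite ler_norml; apply/andP; split.
  rewrite -mulNr -segint_cst//; apply: le_segint => //; first exact: conton_cst.
  by move=> x /fM; rewrite ler_norml => /andP[].
rewrite -segint_cst//; apply: le_segint => //; first exact: conton_cst.
by move=> x /fM; rewrite ler_norml => /andP[].
Qed.

End segment_integral.

Lemma cont_Complex {R : realType} (u v : R -> R) t :
  {for t, continuous u} -> {for t, continuous v} ->
  {for t, continuous (fun s => Complex (u s) (v s) : Cplane R)}.
Proof.
move=> cu cv P /cnbhsP[e e0 eP]; have e20 : 0 < e / 2 by rewrite divr_gt0.
have hu : \forall s \near t, ball (u t) (e / 2) (u s).
  exact: (cu _ (nbhsx_ballx (u t) (e / 2) e20)).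
have hv : \forall s \near t, ball (v t) (e / 2) (v s).
  exact: (cv _ (nbhsx_ballx (v t) (e / 2) e20)).
apply: filterS2 hu hv => s; rewrite -!ball_normE/= => hu hv.
apply: eP; apply: (le_lt_trans (ler_cnorm_ReIm _)) => /=.
by rewrite [e]splitr ltrD// distrC.
Qed.

(** The form P dx + Q dy is closed at each point, but the derivatives of P and
    Q may be discontinuous, so Green's formula is out of reach.  The integral
    along the boundary is an additive function of the rectangle; subtracting the
    affine parts of P and Q at a point, whose boundary integral is 0, shows that
    it has density 0 there. *)
Section goursat.
Context {R : realType}.
Local Notation C := (Cplane R).
Local Notation N := (@ComplexField.Normc.normc R).
Variables (P Q : C -> R) (a b c d : R).
Hypotheses (ab : a < b) (cd : c < d).
Hypothesis closedPQ : forall x y, a <= x <= b -> c <= y <= d ->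
  exists p q r, rdiff P (Complex x y) p q /\ rdiff Q (Complex x y) q r.

Let ptC (x y : R) : C := Complex x y.

Let cP x y : a <= x <= b -> c <= y <= d -> {for ptC x y, continuous P}.
Proof. by move=> hx hy; have [p [q [r [/rdiff_cont]]]] := closedPQ hx hy. Qed.

Let cQ x y : a <= x <= b -> c <= y <= d -> {for ptC x y, continuous Q}.
Proof. by move=> hx hy; have [p [q [r [_ /rdiff_cont]]]] := closedPQ hx hy. Qed.

Let conPx y : c <= y <= d -> conton (fun x => P (ptC x y)) a b.
Proof.
move=> hy; apply: continuous_in_subspaceT => x.
rewrite inE/= in_itv/= => hx; apply: (continuous_comp (g := P) (f := fun x => ptC x y)).
  by apply: cont_Complex; [exact: cvg_id|exact: cvg_cst].
exact: cP.
Qed.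

Let conQy x : a <= x <= b -> conton (fun y => Q (ptC x y)) c d.
Proof.
move=> hx; apply: continuous_in_subspaceT => y.
rewrite inE/= in_itv/= => hy; apply: (continuous_comp (g := Q) (f := fun y => ptC x y)).
  by apply: cont_Complex; [exact: cvg_cst|exact: cvg_id].
exact: cQ.
Qed.

Let mu x1 x2 y1 y2 :=
  (segint (fun x => P (ptC x y1)) x1 x2 - segint (fun x => P (ptC x y2)) x1 x2) +
  (segint (fun y => Q (ptC x2 y)) y1 y2 - segint (fun y => Q (ptC x1 y)) y1 y2).

Lemma goursat :
  segint (fun x => P (ptC x c)) a b + segint (fun y => Q (ptC b y)) c d =
  segint (fun x => P (ptC x d)) a b + segint (fun y => Q (ptC a y)) c d.
Proof.
suff : mu a b c d = 0.
  rewrite /mu; move: (segint _ _ _) (segint _ _ _) (segint _ _ _) (segint _ _ _).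
  by move=> A B D E; lra.
apply: (additive_rect_eq0 ab cd).
- move=> x1 x2 x3 y1 y2 ax x12 x23 xb cy y12 yd.
  have cy1 : c <= y1 <= d by apply/andP; split; lra.
  have cy2 : c <= y2 <= d by apply/andP; split; lra.
  rewrite /mu (@segint_cat _ _ x1 x2 x3) ?ltW//; last exact: contonS (conPx cy1).
  rewrite (@segint_cat _ (fun x => P (ptC x y2)) x1 x2 x3) ?ltW//; last exact: contonS (conPx cy2).
  by ring.
- move=> x1 x2 y1 y2 y3 ax x12 xb cy y12 y23 yd.
  have cy1 : a <= x1 <= b by apply/andP; split; lra.
  have cy2 : a <= x2 <= b by apply/andP; split; lra.
  rewrite /mu (@segint_cat _ (fun y => Q (ptC x2 y)) y1 y2 y3) ?ltW//; last exact: contonS (conQy cy2).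
  rewrite (@segint_cat _ (fun y => Q (ptC x1 y)) y1 y2 y3) ?ltW//; last exact: contonS (conQy cy1).
  by ring.
move=> x y hx hy e e0; have [p [q [r [dP dQ]]]] := closedPQ hx hy.
set L := b - a; set M := d - c.
have L0 : 0 < L by rewrite subr_gt0.
have M0 : 0 < M by rewrite subr_gt0.
have LM : 0 < L + M by rewrite addr_gt0.
set e' := e / (2 * (L + M) ^+ 2).
have e'0 : 0 < e' by rewrite divr_gt0// mulr_gt0// exprn_gt0.
have [r1 r10 r1P] := dP _ e'0; have [r2 r20 r2P] := dQ _ e'0.
exists (Order.min (r1 / (L + M)) (r2 / (L + M))).
  by rewrite lt_min !divr_gt0.
move=> t x1 y1 /andP[t0]; rewrite lt_min !ltr_pdivlMr// => /andP[tr1 tr2].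
move=> ax x1x xx2 x2b cy y1y yy2 y2d.
set x2 := x1 + L * t; set y2 := y1 + M * t.
have Lt : 0 < L * t by rewrite mulr_gt0.
have Mt : 0 < M * t by rewrite mulr_gt0.
have hN u v : x1 <= u <= x2 -> y1 <= v <= y2 -> N (ptC u v - ptC x y) <= (L + M) * t.
  rewrite /x2 /y2 => /andP[u1 u2] /andP[v1 v2].
  rewrite (le_trans (ler_cnorm_ReIm _))// /ptC /= mulrDl lerD// ler_norml; apply/andP; split; lra.
pose rP z := P z - P (ptC x y) - (p * (complex.Re z - x) + q * (complex.Im z - y)).
pose rQ z := Q z - Q (ptC x y) - (q * (complex.Re z - x) + r * (complex.Im z - y)).
have rPle u v : x1 <= u <= x2 -> y1 <= v <= y2 -> `|rP (ptC u v)| <= e' * ((L + M) * t).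
  move=> hu hv; have h := hN _ _ hu hv.
  have := r1P (ptC u v - ptC x y); rewrite subrKC => /(_ _)/le_trans; apply.
    by apply: le_lt_trans h _; rewrite mulrC.
  by rewrite ler_pM2l.
have rQle u v : x1 <= u <= x2 -> y1 <= v <= y2 -> `|rQ (ptC u v)| <= e' * ((L + M) * t).
  move=> hu hv; have h := hN _ _ hu hv.
  have := r2P (ptC u v - ptC x y); rewrite subrKC => /(_ _)/le_trans; apply.
    by apply: le_lt_trans h _; rewrite mulrC.
  by rewrite ler_pM2l.
have y1y2 : y1 <= y2 by rewrite lerDl ltW.
have x1x2 : x1 <= x2 by rewrite lerDl ltW.
have cx1 : a <= x1 <= b by apply/andP; split=> //; rewrite (le_trans x1x2).
have cx2 : a <= x2 <= b by apply/andP; split=> //; rewrite (le_trans ax).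
have cy1 : c <= y1 <= d by apply/andP; split=> //; rewrite (le_trans y1y2).
have cy2 : c <= y2 <= d by apply/andP; split=> //; rewrite (le_trans cy).
have cPx v : c <= v <= d -> conton (fun x => P (ptC x v)) x1 x2.
  by move=> hv; apply: contonS (conPx hv).
have cQy u : a <= u <= b -> conton (fun x => Q (ptC u x)) y1 y2.
  by move=> hv; apply: contonS (conQy hv).
have contonB f g u v : @conton R f u v -> conton g u v -> conton (fun x => f x - g x) u v.
  by move=> cf cg x0; apply: continuousB; [exact: cf|exact: cg].
have cP12 : conton (fun u => P (ptC u y1) - P (ptC u y2)) x1 x2.
  by apply: contonB; exact: cPx.
have cQ12 : conton (fun v => Q (ptC x2 v) - Q (ptC x1 v)) y1 y2.
  by apply: contonB; exact: cQy.
have -> : mu x1 x2 y1 y2 =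
  segint (fun u => (P (ptC u y1) - P (ptC u y2)) - q * (y1 - y2)) x1 x2 +
  segint (fun v => (Q (ptC x2 v) - Q (ptC x1 v)) - q * (x2 - x1)) y1 y2.
  rewrite (segintB cP12 (@conton_cst _ _ _ _)) (segintB cQ12 (@conton_cst _ _ _ _)).
  rewrite (segintB (cPx _ cy1) (cPx _ cy2)) (segintB (cQy _ cx2) (cQy _ cx1)).
  by rewrite /mu !segint_cst// /x2 /y2; ring.
have -> : e * t ^+ 2 = (e' * ((L + M) * t) * 2) * (L * t) + (e' * ((L + M) * t) * 2) * (M * t).
  rewrite /e'; field; lra.
rewrite (le_trans (ler_normD _ _))// lerD//.
  rewrite (_ : L * t = x2 - x1); last by rewrite /x2; ring.
  apply: segint_le => //.
    by apply: contonB; [exact: cP12|exact: conton_cst].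
  move=> u hu; rewrite (_ : _ - _ = rP (ptC u y1) - rP (ptC u y2)); last first.
    by rewrite /rP /=; ring.
  rewrite (le_trans (ler_normB _ _))// mulr2n mulrDr mulr1 lerD// rPle// lexx y1y2//.
rewrite (_ : M * t = y2 - y1); last by rewrite /y2; ring.
apply: segint_le => //.
  by apply: contonB; [exact: cQ12|exact: conton_cst].
move=> u hu; rewrite (_ : _ - _ = rQ (ptC x2 u) - rQ (ptC x1 u)); last first.
  by rewrite /rQ /=; ring.
by rewrite (le_trans (ler_normB _ _))// mulr2n mulrDr mulr1 lerD// rQle// lexx x1x2.
Qed.

End goursat.

(** * The derivative of a holomorphic function is holomorphic *)

Section one_variable.
Context {R : realType}.
Local Notation C := (Cplane R).
Local Notation N := (@ComplexField.Normc.normc R).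

(** One-variable analogue of [rdiff]; it lets real functions be composed with
    real functions on the plane. *)
Definition rder (f : R -> R) (x df : R) := forall e : R, 0 < e ->
  exists2 d : R, 0 < d & forall s, `|s| < d ->
    `|f (x + s) - f x - df * s| <= e * `|s|.

Lemma is_derive_rder (f : R -> R) (x df : R) : is_derive x 1 f df -> rder f x df.
Proof.
move=> [dfx <-] e e0; move: dfx; rewrite /derivable /derive; set l := lim _ => dfx.
have : nbhs l (ball l e) by exact: nbhsx_ballx.
move=> /dfx /nbhs_ballP[d /= d0 dP]; exists d => // s sd.
have [->|s0] := eqVneq s 0; first by rewrite addr0 subrr mulr0 subrr normr0 mulr0.
have := dP s; rewrite -ball_normE /= sub0r normrN => /(_ sd s0).
rewrite distrC => /ltW.
rewrite -(ler_pM2r (_ : 0 < `|s|)) ?normr_gt0// -normrM mulrBl.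
by rewrite /GRing.scale /= mulr1 mulrAC mulVf// mul1r [s + x]addrC.
Qed.

Lemma rdiff_fun1 (f : R -> R) (k : C -> R) z (df a b : R) :
  rder f (k z) df -> rdiff k z a b -> rdiff (f \o k) z (df * a) (df * b).
Proof.
move=> fd rk0; have [M M0 lipM] := rdiff_lip rk0.
move: rk0 => /rdiffE rk; apply/rdiffE.
have s1 : small (fun h => f (k (z + h)) - f (k z) - df * (k (z + h) - k z)).
  move=> e e0; have [d d0 dP] := fd (e / M) (divr_gt0 e0 M0).
  have b1 : \forall h \near (0 : C), N h < d / M.
    by apply/near0P; exists (d / M) => //; rewrite divr_gt0.
  apply: filterS2 lipM b1 => h kh; rewrite ltr_pdivlMr// => hd.
  have kd : `|k (z + h) - k z| < d by apply: le_lt_trans kh _; rewrite mulrC.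
  have := dP _ kd; rewrite subrKC => /le_trans; apply.
  by rewrite -mulrA ler_pM2l// ler_pdivrMl.
have s2 : small (fun h => df * (k (z + h) - k z - (a * complex.Re h + b * complex.Im h))).
  by apply: (@small_le _ _ _ `|df|) rk; apply: near0T => h /=; rewrite normrM.
by apply: small_eq (smallD s1 s2) => h /=; ring.
Qed.

(** The factor 2 comes from applying the real mean value theorem to the real
    and imaginary parts separately. *)
Lemma cder_MVT (f f' : C -> C) z h (L : R) :
  (forall t : R, 0 <= t <= 1 -> cder f (z + t%:C%C * h) (f' (z + t%:C%C * h)) /\
    N (f' (z + t%:C%C * h)) <= L) ->
  N (f (z + h) - f z) <= 2 * L * N h.
Proof.
move=> fd.
have key (k : C -> R) (a b : C -> R) :
    (forall t : R, 0 <= t <= 1 -> let w := z + t%:C%C * h in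
      rdiff k w (a w) (b w) /\ `|a w * complex.Re h + b w * complex.Im h| <= L * N h) ->
    `|k (z + h) - k z| <= L * N h.
  move=> H; pose g (t : R) := k (z + t%:C%C * h).
  pose g' (t : R) := a (z + t%:C%C * h) * complex.Re h + b (z + t%:C%C * h) * complex.Im h.
  have gd (t : R) : 0 <= t <= 1 -> is_derive t 1 g (g' t).
    by move=> /H[rd _]; exact: rdiff_line rd.
  have [||c] := @MVT R g g' 0 1 ltr01.
  - by move=> x; rewrite in_itv/= => /andP[x0 x1]; apply: gd; rewrite !ltW.
  - apply: continuous_in_subspaceT => x; rewrite inE/= in_itv/= => /gd[gdx _].
    exact/differentiable_continuous/derivable1_diffP.
  rewrite in_itv/= => /andP[c0 c1]; rewrite subr0 mulr1 /g mul1r mul0r addr0 => ->.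
  have c01 : 0 <= c <= 1 by rewrite !ltW.
  by have [_] := H c c01; apply.
rewrite (le_trans (ler_cnorm_ReIm _))// (_ : 2 * L * N h = L * N h + L * N h); last by ring.
rewrite !ReImE lerD//.
  apply: (key (@complex.Re R \o f) (fun w => complex.Re (f' w)) (fun w => - complex.Im (f' w))) => t /fd[fdt fL] w.
  move: fdt => /cderP[ru rv]; split; first exact: ru.
  rewrite mulNr -cReM (le_trans (ler_Re_cnorm _))// cnormM.
  by rewrite ler_wpM2r ?cnorm_ge0.
apply: (key (@complex.Im R \o f) (fun w => complex.Im (f' w)) (fun w => complex.Re (f' w))) => t /fd[fdt fL] w.
move: fdt => /cderP[ru rv]; split; first exact: rv.
rewrite addrC -cImM (le_trans (ler_Im_cnorm _))// cnormM.
by rewrite ler_wpM2r ?cnorm_ge0.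
Qed.

End one_variable.

Section cauchy.
Context {R : realType}.
Local Notation C := (Cplane R).
Local Notation N := (@ComplexField.Normc.normc R).
Local Notation Re := (@complex.Re R).
Local Notation Im := (@complex.Im R).

Definition cexp (z : C) : C := Complex (expR (Re z) * cos (Im z)) (expR (Re z) * sin (Im z)).

Lemma cder_cexp z : cder cexp z (cexp z).
Proof.
have rE : rdiff (expR \o Re) z (expR (Re z)) 0.
  by apply: rdiff_val (rdiff_fun1 (is_derive_rder (is_derive_expR _)) (rdiff_Re z)); ring.
have rc : rdiff (cos \o Im) z 0 (- sin (Im z)).
  by apply: rdiff_val (rdiff_fun1 (is_derive_rder (is_derive_cos _)) (rdiff_Im z)); ring.
have rs : rdiff (sin \o Im) z 0 (cos (Im z)).
  by apply: rdiff_val (rdiff_fun1 (is_derive_rder (is_derive_sin _)) (rdiff_Im z)); ring.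
apply/cderP; split.
  by apply: rdiff_val (rdiffM rE rc) => /=; ring.
by apply: rdiff_val (rdiffM rE rs) => /=; ring.
Qed.

Lemma N_cexp z : N (cexp z) = expR (Re z).
Proof.
rewrite cnormE /cexp /= !exprMn -mulrDr cos2Dsin2 mulr1 sqrtr_sqr.
by rewrite ger0_norm// expR_ge0.
Qed.

Definition circ (t : R) : C := Complex (cos t) (sin t).

Lemma N_circ t : N (circ t) = 1.
Proof. by rewrite cnormE /= cos2Dsin2 sqrtr1. Qed.

Definition cint (g : R -> C) : C :=
  Complex (segint (Re \o g) 0 (2 * pi)) (segint (Im \o g) 0 (2 * pi)).

Definition ccont (g : R -> C) := conton (Re \o g) 0 (2 * pi) /\ conton (Im \o g) 0 (2 * pi).

Let pi2_ge0 : 0 <= 2 * pi :> R.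
Proof. by rewrite mulr_ge0// pi_ge0. Qed.

Lemma cintB g1 g2 : ccont g1 -> ccont g2 ->
  cint (fun t => g1 t - g2 t) = cint g1 - cint g2.
Proof.
move=> [a1 b1] [a2 b2]; apply: complex_ext; rewrite !ReImE /cint /=.
  by rewrite -segintB//; apply: eq_segint => x _ /=; rewrite !ReImE.
by rewrite -segintB//; apply: eq_segint => x _ /=; rewrite !ReImE.
Qed.

Lemma ccont_cont g : (forall t, {for t, continuous g}) -> ccont g.
Proof.
by move=> cg; split; apply: continuous_subspaceT => t;
  apply: (continuous_comp (cg t)); [exact: rdiff_cont (rdiff_Re _)|exact: rdiff_cont (rdiff_Im _)].
Qed.

Lemma cint_le g (M : R) : ccont g -> (forall t, 0 <= t <= 2 * pi -> N (g t) <= M) ->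
  N (cint g) <= 2 * M * (2 * pi).
Proof.
move=> [cu cv] gM; rewrite (le_trans (ler_cnorm_ReIm _))//=.
rewrite (_ : 2 * M * (2 * pi) = M * (2 * pi) + M * (2 * pi)); last by ring.
rewrite lerD//.
  have := @segint_le R M _ _ _ pi2_ge0 cu; rewrite subr0; apply=> x hx.
  by apply: le_trans (gM _ hx); exact: ler_Re_cnorm.
have := @segint_le R M _ _ _ pi2_ge0 cv; rewrite subr0; apply=> x hx.
by apply: le_trans (gM _ hx); exact: ler_Im_cnorm.
Qed.

Lemma cint_cst c : cint (fun=> c) = (2 * pi)%:C%C * c.
Proof.
by apply: complex_ext; rewrite !ReImE /cint /= /comp segint_cst// subr0; ring.
Qed.

Lemma cintZ c g : ccont g -> cint (fun t => c * g t) = c * cint g.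
Proof.
move=> [cu cv]; have cz (k : R) f a b : conton f a b -> conton (fun x => k * f x) a b.
  by move=> cf x; apply: continuousM; [exact: cvg_cst|exact: cf].
apply: complex_ext; rewrite !ReImE /cint /=.
  rewrite -!segintZ// -segintB; try exact: cz.
  by apply: eq_segint => x _ /=; rewrite !ReImE.
rewrite -!segintZ// -segintD; try exact: cz.
by apply: eq_segint => x _ /=; rewrite !ReImE addrC.
Qed.

Variables (f f' : C -> C).

(** The integrand of Cauchy's formula for f' w along the circle of radius r
    around w; subtracting f w makes the limit r -> 0 immediate. *)
Definition cauchy_kernel (w : C) (r : R) (t : R) : C :=
  (f (w + r%:C%C * circ t) - f w) * (r^-1%:C%C * circ (- t)).

Lemma cauchy_kernelE w x t :
  (f (w + cexp (Complex x t)) - f w) * cexp (- Complex x t) = cauchy_kernel w (expR x) t.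
Proof.
have E : cexp (Complex x t) = (expR x)%:C%C * circ t.
  by apply: complex_ext; rewrite !ReImE /cexp /circ /=; ring.
rewrite /cauchy_kernel E; congr (_ * _).
by apply: complex_ext; rewrite !ReImE /cexp /circ /= expRN; ring.
Qed.

Lemma circ_cont t : {for t, continuous circ}.
Proof. by apply: cont_Complex; [exact: continuous_cos|exact: continuous_sin]. Qed.

Lemma cont_ReIm (g : R -> C) t : {for t, continuous g} <->
  {for t, continuous (Re \o g)} /\ {for t, continuous (Im \o g)}.
Proof.
split=> [cg|[cu cv]].
  by split; apply: (continuous_comp cg); [exact: rdiff_cont (rdiff_Re _)|
    exact: rdiff_cont (rdiff_Im _)].
suff -> : g = (fun s => Complex (Re (g s)) (Im (g s))) by exact: cont_Complex.
by apply/funext => s; apply: complex_ext.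
Qed.

Lemma contCD (g h : R -> C) t : {for t, continuous g} -> {for t, continuous h} ->
  {for t, continuous (fun s => g s + h s)}.
Proof.
move=> /cont_ReIm[gu gv] /cont_ReIm[hu hv]; apply/cont_ReIm; split.
  rewrite (_ : _ \o _ = fun s => Re (g s) + Re (h s)).
    by apply: cvgD; [exact: gu|exact: hu].
  by apply/funext => s /=; rewrite !ReImE.
rewrite (_ : _ \o _ = fun s => Im (g s) + Im (h s)).
  by apply: cvgD; [exact: gv|exact: hv].
by apply/funext => s /=; rewrite !ReImE.
Qed.

Lemma contCM (g h : R -> C) t : {for t, continuous g} -> {for t, continuous h} ->
  {for t, continuous (fun s => g s * h s)}.
Proof.
move=> /cont_ReIm[gu gv] /cont_ReIm[hu hv]; apply/cont_ReIm; split.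
  rewrite (_ : _ \o _ = fun s => Re (g s) * Re (h s) - Im (g s) * Im (h s)).
    by apply: cvgB; apply: cvgM; [exact: gu|exact: hu|exact: gv|exact: hv].
  by apply/funext => s /=; rewrite !ReImE.
rewrite (_ : _ \o _ = fun s => Re (g s) * Im (h s) + Im (g s) * Re (h s)).
  by apply: cvgD; apply: cvgM; [exact: gu|exact: hv|exact: gv|exact: hu].
by apply/funext => s /=; rewrite !ReImE.
Qed.

Lemma contCB (g h : R -> C) t : {for t, continuous g} -> {for t, continuous h} ->
  {for t, continuous (fun s => g s - h s)}.
Proof.
move=> /cont_ReIm[gu gv] /cont_ReIm[hu hv]; apply/cont_ReIm; split.
  rewrite (_ : _ \o _ = fun s => Re (g s) - Re (h s)).
    by apply: cvgB; [exact: gu|exact: hu].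
  by apply/funext => s /=; rewrite !ReImE.
rewrite (_ : _ \o _ = fun s => Im (g s) - Im (h s)).
  by apply: cvgB; [exact: gv|exact: hv].
by apply/funext => s /=; rewrite !ReImE.
Qed.

Lemma cauchy_kernel_cont w r : (forall z, N (z - w) <= r -> cder f z (f' z)) -> 0 < r ->
  forall t, {for t, continuous (cauchy_kernel w r)}.
Proof.
move=> fd r0 t; rewrite /cauchy_kernel.
apply: contCM; last first.
  apply: contCM; first exact: cvg_cst.
  apply: (continuous_comp (f := -%R) (g := circ)); last exact: circ_cont.
  exact: opp_continuous.
apply: contCD; last exact: cvg_cst.
suff : {for t, continuous (f \o (fun t : R => w + r%:C%C * circ t))} by [].
apply: continuous_comp.
  by apply: contCD; [exact: cvg_cst|apply: contCM; [exact: cvg_cst|exact: circ_cont]].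
apply: cder_cont; apply: fd; rewrite addrAC subrr add0r cnormM N_circ mulr1.
by rewrite cnormE /= expr0n addr0 sqrtr_sqr ger0_norm// ltW.
Qed.

(** In logarithmic polar coordinates u = w + exp (x + i t) the integrand is a
    differentiable function of x + i t with period 2 pi in t.  Goursat's theorem
    on [ln s, ln r] x [0, 2 pi] therefore shows that the integral does not depend
    on the radius, and it tends to 2 pi f' w as the radius tends to 0. *)
Lemma cauchy_deriv w r : 0 < r -> (forall z, N (z - w) <= r -> cder f z (f' z)) ->
  cint (cauchy_kernel w r) = (2 * pi)%:C%C * f' w.
Proof.
move=> r0 fd.
have indep s : 0 < s -> s < r -> cint (cauchy_kernel w s) = cint (cauchy_kernel w r).
  move=> s0 sr.
  pose g z := (f (w + cexp z) - f w) * cexp (- z).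
  have gE x t : 0 < x -> g (Complex (ln x) t) = cauchy_kernel w x t.
    by move=> x0; rewrite /g cauchy_kernelE lnK.
  have ls : ln s < ln r by rewrite ltr_ln.
  have p2 : 0 < 2 * pi :> R by rewrite mulr_gt0// pi_gt0.
  have gd x y : ln s <= x <= ln r -> 0 <= y <= 2 * pi -> exists c, cder g (Complex x y) c.
    move=> /andP[sx xr] _; set z : C := Complex x y.
    have d1 : cder (fun z => f (w + cexp z)) z (f' (w + cexp z) * cexp z).
      apply: (cder_comp (f := fun z => w + cexp z) (g := f)).
        by apply: cder_val (cderD (cder_cst w z) (cder_cexp z)); rewrite add0r.
      apply: fd; rewrite addrAC subrr add0r N_cexp -[leRHS]lnK// ler_expR//.
    have d2 : cder (fun z : C => - z) z (-1).
      apply: cder_ext (cder_val _ (cderZ (-1) (cder_id z))) => [u|]; first by rewrite mulN1r.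
      by rewrite mulr1.
    have d3 := cderM (cderD d1 (cder_cst (- f w) z)) (cder_comp d2 (cder_cexp (- z))).
    by eexists; exact: d3.
  have per x : g (Complex x 0) = g (Complex x (2 * pi)).
    rewrite /g !cauchy_kernelE /cauchy_kernel; congr ((f (w + _ * _) - _) * (_ * _)).
      by rewrite /circ cos0 sin0 mulr_natl cos2pi sin2pi.
    by rewrite /circ !cosN !sinN cos0 sin0 mulr_natl cos2pi sin2pi.
  apply: complex_ext; rewrite /cint /=.
    have H x y : ln s <= x <= ln r -> 0 <= y <= 2 * pi -> exists p q r,
      rdiff (Im \o g) (Complex x y) p q /\ rdiff (Re \o g) (Complex x y) q r.
      by move=> hx hy; have [c /cderP[ru rv]] := gd _ _ hx hy;
        exists (Im c), (Re c), (- Im c).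
    have := @goursat R (Im \o g) (Re \o g) _ _ _ _ ls p2 H.
    rewrite [in RHS](@eq_segint _ _ (fun x => (Im \o g) (Complex x 0))).
      move=> /addrI E; rewrite (@eq_segint _ _ (fun y => (Re \o g) (Complex (ln s) y))).
        rewrite -E; apply: eq_segint => y _ /=; by rewrite gE.
      by move=> y _ /=; rewrite gE.
    by move=> x _ /=; rewrite per.
  have H x y : ln s <= x <= ln r -> 0 <= y <= 2 * pi -> exists p q r,
      rdiff (Re \o g) (Complex x y) p q /\ rdiff ((fun x => - 1 * x) \o (Im \o g)) (Complex x y) q r.
    move=> hx hy; have [c /cderP[ru rv]] := gd _ _ hx hy.
    exists (Re c), (- Im c), (- 1 * Re c); split => //.
    by apply: rdiff_val (rdiffZ (-1) rv); rewrite ?mulN1r.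
  have eI x : 0 < x -> x <= r ->
      segint (fun y => ((fun x => - 1 * x) \o (Im \o g)) (Complex (ln x) y)) 0 (2 * pi) =
      - segint (Im \o cauchy_kernel w x) 0 (2 * pi).
    move=> x0 xr; rewrite -[RHS]mulN1r -[RHS]segintZ.
      by apply: eq_segint => y _ /=; rewrite gE.
    have [] // := ccont_cont (@cauchy_kernel_cont w x _ x0) => z hz; apply: fd.
    exact: le_trans xr.
  have := @goursat R (Re \o g) _ _ _ _ _ ls p2 H.
  rewrite [in RHS](@eq_segint _ _ (fun x => (Re \o g) (Complex x 0))).
    by move=> /addrI; rewrite !eI// ?ltW// => /oppr_inj.
  by move=> x _ /=; rewrite per.
have key e : 0 < e -> N (cint (cauchy_kernel w r) - (2 * pi)%:C%C * f' w) <= 2 * e * (2 * pi).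
  move=> e0; have fw : cder f w (f' w) by apply: fd; rewrite subrr cnorm0 ltW.
  have [d d0 dP] := fw _ e0; pose s := Order.min (d / 2) (r / 2).
  have s0 : 0 < s by rewrite lt_min !divr_gt0.
  have sd : s < d by rewrite gt_min ltr_pdivrMr// ltr_pMr// ltr1n.
  have sr : s < r by rewrite gt_min orbC ltr_pdivrMr// ltr_pMr// ltr1n.
  have cs : ccont (cauchy_kernel w s).
    by apply/ccont_cont/cauchy_kernel_cont => // z hz; apply: fd; rewrite (le_trans hz)// ltW.
  have cc : ccont (fun=> f' w) by apply: ccont_cont => t; exact: cvg_cst.
  rewrite -(indep s)// -cint_cst -cintB//; apply: cint_le.
    by apply: ccont_cont => t; apply: contCD; [|exact: cvg_cst];
      apply: cauchy_kernel_cont => // z hz; apply: fd; rewrite (le_trans hz)// ltW.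
  move=> t _; pose h := s%:C%C * circ t.
  have Ns (x : R) : 0 < x -> N x%:C%C = x.
    by move=> x0; rewrite cnormE /= expr0n addr0 sqrtr_sqr gtr0_norm.
  have Nh : N h = s by rewrite cnormM N_circ mulr1 Ns.
  have hk : h * (s^-1%:C%C * circ (- t)) = 1.
    rewrite mulrACA -rmorphM divff ?gt_eqF// mul1r.
    apply: complex_ext; rewrite !ReImE /= cosN sinN.
      by rewrite mulrN opprK -!expr2 cos2Dsin2.
    by rewrite mulrN mulrC addNr.
  have -> : cauchy_kernel w s t - f' w = (f (w + h) - f w - f' w * h) * (s^-1%:C%C * circ (- t)).
    by rewrite [RHS]mulrBl -[f' w * h * _]mulrA hk mulr1.
  rewrite cnormM cnormM N_circ mulr1 Ns ?invr_gt0// ler_pdivrMr// -Nh.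
  by apply: dP; rewrite Nh.
apply/eqP; rewrite -subr_eq0 -cnorm_eq0; apply/negPn/negP => n0.
set D := N _ in n0 key; have D0 : 0 < D by rewrite lt_def n0 cnorm_ge0.
have := key (D / (8 * pi)); rewrite divr_gt0 ?mulr_gt0 ?pi_gt0// => /(_ isT).
have E (x q : R) : q != 0 -> 2 * (x / (8 * q)) * (2 * q) = x / 2 by move=> q0; field.
rewrite E ?lt0r_neq0 ?pi_gt0// => DD.
lra.
Qed.

End cauchy.

(** Cauchy's formula expresses f' through f, so bounds propagate upwards on
    shrinking discs: f bounded gives f' bounded, hence f Lipschitz, hence f'
    Lipschitz, hence a quadratic remainder for f that is uniform in the base
    point.  Inserting this remainder into the formula differentiates it under
    the integral sign.  Each use of the formula costs a distance rho to the
    boundary, hence the radii 5 rho, 3 rho, 2 rho and rho. *)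
Section derivative_is_holomorphic.
Context {R : realType}.
Local Notation C := (Cplane R).
Local Notation N := (@ComplexField.Normc.normc R).
Variables (f f' : C -> C) (w : C) (rho B : R).
Hypotheses (rho0 : 0 < rho) (fd : forall z, N (z - w) < 5 * rho -> cder f z (f' z)).
Hypothesis fB : forall z, N (z - w) < 5 * rho -> N (f z) <= B.

Let Nr (x : R) : 0 <= x -> N x%:C%C = x.
Proof. by move=> x0; rewrite cnormE /= expr0n addr0 sqrtr_sqr ger0_norm. Qed.

Let pi2 : 0 < 2 * pi :> R. Proof. by rewrite mulr_gt0// pi_gt0. Qed.

Let scale t : N (rho%:C%C * circ t) = rho.
Proof. by rewrite cnormM N_circ mulr1 Nr// ltW. Qed.

Let scaleV t : N (rho^-1%:C%C * circ t) = rho^-1.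
Proof. by rewrite cnormM N_circ mulr1 Nr// invr_ge0 ltW. Qed.

Let ND3 z c r s : N (z - w) <= r -> N c <= s -> N (z + c - w) <= r + s.
Proof.
by move=> h1 h2; rewrite addrAC (le_trans (ler_cnormD _ _))// lerD.
Qed.

Let disc z : N (z - w) <= 3 * rho -> forall u, N (u - z) <= rho -> N (u - w) < 5 * rho.
Proof.
move=> zr u uz; have -> : u - w = (z - w) + (u - z) by ring.
by apply: (le_lt_trans (ler_cnormD _ _)); (have r1 := rho0; move: r1; lra).
Qed.

Let fdisc z : N (z - w) <= 3 * rho -> forall u, N (u - z) <= rho -> cder f u (f' u).
Proof. by move=> zr u uz; apply: fd; exact: disc uz. Qed.

Let ckern z : N (z - w) <= 3 * rho -> ccont (cauchy_kernel f z rho).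
Proof. by move=> zr; apply: ccont_cont; apply: cauchy_kernel_cont (fdisc zr) rho0. Qed.

Let cauchyE z : N (z - w) <= 3 * rho ->
  f' z = (2 * pi)^-1%:C%C * cint (cauchy_kernel f z rho).
Proof.
move=> zr; rewrite (cauchy_deriv rho0 (fdisc zr)) mulrA -rmorphM mulVf ?mul1r//.
by rewrite gt_eqF.
Qed.

Let N2pi x : N ((2 * pi)^-1%:C%C * x) = (2 * pi)^-1 * N x.
Proof. by rewrite cnormM Nr// invr_ge0 ltW. Qed.

Let bound2pi (x M : R) : x <= 2 * M * (2 * pi) -> (2 * pi)^-1 * x <= 2 * M.
Proof. by move=> h; rewrite ler_pdivrMl// [leRHS]mulrC. Qed.

Let L := 4 * B / rho.

Let B0 : 0 <= B.
Proof. by apply: le_trans (cnorm_ge0 _) (fB (z := w) _); rewrite subrr cnorm0 mulr_gt0. Qed.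

Let L_ge0 : 0 <= L. Proof. by rewrite divr_ge0 ?mulr_ge0// ltW. Qed.

Let bound' z : N (z - w) <= 3 * rho -> N (f' z) <= L.
Proof.
move=> zr; rewrite cauchyE// N2pi (_ : L = 2 * (2 * B / rho)); last by rewrite /L; field; rewrite gt_eqF.
apply: bound2pi; apply: cint_le; first exact: ckern.
move=> t _; rewrite /cauchy_kernel cnormM scaleV ler_wpM2r ?invr_ge0 ?(ltW rho0)//.
rewrite mulr_natl mulr2n (le_trans (ler_cnormD _ _))// cnormN lerD// fB//.
  by apply: disc zr _ _; rewrite addrAC subrr add0r scale.
by apply: disc zr _ _; rewrite subrr cnorm0 ltW.
Qed.

Let seg z h (t r : R) : 0 <= t <= 1 -> N (z - w) <= r -> N (z + h - w) <= r ->
  N (z + t%:C%C * h - w) <= r.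
Proof.
move=> /andP[t0 t1] h1 h2.
rewrite (_ : _ - w = (1 - t)%:C%C * (z - w) + t%:C%C * (z + h - w)); last first.
  by rewrite rmorphB rmorph1; ring.
rewrite (le_trans (ler_cnormD _ _))// !cnormM !Nr ?subr_ge0//.
have : (1 - t) * N (z - w) <= (1 - t) * r by rewrite ler_wpM2l ?subr_ge0.
have : t * N (z + h - w) <= t * r by rewrite ler_wpM2l.
(have r1 := rho0; move: r1; lra).
Qed.

Let lip z u : N (z - w) <= 3 * rho -> N (u - w) <= 3 * rho ->
  N (f u - f z) <= 2 * L * N (u - z).
Proof.
move=> zr ur; have := @cder_MVT R f f' z (u - z) L; rewrite subrKC; apply=> t t01.
have hr : N (z + t%:C%C * (u - z) - w) <= 3 * rho by apply: seg => //; rewrite subrKC.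
split; last exact: bound'.
by apply: fd; apply: le_lt_trans hr _; (have r1 := rho0; move: r1; lra).
Qed.

Let L2 := 8 * L / rho.

Let L2_ge0 : 0 <= L2. Proof. by rewrite divr_ge0 ?(ltW rho0)// mulr_ge0. Qed.

Let lip' z u : N (z - w) <= 2 * rho -> N (u - w) <= 2 * rho ->
  N (f' u - f' z) <= L2 * N (u - z).
Proof.
move=> zr ur.
have zr3 : N (z - w) <= 3 * rho by apply: (le_trans zr); (have r1 := rho0; move: r1; lra).
have ur3 : N (u - w) <= 3 * rho by apply: (le_trans ur); (have r1 := rho0; move: r1; lra).
rewrite !cauchyE// -mulrBr N2pi -cintB; [|exact: ckern|exact: ckern].
rewrite (_ : L2 * _ = 2 * (4 * L * N (u - z) / rho)); last by rewrite /L2; field; rewrite gt_eqF.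
apply: bound2pi; apply: cint_le.
  apply: ccont_cont => t; apply: contCB; [exact: cauchy_kernel_cont (fdisc ur3) rho0 t|exact: cauchy_kernel_cont (fdisc zr3) rho0 t].
move=> t _; rewrite /cauchy_kernel -mulrBl cnormM scaleV ler_wpM2r ?invr_ge0 ?(ltW rho0)//.
set c := rho%:C%C * circ t.
have hc : N c <= rho by rewrite scale.
rewrite (_ : f (u + c) - f u - (f (z + c) - f z) =
  (f (u + c) - f (z + c)) - (f u - f z)); last by ring.
rewrite (le_trans (ler_cnormD _ _))// cnormN (_ : 4 * L * _ = 2 * L * N (u - z) + 2 * L * N (u - z)); last by ring.
rewrite lerD ?lip//.
rewrite (_ : u - z = (u + c) - (z + c)); last by ring.
by apply: lip; rewrite (_ : 3 * rho = 2 * rho + rho) ?ND3//; ring.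
Qed.

Let taylor z h : N (z - w) <= rho -> N h <= rho ->
  N (f (z + h) - f z - f' z * h) <= 2 * L2 * N h ^+ 2.
Proof.
move=> zr hr; pose F u := f u - f' z * u; pose F' u := f' u - f' z.
have zr2 : N (z - w) <= 2 * rho by apply: (le_trans zr); (have r1 := rho0; move: r1; lra).
have := @cder_MVT R F F' z h (L2 * N h).
rewrite (_ : F (z + h) - F z = f (z + h) - f z - f' z * h); last by rewrite /F; ring.
rewrite (_ : 2 * (L2 * N h) * N h = 2 * L2 * N h ^+ 2); last by ring.
apply=> t t01.
have tr : N (z + t%:C%C * h - w) <= 2 * rho.
  by apply: seg => //; rewrite (_ : 2 * rho = rho + rho) ?ND3//; ring.
split.
  apply: cderD; first by apply: fd; apply: le_lt_trans tr _; (have r1 := rho0; move: r1; lra).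
  apply: cder_ext (cder_val _ (cderZ (- f' z) (cder_id _))) => [u|]; first by rewrite mulNr.
  by rewrite mulr1.
apply: (le_trans (lip' zr2 tr)); rewrite ler_wpM2l// addrAC subrr add0r cnormM.
by case/andP: t01 => t0 t1; rewrite Nr// ler_piMl ?cnorm_ge0.
Qed.

Let kern' t := (f' (w + rho%:C%C * circ t) - f' w) * (rho^-1%:C%C * circ (- t)).

Let kern'_cont t : {for t, continuous kern'}.
Proof.
apply: contCM; last first.
  apply: contCM; first exact: cvg_cst.
  apply: (continuous_comp (f := -%R) (g := @circ R)); last exact: circ_cont.
  exact: opp_continuous.
apply: contCB; last exact: cvg_cst.
suff : {for t, continuous (f' \o (fun t : R => w + rho%:C%C * circ t))} by [].
apply: continuous_comp.
  by apply: contCD; [exact: cvg_cst|apply: contCM; [exact: cvg_cst|exact: circ_cont]].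
apply/continuousCP => e e0; set z := w + _.
have zr : N (z - w) <= rho by rewrite addrAC subrr add0r scale.
exists (Order.min rho (e / (L2 + 1))).
  by rewrite lt_min rho0 divr_gt0// ltr_wpDl.
move=> u; rewrite lt_min => /andP[u1 u2].
have ur : N (u - w) <= 2 * rho.
  have -> : u - w = z + (u - z) - w by ring.
  by rewrite (_ : 2 * rho = rho + rho) ?ND3 ?(ltW u1)//; ring.
have zr2 : N (z - w) <= 2 * rho by apply: (le_trans zr); (have r1 := rho0; move: r1; lra).
apply: (le_lt_trans (lip' zr2 ur)); rewrite ltr_pdivlMr ?ltr_wpDl// in u2.
by apply: le_lt_trans u2; rewrite mulrC ler_wpM2l ?cnorm_ge0// lerDl.
Qed.

Lemma cder_deriv_local : exists c, cder f' w c.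
Proof.
exists ((2 * pi)^-1%:C%C * cint kern') => e e0.
pose K := 8 * L2 / rho.
have K0 : 0 <= K by rewrite divr_ge0 ?(ltW rho0)// mulr_ge0.
exists (Order.min rho (e / (K + 1))); first by rewrite lt_min rho0 divr_gt0// ltr_wpDl.
move=> h; rewrite lt_min => /andP[/ltW hr he].
have w3 : N (w - w) <= 3 * rho by rewrite subrr cnorm0 mulr_ge0// ltW.
have w1 : N (w - w) <= rho by rewrite subrr cnorm0 ltW.
have wh3 : N (w + h - w) <= 3 * rho by rewrite addrAC subrr add0r (le_trans hr)//; (have r1 := rho0; move: r1; lra).
have ck' : ccont kern' by exact: ccont_cont.
have ckh : ccont (fun t => h * kern' t).
  by apply: ccont_cont => t; apply: contCM; [exact: cvg_cst|exact: kern'_cont].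
have ckd : ccont (fun t => cauchy_kernel f (w + h) rho t - cauchy_kernel f w rho t).
  apply: ccont_cont => t; apply: contCB; [exact: cauchy_kernel_cont (fdisc wh3) rho0 t|exact: cauchy_kernel_cont (fdisc w3) rho0 t].
rewrite !cauchyE//.
rewrite (_ : _ - _ = (2 * pi)^-1%:C%C * (cint (cauchy_kernel f (w + h) rho) - cint (cauchy_kernel f w rho) - h * cint kern'));
  last by ring.
rewrite -(cintB (ckern wh3) (ckern w3)) -(cintZ h ck') -(cintB ckd ckh) N2pi.
apply: (@le_trans _ _ (K * N h ^+ 2)); last first.
  rewrite expr2 mulrA ler_wpM2r ?cnorm_ge0//.
  rewrite ltr_pdivlMr ?ltr_wpDl// in he; apply: le_trans (ltW he).
  by rewrite mulrC ler_wpM2l ?cnorm_ge0// lerDl.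
rewrite (_ : K * _ = 2 * (4 * L2 * N h ^+ 2 / rho)); last by rewrite /K; field; rewrite gt_eqF.
apply: bound2pi; apply: cint_le.
  apply: ccont_cont => t; apply: contCB; last by apply: contCM; [exact: cvg_cst|exact: kern'_cont].
  apply: contCB; [exact: cauchy_kernel_cont (fdisc wh3) rho0 t|exact: cauchy_kernel_cont (fdisc w3) rho0 t].
move=> t _; rewrite /cauchy_kernel /kern'; set c := rho%:C%C * circ t; set k := _ * circ (- t).
rewrite (_ : _ - _ = ((f (w + c + h) - f (w + c) - f' (w + c) * h) -
    (f (w + h) - f w - f' w * h)) * k); last by rewrite [w + c + h]addrAC; ring.
rewrite cnormM scaleV ler_wpM2r ?invr_ge0 ?(ltW rho0)// (le_trans (ler_cnormD _ _))// cnormN.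
rewrite (_ : 4 * L2 * _ = 2 * L2 * N h ^+ 2 + 2 * L2 * N h ^+ 2); last by ring.
by rewrite lerD// taylor// addrAC subrr add0r scale.
Qed.

End derivative_is_holomorphic.

(** A function differentiable at the centre is bounded near it, which supplies
    the initial bound of the local argument. *)
Lemma cder_deriv {R : realType} (A : set (Cplane R)) (f f' : Cplane R -> Cplane R) :
  open A -> (forall z, A z -> cder f z (f' z)) ->
  forall w, A w -> exists c, cder f' w c.
Proof.
move=> /open_discP oA fd w Aw; have [r r0 rA] := oA _ Aw.
have [M M0 /near0P[d d0 dM]] := cder_lip (fd _ Aw).
pose rho := Order.min r d / 5.
have m0 : 0 < Order.min r d by rewrite lt_min r0.
have rho0 : 0 < rho by rewrite divr_gt0.
have E : 5 * rho = Order.min r d by rewrite /rho mulrC divfK.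
apply: (@cder_deriv_local R f f' w rho (ComplexField.Normc.normc (f w) + M * (5 * rho))) => //.
  by move=> z; rewrite E lt_min => /andP[zr _]; apply/fd/rA.
move=> z; rewrite E => zr; have zd : ComplexField.Normc.normc (z - w) < d.
  by apply: lt_le_trans zr _; rewrite ge_min lexx orbT.
rewrite -(subrKC (f w) (f z)) (le_trans (ler_cnormD _ _))// lerD2l.
have := dM _ zd; rewrite subrKC => /le_trans; apply.
by rewrite ler_pM2l// ltW.
Qed.

(** * Smooth functions and test functions *)

Section smoothness.
Context {R : realType}.
Local Notation C := (Cplane R).
Local Notation N := (@ComplexField.Normc.normc R).
Local Notation Re := (@complex.Re R).
Local Notation Im := (@complex.Im R).
Implicit Types (k l h : C -> R) (z w : C) (U : set C).

Definition dir (b : bool) : C := toC (axis b).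

Lemma line_quotient k b z (t : R) :
  (fun h : R => h^-1 *: (((fun s : R => k (z + s%:C%C * dir b)) \o shift t) (h *: (1:R)) -
     k (z + t%:C%C * dir b))) =
  (fun h : R => h^-1 *: (((k \o toC) \o shift (ofC (z + t%:C%C * dir b))) (h *: axis b) -
     (k \o toC) (ofC (z + t%:C%C * dir b)))).
Proof.
apply/funext => h /=; rewrite ofCK; congr (_ *: (k _ - _)).
apply: complex_ext; rewrite !ReImE /dir; case: b; rewrite /toC /ofC /axis /=;
  rewrite /GRing.scale /= ?ReImE /=; ring.
Qed.

Lemma derivable_line k b z (t : R) :
  derivable (k \o toC) (ofC (z + t%:C%C * dir b)) (axis b) ->
  is_derive t 1 (fun s : R => k (z + s%:C%C * dir b)) (partial b k (z + t%:C%C * dir b)).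
Proof.
move=> d; apply: DeriveDef.
  by rewrite /derivable line_quotient.
by rewrite /derive line_quotient.
Qed.

Lemma rdiff_partial k z a b (d : bool) : rdiff k z a b ->
  derivable (k \o toC) (ofC z) (axis d) /\ partial d k z = (if d then b else a).
Proof.
move=> rk; have rk0 : rdiff k (z + 0%:C%C * dir d) a b by rewrite mul0r addr0.
have [] := rdiff_line rk0; rewrite /derivable /derive line_quotient mul0r addr0.
move=> dk E; split => //; rewrite /partial /derive E.
by case: d {rk0 dk E}; rewrite /= ?mulr1 ?mulr0 ?addr0 ?add0r.
Qed.

Lemma partial_MVT k b z (s : R) :
  (forall w, derivable (k \o toC) (ofC w) (axis b)) ->
  exists2 t : R, `|t| <= `|s| & k (z + s%:C%C * dir b) - k z = partial b k (z + t%:C%C * dir b) * s.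
Proof.
move=> dk; pose g (t : R) := k (z + t%:C%C * dir b).
have gd (t : R) : is_derive t 1 g (partial b k (z + t%:C%C * dir b)).
  exact: derivable_line.
have gc (x y : R) : {within `[x, y], continuous g}.
  apply: continuous_subspaceT => t.
  by apply/differentiable_continuous/derivable1_diffP; have [] := gd t.
have g0 : g 0 = k z by rewrite /g mul0r addr0.
rewrite -g0 -/(g s); case: (ltgtP 0 s) => [s0|s0|<-].
- have [c] := MVT s0 (fun x _ => gd x) (gc _ _).
  rewrite in_itv/= subr0 => /andP[c0 cs] E; exists c => //.
  by rewrite !gtr0_norm// ltW.
- have [c] := MVT s0 (fun x _ => gd x) (gc _ _).
  rewrite in_itv/= sub0r => /andP[c0 cs] E; exists c.
    by rewrite !ltr0_norm// lerN2 ltW.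
  by rewrite -opprB E mulrN opprK.
- by exists 0; rewrite // subrr mulr0.
Qed.

(** The increment is followed first along the y-axis and then along the
    x-axis, with the mean value theorem on each piece. *)
Lemma C1_rdiff k z : (forall b w, derivable (k \o toC) (ofC w) (axis b)) ->
  (forall b, {for z, continuous (partial b k)}) ->
  rdiff k z (partial false k z) (partial true k z).
Proof.
move=> dk ck e e0; have e20 : 0 < e / 2 by rewrite divr_gt0.
have /continuousRP/(_ _ e20)[d1 d10 d1P] := ck false.
have /continuousRP/(_ _ e20)[d2 d20 d2P] := ck true.
exists (Order.min d1 d2 / 2); first by rewrite divr_gt0// lt_min d10.
move=> h; rewrite ltr_pdivlMr// lt_min => /andP[h1 h2].
set z1 := z + (Im h)%:C%C * dir true.
have zh : z + h = z1 + (Re h)%:C%C * dir false.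
  by apply: complex_ext; rewrite /z1 !ReImE /=; ring.
have [s sh sE] := partial_MVT z (Im h) (dk true).
have [t th tE] := partial_MVT z1 (Re h) (dk false).
rewrite zh (_ : _ - _ - _ = (partial false k (z1 + t%:C%C * dir false) - partial false k z) * Re h +
   (partial true k (z + s%:C%C * dir true) - partial true k z) * Im h); last first.
  rewrite !mulrBl -tE -sE -/z1; ring.
have Nd (x : R) b : N (x%:C%C * dir b) = `|x|.
  rewrite cnormM cnormE [N _]cnormE /= expr0n addr0 sqrtr_sqr.
  by case: b => /=; rewrite expr0n expr1n ?addr0 ?add0r sqrtr1 mulr1.
have zt : N (z1 + t%:C%C * dir false - z) < d1.
  rewrite (_ : _ - z = (Im h)%:C%C * dir true + t%:C%C * dir false); last first.
    by rewrite /z1; ring.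
  rewrite (le_lt_trans (ler_cnormD _ _))// !Nd.
  apply: le_lt_trans h1; rewrite mulrDr mulr1 lerD ?ler_Im_cnorm//.
  by apply: (le_trans th); exact: ler_Re_cnorm.
have zs : N (z + s%:C%C * dir true - z) < d2.
  rewrite addrAC subrr add0r Nd; apply: le_lt_trans h2.
  by rewrite (le_trans sh)// (le_trans (ler_Im_cnorm _))// ler_peMr ?cnorm_ge0// ler1n.
rewrite (le_trans (ler_normD _ _))// !normrM [e]splitr mulrDl lerD//.
  by rewrite ler_pM// ?ler_Re_cnorm// ltW// d1P.
by rewrite ler_pM// ?ler_Im_cnorm// ltW// d2P.
Qed.

(** A family of functions containing the partial derivatives of its members:
    all of them are then smooth on U, which replaces the handling of iterated
    derivatives one order at a time. *)
Definition closed_system U (S : (C -> R) -> Prop) := forall k, S k ->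
  exists kx ky, [/\ S kx, S ky & forall z, U z -> rdiff k z (kx z) (ky z)].

Lemma open_near U z k l : open U -> U z -> (forall w, U w -> k w = l w) ->
  \forall w \near z, k w = l w.
Proof. by move=> oU Uz kl; apply: filterS (open_nbhs_nbhs (conj oU Uz)). Qed.

Lemma closed_system_partial U S h k : open U -> closed_system U S -> S k ->
  (forall z, U z -> h z = k z) ->
  forall s, exists2 l, S l & forall z, U z -> foldr partial h s z = l z.
Proof.
move=> oU clS Sk hk; elim=> [|b s [l Sl sl]]; first by exists k.
have [lx [ly [Slx Sly dl]]] := clS _ Sl.
exists (if b then ly else lx); first by case: b.
move=> z Uz /=; have lh : \forall w \near z, l w = foldr partial h s w.
  by apply: (open_near oU Uz) => w /sl.
have [_ ->] := rdiff_partial b (rdiff_near lh (dl _ Uz)).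
by case: b.
Qed.

Lemma smooth_local h : (forall z, exists U S k,
    [/\ open U, U z, closed_system U S, S k & forall w, U w -> h w = k w]) ->
  smooth h.
Proof.
move=> H s; split=> [z|b z]; have [U [S [k [oU Uz clS Sk hk]]]] := H z;
  have [l Sl sl] := closed_system_partial oU clS Sk hk s;
  have [lx [ly [_ _ dl]]] := clS _ Sl;
  have rd : rdiff (foldr partial h s) z (lx z) (ly z)
    by apply: rdiff_near (dl _ Uz); apply: (open_near oU Uz) => w /sl.
- exact: rdiff_cont rd.
- by have [] := rdiff_partial b rd.
Qed.

(** Sums and products of generators.  By the Leibniz rule such an algebra is a
    closed system as soon as it contains the derivatives of its generators
    ([alg_closed]). *)
Inductive alg (G : (C -> R) -> Prop) : (C -> R) -> Prop :=
| alg_gen k of G k : alg G k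
| alg_cst c : alg G (fun=> c)
| alg_add k l of alg G k & alg G l : alg G (fun z => k z + l z)
| alg_mul k l of alg G k & alg G l : alg G (fun z => k z * l z).

Lemma alg_closed U G : (forall k, G k -> exists kx ky,
    [/\ alg G kx, alg G ky & forall z, U z -> rdiff k z (kx z) (ky z)]) ->
  closed_system U (alg G).
Proof.
move=> GU k; elim=> {k} [k /GU//|c|k l Gk [kx [ky [kx1 ky1 dk]]] Gl [lx [ly [lx1 ly1 dl]]]
  |k l Gk [kx [ky [kx1 ky1 dk]]] Gl [lx [ly [lx1 ly1 dl]]]].
- exists (fun=> 0), (fun=> 0); split; try exact: alg_cst.
  by move=> z _; exact: rdiff_cst.
- exists (fun z => kx z + lx z), (fun z => ky z + ly z); split; try exact: alg_add.
  by move=> z Uz; exact: rdiffD (dk _ Uz) (dl _ Uz).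
- exists (fun z => kx z * l z + k z * lx z), (fun z => ky z * l z + k z * ly z); split.
  + by apply: alg_add; exact: alg_mul.
  + by apply: alg_add; exact: alg_mul.
  + by move=> z Uz; exact: rdiffM (dk _ Uz) (dl _ Uz).
Qed.

Lemma smooth_rdiff h : smooth h -> forall s z,
  rdiff (foldr partial h s) z (foldr partial h (false :: s) z) (foldr partial h (true :: s) z).
Proof.
move=> sh s z; apply: C1_rdiff; first by move=> b w; have [_] := sh s; apply.
by move=> b; have [+ _] := sh (b :: s); apply.
Qed.

(** Each point has a neighbourhood contained in U or in the complement of K, and
    on the latter the function is 0. *)
Lemma smooth_extend U K k h S : open U -> closed K -> K `<=` U ->
  closed_system U S -> S k -> (forall z, U z -> h z = k z) ->
  (forall z, ~ K z -> h z = 0) -> smooth h.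
Proof.
move=> oU cK KU clS Sk hk h0; apply: smooth_local => z.
have [Uz|nUz] := pselect (U z); first by exists U, S, k.
exists (~` K), (alg (fun=> False)), (fun=> 0); split.
- exact: closed_openC.
- by move=> /KU.
- exact: alg_closed.
- exact: alg_cst.
- exact: h0.
Qed.

Lemma test_function_extend U K k h S : open U -> compact K -> K `<=` U ->
  closed_system U S -> S k -> (forall z, U z -> h z = k z) ->
  (forall z, ~ K z -> h z = 0) -> test_function U h.
Proof.
move=> oU cK KU clS Sk hk h0.
have clK : closed K by apply: compact_closed => //; exact: norm_hausdorff.
have sK : closure [set z | h z != 0] `<=` K.
  rewrite [X in _ `<=` X]((closure_id K).1 clK); apply: closure_subset => z /= hz.
  by apply: contrapT => /h0 E; rewrite E eqxx in hz.
split.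
- exact: smooth_extend oU clK KU clS Sk hk h0.
- apply: subclosed_compact sK => //; exact: closed_closure.
- exact: subset_trans KU.
Qed.

Section pullback.
Variables (U : set C) (phi : C -> C) (eta : C -> R).
Hypotheses (oU : open U) (phiU : forall z, U z -> exists c, cder phi z c).
Hypothesis eta_smooth : smooth eta.

Definition holo (g : C -> C) := forall z, U z -> exists c, cder g z c.

Lemma holo_deriv g : holo g -> (forall z, U z -> cder g z (derive1 g z)) /\ holo (derive1 g).
Proof.
move=> hg; have dg z : U z -> cder g z (derive1 g z).
  by move=> /hg[c gc]; have [_ ->] := derive1_cder gc.
by split=> // z Uz; exact: cder_deriv dg _ Uz.
Qed.

(** The derivatives of Re g, Im g and (d^s eta) o phi, for g holomorphic, are
    polynomials in functions of the same kind. *)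
Inductive pullback_gen : (C -> R) -> Prop :=
| pb_Re g of holo g : pullback_gen (Re \o g)
| pb_Im g of holo g : pullback_gen (Im \o g)
| pb_comp s : pullback_gen (foldr partial eta s \o phi).

Lemma pullback_closed : closed_system U (alg pullback_gen).
Proof.
apply: alg_closed => k [g hg|g hg|s].
- have [dg hg'] := holo_deriv hg.
  exists (Re \o derive1 g), (fun z => -1 * (Im \o derive1 g) z); split.
  + exact/alg_gen/pb_Re.
  + by apply: alg_mul; [exact: alg_cst|exact/alg_gen/pb_Im].
  + move=> z /dg/cderP[ru _]; apply: rdiff_val ru => //=; by rewrite mulN1r.
- have [dg hg'] := holo_deriv hg.
  exists (Im \o derive1 g), (Re \o derive1 g); split.
  + exact/alg_gen/pb_Im.
  + exact/alg_gen/pb_Re.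
  + by move=> z /dg/cderP[_ rv].
- have [dphi hphi'] := holo_deriv phiU.
  exists (fun z => (foldr partial eta (false :: s) \o phi) z * (Re \o derive1 phi) z +
     (foldr partial eta (true :: s) \o phi) z * (Im \o derive1 phi) z),
     (fun z => (foldr partial eta (true :: s) \o phi) z * (Re \o derive1 phi) z +
     -1 * ((foldr partial eta (false :: s) \o phi) z * (Im \o derive1 phi) z)).
  have aRe : alg pullback_gen (Re \o derive1 phi) by exact/alg_gen/pb_Re.
  have aIm : alg pullback_gen (Im \o derive1 phi) by exact/alg_gen/pb_Im.
  have ac b : alg pullback_gen (foldr partial eta (b :: s) \o phi) by exact/alg_gen/pb_comp.
  split.
  + by apply: alg_add; apply: alg_mul.
  + by apply: alg_add; [apply: alg_mul|apply: alg_mul; [exact: alg_cst|apply: alg_mul]].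
  + move=> z Uz; apply: rdiff_val (rdiff_compc (dphi _ Uz) (smooth_rdiff eta_smooth s (phi z))) => //.
    by rewrite mulN1r.
Qed.

End pullback.

End smoothness.

(** * Measures with a density and affine maps of the plane *)

Definition image_measure d d' (T1 : measurableType d) (T2 : measurableType d') (R : realFieldType)
  (m : {measure set T1 -> \bar R}) (f : T1 -> T2) (mf : measurable_fun setT f) :
  {measure set T2 -> \bar R} :=
  measure_function_pushforward__canonical__measure_function_Measure m mf.

Definition restricted_measure d (T : measurableType d) (R : realFieldType)
  (m : {measure set T -> \bar R}) (D : set T) (mD : measurable D) : {measure set T -> \bar R} :=
  measure_function_mrestr__canonical__measure_function_Measure m mD.

Section density.
Context d (T : measurableType d) (R : realType) (mu : {measure set T -> \bar R}).
Variables (f : T -> R) (mf : measurable_fun setT f) (f0 : forall x, 0 <= f x).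
Local Open Scope ereal_scope.

(** The proofs are arguments of the function so that it can carry its measure
    structure. *)
Definition density_measure (_ : measurable_fun setT f) (_ : forall x, (0 <= f x)%R) (A : set T) : \bar R :=
  \int[mu]_(x in A) (f x)%:E.

Let mfE : measurable_fun setT (EFin \o f).
Proof. exact/measurable_EFinP. Qed.

Let mdens0 : density_measure mf f0 set0 = 0.
Proof. by rewrite /density_measure integral_set0. Qed.

Let mdens_ge0 A : 0 <= density_measure mf f0 A.
Proof. by apply: integral_ge0 => x _; rewrite lee_fin. Qed.

Let mdens_additive : semi_sigma_additive (density_measure mf f0).
Proof.
move=> F mF tF mUF; rewrite /density_measure ge0_integral_bigcup//.
- apply: is_cvg_ereal_nneg_natsum_cond => n _ _.
  by apply: integral_ge0 => x _; rewrite lee_fin.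
- exact: measurable_funS mfE.
- by move=> x _; rewrite lee_fin.
Qed.

HB.instance Definition _ := isMeasure.Build _ _ _ (density_measure mf f0)
  mdens0 mdens_ge0 mdens_additive.

Import HBNNSimple.

(** The identity holds for simple functions by definition; both sides pass to
    monotone limits. *)
Lemma ge0_integral_density (g : T -> \bar R) : measurable_fun setT g -> (forall x, 0 <= g x) ->
  \int[density_measure mf f0]_x g x = \int[mu]_x (g x * (f x)%:E).
Proof.
move=> mg g0; pose h := nnsfun_approx measurableT mg.
have hcvg x : (h n x)%:E @[n --> \oo] --> g x by apply: cvg_nnsfun_approx.
have mh n : measurable_fun setT (EFin \o h n).
  exact/measurable_EFinP/measurable_funP.
transitivity (limn (fun n => \int[density_measure mf f0]_x (h n x)%:E)).
  rewrite -monotone_convergence//.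
  - by apply: eq_integral => x _; exact/esym/cvg_lim.
  - by move=> n x _; rewrite lee_fin.
  - by move=> x _ a b ab; rewrite lee_fin; exact/lefP/nd_nnsfun_approx.
transitivity (limn (fun n => \int[mu]_x ((h n x)%:E * (f x)%:E))); last first.
  rewrite -monotone_convergence//.
  - by apply: eq_integral => x _; apply/cvg_lim => //; exact: cvgeZr.
  - by move=> n; exact: (emeasurable_funM (mh n) mfE).
  - by move=> n x _; rewrite mule_ge0// lee_fin.
  - by move=> x _ a b ab; rewrite lee_wpmul2r ?lee_fin//; exact/lefP/nd_nnsfun_approx.
congr (limn _); apply/funext => n.
have hE x : (h n x)%:E = \sum_(y \in range (h n)) (y * \1_(h n @^-1` [set y]) x)%:E.
  by rewrite fsumEFin// -fimfunE.
have indich r : measurable_fun setT (fun x => (r * \1_(h n @^-1` [set r]) x)%:E).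
  by apply: (measurable_comp measurableT) => //; exact: measurable_funM.
transitivity (\int[density_measure mf f0]_x (\sum_(y \in range (h n))
    (y * \1_(h n @^-1` [set y]) x)%:E)); first by apply: eq_integral => x _; exact: hE.
rewrite ge0_integral_fsum//; last by move=> m y _; exact: nnfun_muleindic_ge0.
transitivity (\int[mu]_x (\sum_(y \in range (h n))
    (y * \1_(h n @^-1` [set y]) x)%:E * (f x)%:E)); last first.
  apply: eq_integral => x _; rewrite hE -ge0_mule_fsuml// => y.
  exact: nnfun_muleindic_ge0.
rewrite ge0_integral_fsum//; last 2 first.
  - by move=> y; exact: (emeasurable_funM (indich y) mfE).
  - by move=> m y _; apply: mule_ge0; [exact: nnfun_muleindic_ge0|rewrite lee_fin].
apply: eq_fsbigr => r rhn.
rewrite integralZl_indic_nnsfun// integral_indic// setIT.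
under eq_integral do rewrite EFinM -muleA.
rewrite ge0_integralZl//.
- congr (_ * _); rewrite /= /density_measure [LHS]integral_mkcond; apply: eq_integral => x _.
  rewrite patchE indicE; case: ifPn => _; first by rewrite mul1e.
  by rewrite mul0e.
- by apply: emeasurable_funM => //; exact/measurable_EFinP.
- by move=> x _; rewrite mule_ge0// lee_fin.
- by rewrite lee_fin; move: rhn; rewrite inE => -[x _ <-].
Qed.

End density.

Section affine.
Context {R : realType}.
Local Notation C := (Cplane R).
Local Notation N := (@ComplexField.Normc.normc R).
Local Notation M := (measurableTypeR R).
Local Notation P := (M * M)%type.
Local Notation lam := (@lebesgue_measure R).
Local Notation lam2 := (@lebesgue2 R).

Let aff (a b : R) : M -> M := fun x : R => (a * x + b : R).

Let measurable_aff a b : measurable_fun setT (aff a b).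
Proof.
apply: (@continuous_measurable_fun R (aff a b)) => x.
apply: cvgD; last exact: cvg_cst.
by apply: cvgM; [exact: cvg_cst|exact: cvg_id].
Qed.

(** Lebesgue measure is determined by its values on half-open intervals. *)
Lemma lebesgue_affine a b (E : set M) : a != 0 -> measurable E ->
  lam (aff a b @^-1` E) = ((`|a|^-1)%:E * lam E)%E.
Proof.
move=> a0 mE; have na : 0 < `|a| by rewrite normr_gt0.
have -> : lam E = (`|a|%:E * lam (aff a b @^-1` E))%E.
  pose m := mscale (NngNum (normr_ge0 a)) (image_measure lam (@measurable_aff a b)).
  apply: (@lebesgue_measure_unique R m) => // _ [[x y] _ <-].
  rewrite /m /= /mscale /= /image_measure /= /pushforward /= -/lebesgue_measure.
  have [ap|an] := ltP 0 a.
    have -> : aff a b @^-1` `]x, y] = [set` `](x - b) / a, (y - b) / a]].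
      apply/seteqP; split=> u /=; rewrite !in_itv/= /aff ltr_pdivrMr// ler_pdivlMr// [u * a]mulrC ltrBlDr lerBrDr//.
    rewrite !lebesgue_measure_itv/= !lte_fin ltr_pM2r ?invr_gt0// ltrD2r.
    case: ifPn => // xy; last by rewrite mule0.
    rewrite -!EFinB -EFinM gtr0_norm//; congr (_%:E); field; exact: lt0r_neq0.
  have {an}an : a < 0 by rewrite lt_neqAle a0.
  have -> : aff a b @^-1` `]x, y] = [set` `[(y - b) / a, (x - b) / a[].
    apply/seteqP; split=> u /=; rewrite !in_itv/= /aff ler_ndivrMr// ltr_ndivlMr// [u * a]mulrC ltrBlDr lerBrDr// andbC//.
  rewrite !lebesgue_measure_itv/= !lte_fin ltr_nM2r ?invr_lt0// ltrD2r.
  case: ifPn => // xy; last by rewrite mule0.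
  rewrite -!EFinB -EFinM ltr0_norm//; congr (_%:E); field; exact: ltr0_neq0.
by rewrite muleA -EFinM mulVf ?gt_eqF// mul1e.
Qed.

(** Maps that divide areas by a constant are tracked through preimages, which
    are always measurable. *)
Definition scales (k : R) (T : P -> P) := [/\ 0 < k, measurable_fun setT T &
  forall E, measurable E -> lam2 (T @^-1` E) = (k%:E * lam2 E)%E].

Lemma scales_comp k k' T T' : scales k T -> scales k' T' -> scales (k * k') (T' \o T).
Proof.
move=> [k0 mT Tk] [k'0 mT' Tk']; split; first exact: mulr_gt0.
  exact: measurableT_comp.
move=> E mE; rewrite comp_preimage Tk; last by rewrite -[X in measurable X]setTI; exact: mT'.
by rewrite Tk'// muleA EFinM.
Qed.

Let shear (a : R) (g : M -> M) (p : P) : P := (p.1, a * p.2 + g p.1).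

Let measurable_shear a g : measurable_fun setT g -> measurable_fun setT (shear a g).
Proof.
move=> mg; apply: measurable_fun_pair => //.
apply: (@measurable_funD _ _ _ _ (fun p : P => a * p.2) (fun p : P => g p.1)).
  by apply: (@measurable_funM _ _ _ _ (fun p : P => a) (fun p : P => p.2)) => //;
    exact: measurable_snd.
exact: (measurableT_comp mg measurable_fst).
Qed.

(** On each vertical line the map is affine with slope a. *)
Lemma scales_shear a g : a != 0 -> measurable_fun setT g -> scales `|a|^-1 (shear a g).
Proof.
move=> a0 mg; split; first by rewrite invr_gt0 normr_gt0.
  exact: measurable_shear.
move=> E mE; have mS := measurable_shear a mg.
rewrite /lebesgue2 /= /product_measure1.
have mX : measurable_fun setT (lam \o xsection E) by exact: measurable_fun_xsection.
rewrite -ge0_integralZl//.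
apply: eq_integral => x _ /=.
rewrite -(lebesgue_affine (g x) a0); last exact: measurable_xsection.
by congr (lam _); apply/seteqP; split => y; rewrite /xsection /= !inE.
Qed.

Let swp (p : P) : P := (p.2, p.1).

Lemma scales_swap : scales 1 swp.
Proof.
have mw : measurable_fun setT swp by exact: measurable_swap.
split => // E mE; rewrite mul1e; apply/esym.
apply: (@product_measure_unique _ _ _ _ _ lam lam (image_measure lam2 mw)) => // A B mA mB.
rewrite /image_measure /= /pushforward /=.
have -> : swp @^-1` (A `*` B) = B `*` A.
  by apply/seteqP; split => -[x y] /= [].
by rewrite /lebesgue2 product_measure1E//= muleC.
Qed.

Definition complex_affine (c w : C) (p : P) : P := ofC (c * toC p + w).

(** For Re c <> 0 multiplication by c is a product of two shears, one of them
    conjugated by the exchange of coordinates.  When Re c = 0, multiplication by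
    c is multiplication by c / (1 + i) followed by multiplication by 1 + i, and
    both factors have nonzero real part. *)
Lemma scales_complex_affine c w : c != 0 -> scales (N c ^- 2) (complex_affine c w).
Proof.
have key (a b e f : R) : a != 0 -> scales ((a ^+ 2 + b ^+ 2)^-1) (complex_affine (Complex a b) (Complex e f)).
  move=> a0; have n0 : 0 < a ^+ 2 + b ^+ 2.
    by rewrite ltr_pwDl ?sqr_ge0// exprn_even_gt0.
  (* T1 computes the first coordinate a x - b y + e; T2 then recovers the second
     one from it and y. *)
  pose T1 := swp \o (shear a (fun y => - b * y + e) \o swp).
  pose T2 := shear ((a ^+ 2 + b ^+ 2) / a) (fun x => b / a * x + (f - b / a * e)).
  have -> : complex_affine (Complex a b) (Complex e f) = T2 \o T1.
    apply/funext => -[x y]; rewrite /complex_affine /T2 /T1 /= /shear /swp /ofC /toC /=.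
    by congr pair; field.
  have s1 : scales (1 * `|a|^-1 * 1) T1.
    exact: (scales_comp (scales_comp scales_swap (scales_shear a0 (@measurable_aff (- b) e))) scales_swap).
  have s2 : scales (`|(a ^+ 2 + b ^+ 2) / a|^-1) T2.
    apply: scales_shear; first by rewrite mulf_neq0 ?invr_neq0// gt_eqF.
    exact: measurable_aff.
  have := scales_comp s1 s2.
  have -> : 1 * `|a|^-1 * 1 * `|(a ^+ 2 + b ^+ 2) / a|^-1 = (a ^+ 2 + b ^+ 2)^-1.
    rewrite mul1r mulr1 normrM normrV ?unitfE// (gtr0_norm n0); field.
    by rewrite normr_eq0 a0 gt_eqF.
  by [].
case: c w => a b [e f] c0; rewrite sqr_cnorm /=.
have [a00|a0] := eqVneq a 0; last exact: key.
have b0 : b != 0 by apply: contra c0 => /eqP ->; rewrite a00.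
have -> : complex_affine (Complex a b) (Complex e f) =
    complex_affine (Complex 1 1) (Complex e f) \o complex_affine (Complex (b / 2) (b / 2)) (Complex 0 0).
  apply/funext => -[x y]; rewrite /complex_affine /= /ofC /toC /= a00.
  by congr pair; field.
have := scales_comp (key (b / 2) (b / 2) 0 0 _) (key 1 1 e f _).
have -> : ((b / 2) ^+ 2 + (b / 2) ^+ 2)^-1 * (1 ^+ 2 + 1 ^+ 2)^-1 = (a ^+ 2 + b ^+ 2)^-1.
  by rewrite a00 -invfM; congr (_^-1); field.
by apply; rewrite ?oner_neq0// mulf_neq0// invr_neq0// pnatr_eq0.
Qed.

End affine.

(** * Rectangles and the Borel sets of the plane *)

Section rectangles.
Context {R : realType}.
Local Notation C := (Cplane R).
Local Notation M := (measurableTypeR R).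
Local Notation P := (M * M)%type.
Local Notation lam := (@lebesgue_measure R).
Local Notation lam2 := (@lebesgue2 R).
Implicit Types (U V : set C) (k : C -> R).

(** Half-open rectangles can be cut without overlap and are stable under
    intersection. *)
Definition rect (a b c d : R) : set P := [set` `]a, b]] `*` [set` `]c, d]].

Lemma rectE a b c d (p : P) : rect a b c d p <-> (a < p.1 <= b) /\ (c < p.2 <= d).
Proof. by rewrite /rect /= !in_itv. Qed.

Lemma measurable_rect a b c d : measurable (rect a b c d).
Proof. by apply: measurableX; exact: measurable_itv. Qed.

Lemma lebesgue2_rect a b c d : a <= b -> c <= d ->
  lam2 (rect a b c d) = ((b - a) * (d - c))%:E.
Proof.
move=> ab cd.
have -> : lam2 (rect a b c d) = (lam [set` `]a, b]] * lam [set` `]c, d]])%E.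
  by apply: product_measure1E; exact: measurable_itv.
rewrite !lebesgue_measure_itv/= !lte_fin EFinM.
case: ltgtP ab => // [ab _|-> _]; last by rewrite subrr !mul0e.
by case: ltgtP cd => // -> _; rewrite subrr !mule0.
Qed.

Lemma rectI a b c d a' b' c' d' : rect a b c d `&` rect a' b' c' d' =
  rect (Order.max a a') (Order.min b b') (Order.max c c') (Order.min d d').
Proof.
apply/seteqP; split=> p /=.
  move=> [/rectE[/andP[h1 h2] /andP[h3 h4]] /rectE[/andP[h5 h6] /andP[h7 h8]]].
  by apply/rectE; rewrite !gt_max !le_min h1 h2 h3 h4 h5 h6 h7 h8.
move=> /rectE; rewrite !gt_max !le_min => -[/andP[/andP[h1 h2] /andP[h3 h4]] /andP[/andP[h5 h6] /andP[h7 h8]]].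
by split; apply/rectE; rewrite ?h1 ?h2 ?h3 ?h4 ?h5 ?h6 ?h7 ?h8.
Qed.

Definition rects : set (set P) := [set A | exists a b c d, A = rect a b c d].

Lemma rect_strip_l (A : set M) : (A `*` setT : set P) = \bigcup_n (A `*` `](- n%:R), n%:R]).
Proof.
apply/seteqP; split=> [[x y] /= [Ax _]|[x y] [n _ [Ax _]]]; last by split.
have [n yn] : exists n : nat, `|y| < n%:R.
  by exists (Num.truncn `|y|).+1; rewrite truncnS_gt.
exists n => //; split => //=; rewrite in_itv/=.
by move: yn; rewrite ltr_norml => /andP[-> /ltW].
Qed.

Lemma rect_strip_r (A : set M) : (setT `*` A : set P) = \bigcup_n (`](- n%:R), n%:R] `*` A).
Proof.
apply/seteqP; split=> [[y x] /= [_ Ax]|[y x] [n _ [_ Ax]]]; last by split.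
have [n yn] : exists n : nat, `|y| < n%:R.
  by exists (Num.truncn `|y|).+1; rewrite truncnS_gt.
exists n => //; split => //=; rewrite in_itv/=.
by move: yn; rewrite ltr_norml => /andP[-> /ltW].
Qed.

Lemma measurable_rectsE : (@measurable _ P) = <<s rects >>.
Proof.
apply/seteqP; split; last first.
  apply: smallest_sub; first exact: sigma_algebra_measurable.
  by move=> _ [a [b [c [d ->]]]]; exact: measurable_rect.
rewrite measurable_prod_measurableType; apply: smallest_sub; first exact: smallest_sigma_algebra.
pose Tg := g_sigma_algebraType rects.
have m1 : measurable_fun (setT : set Tg) (fst : Tg -> M).
  apply: (@measurability _ _ Tg M setT fst (@ocitv R)) => // _ [_ [[a b] _ <-] <-].
  rewrite setTI (_ : _ @^-1` _ = [set` `]a, b]] `*` setT); last first.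
    by apply/seteqP; split=> [[x y]|[x y] []].
  rewrite rect_strip_l.
  apply: bigcupT_measurable => n; apply: sub_sigma_algebra.
  by exists a, b, (- n%:R), n%:R.
have m2 : measurable_fun (setT : set Tg) (snd : Tg -> M).
  apply: (@measurability _ _ Tg M setT snd (@ocitv R)) => // _ [_ [[a b] _ <-] <-].
  rewrite setTI (_ : _ @^-1` _ = setT `*` [set` `]a, b]]); last first.
    by apply/seteqP; split=> [[x y]|[x y] []].
  rewrite rect_strip_r.
  apply: bigcupT_measurable => n; apply: sub_sigma_algebra.
  by exists (- n%:R), n%:R, a, b.
move=> _ [A mA [B mB <-]].
have -> : A `*` B = (fst @^-1` A) `&` (snd @^-1` B) by [].
apply: (@measurableI _ Tg).
  by rewrite -[X in measurable X]setTI; exact: m1.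
by rewrite -[X in measurable X]setTI; exact: m2.
Qed.

(** Rectangles form a pi-system that generates the Borel sets and exhausts the
    plane. *)
Lemma rects_unique (m1 m2 : {measure set P -> \bar R}) :
  (forall a b c d, m1 (rect a b c d) = m2 (rect a b c d)) ->
  (forall a b c d, (m1 (rect a b c d) < +oo)%E) ->
  forall A, measurable A -> m1 A = m2 A.
Proof.
move=> m12 fin; apply: (@measure_unique _ R P rects (fun n => rect (- n%:R) n%:R (- n%:R) n%:R)).
- exact: measurable_rectsE.
- move=> _ _ [a [b [c [d ->]]]] [a' [b' [c' [d' ->]]]]; rewrite rectI; by do 4 eexists.
- by move=> n; do 4 eexists.
- apply/seteqP; split=> // -[x y] _.
  have [n xyn] : exists n : nat, `|x| + `|y| < n%:R.
    by exists (Num.truncn (`|x| + `|y|)).+1; rewrite truncnS_gt.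
  exists n => //; apply/rectE => /=.
  have := normr_ge0 x; have := normr_ge0 y => y0 x0.
  have /ltr_normlP[x1 x2] : `|x| < n%:R by lra.
  have /ltr_normlP[y1 y2] : `|y| < n%:R by lra.
  by split; apply/andP; split; lra.
- by move=> _ [a [b [c [d ->]]]]; exact: m12.
- by move=> n; exact: fin.
Qed.

Lemma open_rect_in U : open U -> forall p : P, U (toC p) ->
  exists q1 q2 : rat, exists n : nat, let s := n.+1%:R^-1 in
  rect (ratr q1 - s) (ratr q1 + s) (ratr q2 - s) (ratr q2 + s) p /\
  forall p', `|p'.1 - ratr q1| <= s -> `|p'.2 - ratr q2| <= s -> U (toC p').
Proof.
move=> /open_discP oU [x y] Up; have [e e0 eP] := oU _ Up.
pose n := Num.truncn (4 / e); pose s : R := n.+1%:R^-1.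
have s0 : 0 < s by rewrite invr_gt0.
have se : 4 * s < e.
  by rewrite /s ltr_pdivrMr// mulrC -ltr_pdivrMr// truncnS_gt.
(* Cells of radius s meeting p lie within 2 s of it in each coordinate. *)
have [q1] : exists q, ratr q \in `](x - s), (x + s)[.
  by apply: rat_in_itvoo; lra.
have [q2] : exists q, ratr q \in `](y - s), (y + s)[.
  by apply: rat_in_itvoo; lra.
rewrite !in_itv/= => /andP[b1 b2] /andP[a1 a2].
exists q1, q2, n; rewrite -/s /=; split.
  by apply/rectE; split; apply/andP; split => /=; lra.
move=> [x' y'] /=; rewrite !ler_norml => /andP[c1 c2] /andP[d1 d2].
apply: eP; apply: (le_lt_trans (ler_cnorm_ReIm _)) => /=.
have h1 : `|x' - x| <= 2 * s by rewrite ler_norml; apply/andP; split; lra.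
have h2 : `|y' - y| <= 2 * s by rewrite ler_norml; apply/andP; split; lra.
lra.
Qed.

(** The indices are all rational squares, those that stick out of U standing
    for the empty set, so that the cells inside U are indexed by a countable
    type. *)
Definition cell U (i : rat * rat * nat) : set P :=
  let s : R := i.2.+1%:R^-1 in let x := ratr i.1.1 in let y := ratr i.1.2 in
  if `[< forall p', `|p'.1 - x| <= s -> `|p'.2 - y| <= s -> U (toC p') >]
  then rect (x - s) (x + s) (y - s) (y + s) else set0.

Definition ncell U (n : nat) : set P :=
  if unpickle n is Some i then cell U i else set0.

Lemma measurable_ncell U n : measurable (ncell U n).
Proof.
rewrite /ncell; case: unpickle => // i; rewrite /cell; case: ifP => // _.
exact: measurable_rect.
Qed.

Lemma bigcup_ncell U : open U -> toC @^-1` U = \bigcup_n ncell U n.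
Proof.
move=> oU; apply/seteqP; split=> [p Up|p [n _]].
  have [q1 [q2 [n [rp rU]]]] := open_rect_in oU Up.
  have [m mE] : exists m, unpickle m = Some (q1, q2, n).
    by exists (pickle (q1, q2, n)); rewrite pickleK.
  by exists m => //; rewrite /ncell mE /cell; case: asboolP.
rewrite /ncell; case: unpickle => // -[[q1 q2] m]; rewrite /cell /=.
case: asboolP => //; set s := _^-1 => rU /rectE[/andP[a1 a2] /andP[b1 b2]]; apply: rU.
  by rewrite ler_norml; apply/andP; split; lra.
by rewrite ler_norml; apply/andP; split; lra.
Qed.

Lemma ncellP U n : ncell U n = set0 \/ exists a b c d, [/\ a < b, c < d,
  ncell U n = rect a b c d &
  forall x y, a <= x <= b -> c <= y <= d -> U (Complex x y)].
Proof.
rewrite /ncell; case: unpickle => [[[q1 q2] m]|]; last by left.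
rewrite /cell /=; set s := _^-1; case: asboolP => rU; last by left.
have s0 : 0 < s :> R by rewrite invr_gt0.
right; exists (ratr q1 - s), (ratr q1 + s), (ratr q2 - s), (ratr q2 + s).
split => //; try lra.
move=> x y /andP[a1 a2] /andP[b1 b2]; apply: (rU (x, y)) => /=.
  by rewrite ler_norml; apply/andP; split; lra.
by rewrite ler_norml; apply/andP; split; lra.
Qed.

Lemma open_measurable2 U : open U -> measurable (toC @^-1` U : set P).
Proof.
by move=> /bigcup_ncell ->; apply: bigcupT_measurable => n; exact: measurable_ncell.
Qed.

Lemma cont_measurable U k : open U -> (forall z, U z -> {for z, continuous k}) ->
  measurable_fun (toC @^-1` U : set P) (k \o toC : P -> M).
Proof.
move=> oU ck mU; apply: (measurability _ (RGenOInfty.measurableE R)) => //.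
move=> /= _ [_ [a ->] <-].
rewrite (_ : _ `&` _ = toC @^-1` (U `&` [set z | a < k z])); last first.
  by apply/seteqP; split=> p /= [Up]; rewrite in_itv/= andbT.
apply: open_measurable2; apply/open_discP => z [Uz /= ak].
have [r1 r10 r1P] := (open_discP _).1 oU _ Uz.
have ka : 0 < k z - a by rewrite subr_gt0.
have [r2 r20 r2P] := (continuousRP k z).1 (ck _ Uz) _ ka.
exists (Order.min r1 r2); first by rewrite lt_min r10.
move=> w; rewrite lt_min => /andP[/r1P Uw /r2P]; rewrite ltr_norml => /andP[h1 h2].
by split => //=; lra.
Qed.

Lemma closed_rect_bounded (k : C -> R) a b c d :
  (forall x y, a <= x <= b -> c <= y <= d -> {for Complex x y, continuous k}) ->
  exists2 B, 0 < B & forall x y, a <= x <= b -> c <= y <= d -> `|k (Complex x y)| <= B.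
Proof.
move=> ck; have cpt : compact (`[a, b] `*` `[c, d] : set (R * R)).
  by apply: compact_setX; exact: segment_compact.
have : compact ((k \o toC) @` (`[a, b] `*` `[c, d] : set (R * R))).
  apply: continuous_compact => //; apply: continuous_in_subspaceT => -[x y].
  rewrite inE /= !in_itv/= => -[hx hy].
  apply: (continuous_comp (f := @toC R) (g := k)); first exact: toC_continuous.
  exact: ck.
move=> /compact_bounded[B [Breal BP]].
exists (`|B| + 1); first by rewrite ltr_wpDl.
move=> x y hx hy; apply: (BP (`|B| + 1)).
  by rewrite (le_lt_trans (ler_norm _))// ltrDl.
by exists (x, y) => //=; rewrite !in_itv.
Qed.

End rectangles.

(** * The area formula for conformal maps *)

Section agreement.
Context {R : realType}.
Local Notation C := (Cplane R).
Local Notation M := (measurableTypeR R).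
Local Notation P := (M * M)%type.

(** The measure m has density J at w along rectangles of side ratio L : H that
    contain w. *)
Definition has_density (m : set P -> \bar R) (J L H : R) (w : C) :=
  forall e : R, 0 < e -> exists2 r : R, 0 < r & forall t x y, 0 < t < r ->
    x <= complex.Re w -> complex.Re w <= x + L * t ->
    y <= complex.Im w -> complex.Im w <= y + H * t ->
    ((J * (L * H) * t ^+ 2 - e * t ^+ 2)%:E <= m (rect x (x + L * t) y (y + H * t)) <=
     (J * (L * H) * t ^+ 2 + e * t ^+ 2)%:E)%E.

(** The difference of the two measures is additive and has density 0 at every
    point of the closed rectangle. *)
Lemma measures_agree_rect (m1 m2 : {measure set P -> \bar R}) a b c d :
  a < b -> c < d -> (m1 (rect a b c d) < +oo)%E -> (m2 (rect a b c d) < +oo)%E ->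
  (forall x y, a <= x <= b -> c <= y <= d -> exists J,
     has_density m1 J (b - a) (d - c) (Complex x y) /\
     has_density m2 J (b - a) (d - c) (Complex x y)) ->
  m1 (rect a b c d) = m2 (rect a b c d).
Proof.
move=> ab cd fin1 fin2 dens.
have sub x1 x2 y1 y2 : a <= x1 -> x2 <= b -> c <= y1 -> y2 <= d ->
    rect x1 x2 y1 y2 `<=` rect a b c d.
  move=> h1 h2 h3 h4 p /rectE[/andP[q1 q2] /andP[q3 q4]]; apply/rectE.
  by rewrite (le_lt_trans h1)// (le_trans q2)// (le_lt_trans h3)// (le_trans q4).
have finm (m : {measure set P -> \bar R}) x1 x2 y1 y2 : (m (rect a b c d) < +oo)%E ->
    a <= x1 -> x2 <= b -> c <= y1 -> y2 <= d -> m (rect x1 x2 y1 y2) \is a fin_num.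
  move=> fm h1 h2 h3 h4; rewrite ge0_fin_numE//; apply: le_lt_trans fm.
  by apply: le_measure; rewrite ?inE; try exact: measurable_rect; exact: sub.
pose mu x1 x2 y1 y2 := fine (m1 (rect x1 x2 y1 y2)) - fine (m2 (rect x1 x2 y1 y2)).
suff : mu a b c d = 0.
  move=> /eqP; rewrite subr_eq0 => /eqP E.
  by rewrite -[LHS]fineK ?finm// E fineK ?finm.
have splitx (m : {measure set P -> \bar R}) x1 x2 x3 y1 y2 : x1 < x2 -> x2 < x3 ->
    m (rect x1 x3 y1 y2) = (m (rect x1 x2 y1 y2) + m (rect x2 x3 y1 y2))%E.
  move=> h1 h2; rewrite -measureU; try exact: measurable_rect; last first.
    apply/seteqP; split=> // p [/rectE[/andP[q1 q2] _] /rectE[/andP[q3 q4] _]].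
    by move: (lt_le_trans q3 q2); rewrite ltxx.
  congr (m _); apply/seteqP; split=> p.
    move=> /rectE[/andP[q1 q2] q3]; have [q4|q4] := leP p.1 x2.
      by left; apply/rectE; rewrite q1 q4.
    by right; apply/rectE; rewrite q4 q2.
  move=> [|] /rectE[/andP[q1 q2] q3]; apply/rectE; split=> //; apply/andP; split => //.
    by rewrite (le_trans q2)// ltW.
  exact: lt_trans q1.
have splity (m : {measure set P -> \bar R}) x1 x2 y1 y2 y3 : y1 < y2 -> y2 < y3 ->
    m (rect x1 x2 y1 y3) = (m (rect x1 x2 y1 y2) + m (rect x1 x2 y2 y3))%E.
  move=> h1 h2; rewrite -measureU; try exact: measurable_rect; last first.
    apply/seteqP; split=> // p [/rectE[_ /andP[q1 q2]] /rectE[_ /andP[q3 q4]]].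
    by move: (lt_le_trans q3 q2); rewrite ltxx.
  congr (m _); apply/seteqP; split=> p.
    move=> /rectE[q3 /andP[q1 q2]]; have [q4|q4] := leP p.2 y2.
      by left; apply/rectE; rewrite q1 q4.
    by right; apply/rectE; rewrite q4 q2.
  move=> [|] /rectE[q3 /andP[q1 q2]]; apply/rectE; split=> //; apply/andP; split => //.
    by rewrite (le_trans q2)// ltW.
  exact: lt_trans q1.
apply: (additive_rect_eq0 ab cd).
- move=> x1 x2 x3 y1 y2 h1 h2 h3 h4 h5 h6 h7.
  have g1 : x2 <= b by rewrite (le_trans (ltW h3)).
  have g2 : a <= x2 by rewrite (le_trans h1)// ltW.
  by rewrite /mu !(splitx _ x1 x2 x3)// !fineD ?finm//; ring.
- move=> x1 x2 y1 y2 y3 h1 h2 h3 h4 h5 h6 h7.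
  have g1 : y2 <= d by rewrite (le_trans (ltW h6)).
  have g2 : c <= y2 by rewrite (le_trans h4)// ltW.
  by rewrite /mu !(splity _ x1 x2 y1 y2 y3)// !fineD ?finm//; ring.
move=> x y hx hy e e0; have [J [d1 d2]] := dens _ _ hx hy.
have e20 : 0 < e / 2 by rewrite divr_gt0.
have [r1 r10 r1P] := d1 _ e20; have [r2 r20 r2P] := d2 _ e20.
exists (Order.min r1 r2); first by rewrite lt_min r10.
move=> t x1 y1; rewrite lt_min => /and3P[t0 tr1 tr2] h1 h2 h3 h4 h5 h6 h7 h8.
have t1 : 0 < t < r1 by rewrite t0.
have t2 : 0 < t < r2 by rewrite t0.
have := r1P _ _ _ t1 h2 h3 h6 h7; have := r2P _ _ _ t2 h2 h3 h6 h7.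
have f1 := finm m1 _ _ _ _ fin1 h1 h4 h5 h8.
have f2 := finm m2 _ _ _ _ fin2 h1 h4 h5 h8.
rewrite /mu -(fineK f1) -(fineK f2) !lee_fin /=.
move: (fine (m1 _)) (fine (m2 _)) => u v; clear => /andP[u1 u2] /andP[v1 v2].
by rewrite ler_norml; apply/andP; split; lra.
Qed.

Lemma measures_agree_bigcup (m1 m2 : {measure set P -> \bar R}) (F : (set P)^nat) :
  (forall n, measurable (F n)) ->
  (forall n E, measurable E -> E `<=` F n -> m1 E = m2 E) ->
  forall E, measurable E -> E `<=` \bigcup_n F n -> m1 E = m2 E.
Proof.
move=> mF m12 E mE EF; pose G n := E `&` seqDU F n.
have mS n : measurable (seqDU F n).
  by apply: measurableD => //; apply: bigsetU_measurable.
have mG n : measurable (G n) by exact: measurableI.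
have tG : trivIset setT G.
  by apply: trivIset_setIl; exact: trivIset_seqDU.
have EG : E = \bigcup_n G n.
  by rewrite /G -setI_bigcupr -seqDU_bigcup_eq setIidl.
rewrite EG !measure_semi_bigcup//; try exact: bigcupT_measurable.
apply: eq_eseriesr => n _; apply: (m12 n) => //.
by move=> p [_ []].
Qed.

End agreement.

Section zero_extension.
Context {R : realType}.
Local Notation C := (Cplane R).
Local Notation M := (measurableTypeR R).
Local Notation P := (M * M)%type.

(** Extension by zero makes functions on an open set globally measurable. *)
Definition zext (U : set C) (k : C -> R) : P -> R := (k \o toC) \_ (toC @^-1` U).

Lemma zextE U k p : U (toC p) -> zext U k p = k (toC p).
Proof. by move=> Up; rewrite /zext patchE mem_set. Qed.

Lemma zext0 U k p : ~ U (toC p) -> zext U k p = 0.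
Proof. by move=> Up; rewrite /zext patchE memNset. Qed.

Lemma measurable_zext U k : open U -> (forall z, U z -> {for z, continuous k}) ->
  measurable_fun setT (zext U k : P -> M).
Proof.
move=> oU ck; apply/(measurable_restrictT _ (open_measurable2 oU)).
exact: cont_measurable.
Qed.

End zero_extension.

Section interval_perturbation.
Context {R : realType}.
Implicit Types x h s u v a : R.

Lemma itv_shrink x h s u v : x + s < v -> v <= x + h - s -> - s <= u - v -> u - v <= s ->
  x < u <= x + h.
Proof. by move=> *; apply/andP; split; lra. Qed.

Lemma itv_grow x h s u v : x < v -> v <= x + h -> - s <= u - v -> u - v <= s ->
  x - s < u <= x + h + s.
Proof. by move=> *; apply/andP; split; lra. Qed.

Lemma itv_inner x h s v : 0 <= s -> x + s < v -> v <= x + h - s -> x <= v <= x + h.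
Proof. by move=> *; apply/andP; split; lra. Qed.

Lemma dist_itv x h a v : x <= a -> a <= x + h -> x <= v <= x + h -> `|v - a| <= h.
Proof. by move=> ? ? /andP[? ?]; rewrite ler_norml; apply/andP; split; lra. Qed.

End interval_perturbation.

Section area_formula.
Context {R : realType}.
Local Notation C := (Cplane R).
Local Notation N := (@ComplexField.Normc.normc R).
Local Notation Re := (@complex.Re R).
Local Notation Im := (@complex.Im R).
Local Notation M := (measurableTypeR R).
Local Notation P := (M * M)%type.
Local Notation lam2 := (@lebesgue2 R).
Variables (U V : set C) (psi phi psi' : C -> C).
Hypotheses (oU : open U) (oV : open V).
Hypotheses (psiV : forall w, U w -> V (psi w)) (psiK : forall w, U w -> phi (psi w) = w).
Hypotheses (phiU : forall z, V z -> U (phi z)) (phiK : forall z, V z -> psi (phi z) = z).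
Hypothesis dpsi : forall w, U w -> cder psi w (psi' w).
Hypothesis dphi : forall z, V z -> cder phi z (psi' (phi z))^-1.
Hypothesis psi'0 : forall w, U w -> psi' w != 0.
Hypothesis psi'c : forall w, U w -> {for w, continuous psi'}.

Let Jac (w : C) : R := N (psi' w) ^+ 2.

Let Jac_cont w : U w -> {for w, continuous Jac}.
Proof.
move=> Uw; have cN : {for w, continuous (fun z => N (psi' z))}.
  apply/continuousRP => e e0; have [d d0 dP] := (continuousCP _ _).1 (psi'c Uw) _ e0.
  exists d => // z /dP; apply: le_lt_trans.
  have := ler_cnormD (psi' z) (psi' w - psi' z); rewrite subrKC cnorm_distC => h1.
  have := ler_cnormD (psi' w) (psi' z - psi' w); rewrite subrKC => h2.
  by rewrite ler_norml; apply/andP; split; lra.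
suff : {for w, continuous (fun z => N (psi' z) * N (psi' z))} by [].
exact: (cvgM cN cN).
Qed.

Definition jac : P -> R := zext U Jac.

Let jac_ge0 p : 0 <= jac p.
Proof.
have [Up|nUp] := pselect (U (toC p)); first by rewrite /jac zextE// sqr_ge0.
by rewrite /jac zext0.
Qed.

Lemma measurable_jac : measurable_fun setT (jac : P -> M).
Proof. by apply: measurable_zext => // w; exact: Jac_cont. Qed.

(** phi in real coordinates, extended by zero outside V to be measurable on the
    whole plane. *)
Definition coord_map (p : P) : P := (zext V (Re \o phi) p, zext V (Im \o phi) p).

Lemma coord_mapE p : V (toC p) -> coord_map p = ofC (phi (toC p)).
Proof. by move=> Vp; rewrite /coord_map !zextE. Qed.

Let phi_cont z : V z -> {for z, continuous phi}.
Proof. by move=> Vz; exact: cder_cont (dphi Vz). Qed.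

Lemma measurable_coord_map : measurable_fun setT coord_map.
Proof.
apply: measurable_fun_pair.
  apply: measurable_zext => // z Vz.
  by apply: continuous_comp; [exact: phi_cont|exact: rdiff_cont (rdiff_Re _)].
apply: measurable_zext => // z Vz.
by apply: continuous_comp; [exact: phi_cont|exact: rdiff_cont (rdiff_Im _)].
Qed.

Let V' : set P := toC @^-1` V.
Let mV' : measurable V'. Proof. exact: open_measurable2. Qed.

Let mindic : measurable_fun setT (\1_V' : P -> R).
Proof. exact: measurable_indic. Qed.

Let indic_ge0 (p : P) : 0 <= (\1_V' p : R).
Proof. by rewrite indicE. Qed.

Let lamV : {measure set P -> \bar R} := density_measure lam2 mindic indic_ge0.
Let nu : {measure set P -> \bar R} := image_measure lamV measurable_coord_map.
Let mm : {measure set P -> \bar R} := density_measure lam2 measurable_jac jac_ge0.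

Let nuE A : measurable A -> nu A = lam2 (coord_map @^-1` A `&` V').
Proof.
move=> mA; have mpA : measurable (coord_map @^-1` A).
  by rewrite -[X in measurable X]setTI; exact: measurable_coord_map.
rewrite /nu /= /pushforward /lamV /= /density_measure integral_indic//.
by rewrite setIC.
Qed.

(** The two measures are compared on rectangles of sides L t and H t that
    contain w0, as t tends to 0. *)
Section local.
Variables (w0 : C) (L H : R).
Hypotheses (Uw0 : U w0) (L0 : 0 < L) (H0 : 0 < H).

Let LH : 0 < L + H. Proof. by rewrite addr_gt0. Qed.

Let box x y t (w : C) : x <= Re w0 -> Re w0 <= x + L * t -> y <= Im w0 -> Im w0 <= y + H * t ->
  x <= Re w <= x + L * t -> y <= Im w <= y + H * t -> N (w - w0) <= (L + H) * t.
Proof.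
move=> h1 h2 h3 h4 h5 h6; rewrite (le_trans (ler_cnorm_ReIm _))// !ReImE mulrDl lerD//.
  exact: dist_itv h1 h2 h5.
exact: dist_itv h3 h4 h6.
Qed.

Lemma density_jac : has_density mm (Jac w0) L H w0.
Proof.
move=> e e0; have J0 : 0 < Jac w0 by rewrite exprn_gt0// cnorm_gt0 psi'0.
have LH0 : 0 < L * H by rewrite mulr_gt0.
pose e' := Order.min (e / (L * H)) (Jac w0).
have e'0 : 0 < e' by rewrite lt_min J0 divr_gt0.
have [d1 d10 d1P] := (continuousRP _ _).1 (Jac_cont Uw0) _ e'0.
have [d2 d20 d2P] := (open_discP _).1 oU _ Uw0.
exists (Order.min d1 d2 / (L + H)); first by rewrite divr_gt0// lt_min d10.
move=> t x y /andP[t0]; rewrite ltr_pdivlMr// lt_min => /andP[td1 td2] h1 h2 h3 h4.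
have Q p : rect x (x + L * t) y (y + H * t) p -> U (toC p) /\ `|Jac (toC p) - Jac w0| < e'.
  move=> /rectE[/andP[q1 q2] /andP[q3 q4]].
  have : N (toC p - w0) <= (L + H) * t.
    by apply: (box h1 h2 h3 h4) => /=; rewrite ?(ltW q1) ?q2 ?(ltW q3) ?q4.
  by rewrite mulrC => hN; split; [apply/d2P|apply/d1P]; exact: le_lt_trans hN _.
have lamQ : lam2 (rect x (x + L * t) y (y + H * t)) = (L * H * t ^+ 2)%:E.
  have Lt : 0 <= L * t by rewrite mulr_ge0// ltW.
  have Ht : 0 <= H * t by rewrite mulr_ge0// ltW.
  rewrite lebesgue2_rect ?lerDl//; congr (_%:E).
  by rewrite !(addrC _ (_ * t)) !addrK; ring.
have bnd : e' * (L * H * t ^+ 2) <= e * t ^+ 2.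
  rewrite mulrA ler_wpM2r ?sqr_ge0// -ler_pdivlMr//.
  by rewrite ge_min lexx.
have mQ := @measurable_rect R x (x + L * t) y (y + H * t).
have mJ : measurable_fun (rect x (x + L * t) y (y + H * t)) (EFin \o jac).
  by apply: measurable_funTS; apply/measurable_EFinP; exact: measurable_jac.
rewrite /mm /= /density_measure; apply/andP; split.
  apply: (@le_trans _ _ (\int[lam2]_(p in rect x (x + L * t) y (y + H * t)) (Jac w0 - e')%:E)%E).
    rewrite integral_cst// [lam2 _]lamQ -EFinM lee_fin; lra.
  apply: ge0_le_integral => //.
  - by move=> p _; rewrite lee_fin subr_ge0 ge_min lexx orbT.
  - move=> p /Q[Up]; rewrite lee_fin /jac zextE// ltr_norml => /andP[q1 q2]; lra.
apply: (@le_trans _ _ (\int[lam2]_(p in rect x (x + L * t) y (y + H * t)) (Jac w0 + e')%:E)%E).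
  apply: ge0_le_integral => //.
  - by move=> p _; rewrite lee_fin jac_ge0.
  - move=> p /Q[Up]; rewrite lee_fin /jac zextE// ltr_norml => /andP[q1 q2]; lra.
rewrite integral_cst// [lam2 _]lamQ -EFinM lee_fin; lra.
Qed.

(** The preimage of a small rectangle Q under phi is compared with its preimage
    under the affine map T that agrees with phi to first order at psi w0.  For
    s small and t smaller, it lies between the T-preimages of Q shrunk and of Q
    enlarged by s t on each side, whose areas are exact multiples of those of
    the rectangles. *)
Lemma density_image : has_density nu (Jac w0) L H w0.
Proof.
move=> e e0; set c := psi' w0; set z0 := psi w0.
have c0 : c != 0 by exact: psi'0.
have Nc : 0 < N c by rewrite cnorm_gt0.
have J0 : 0 < Jac w0 by rewrite exprn_gt0.
have J1 : 0 < Jac w0 + 1 by rewrite addr_gt0.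
(* s t is the tolerance in the comparison below.  Moving every side by s t changes
   the area by at most K s t^2, which fixes the bound on s. *)
pose K := 2 * (L + H) + 4; have K0 : 0 < K by rewrite /K; move: LH; lra.
pose s := Order.min (Order.min 1 (Order.min (L / 4) (H / 4))) (e / ((Jac w0 + 1) * K)).
have s0 : 0 < s by rewrite !lt_min ltr01 !divr_gt0// mulr_gt0.
have s1 : s <= 1 by rewrite !ge_min lexx.
have sL : s <= L / 4 by rewrite !ge_min lexx !orbT.
have sH : s <= H / 4 by rewrite !ge_min lexx !orbT.
have sK : Jac w0 * (s * K) <= e.
  have : s <= e / ((Jac w0 + 1) * K) by rewrite !ge_min lexx !orbT.
  rewrite ler_pdivlMr ?mulr_gt0// => h; apply: le_trans h.
  rewrite mulrCA ler_pM2l// ler_pM2r// lerDl//.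
pose T := complex_affine c^-1 (w0 - c^-1 * z0).
have [_ mT TE] : scales (N c^-1 ^- 2) T by apply: scales_complex_affine; rewrite invr_neq0.
have Tk : N c^-1 ^- 2 = Jac w0 by rewrite cnormV exprVn invrK.
rewrite {}Tk in TE.
have e10 : 0 < s * N c / (L + H) by rewrite divr_gt0// mulr_gt0.
have e20 : 0 < s / (N c * (L + H)) by rewrite divr_gt0// mulr_gt0.
have Vz0 : V z0 by exact: psiV.
have [d1 d10 d1P] := dpsi Uw0 e10.
have := dphi Vz0; rewrite psiK// => dphi0; have [d2 d20 d2P] := dphi0 _ e20.
have [d3 d30 d3P] := (open_discP _).1 oV _ Vz0.
exists (Order.min (d1 / (L + H)) (Order.min d2 d3 / (N c * (L + H)))).
  by rewrite lt_min !divr_gt0// ?mulr_gt0// lt_min d20.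
move=> t x y /andP[t0]; rewrite lt_min !ltr_pdivlMr ?mulr_gt0// lt_min.
move=> /and3P[td1 td2 td3] h1 h2 h3 h4.
have Lt : 0 < L * t by rewrite mulr_gt0.
have Ht : 0 < H * t by rewrite mulr_gt0.
have st : 0 < s * t by rewrite mulr_gt0.
have TC p : toC (T p) = w0 + c^-1 * (toC p - z0).
  by rewrite /T /complex_affine ofCK; ring.
have stL : s * t <= L * t / 4 by rewrite mulrAC ler_pM2r.
have stH : s * t <= H * t / 4 by rewrite mulrAC ler_pM2r.
rewrite nuE; last exact: measurable_rect.
have mI : measurable (coord_map @^-1` rect x (x + L * t) y (y + H * t) `&` V').
  apply: measurableI => //; rewrite -[X in measurable X]setTI.
  by apply: measurable_coord_map => //; exact: measurable_rect.
have mTr a b a' b' : measurable (T @^-1` rect a b a' b').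
  by rewrite -[X in measurable X]setTI; apply: mT => //; exact: measurable_rect.
apply/andP; split.
  have sub : T @^-1` rect (x + s * t) (x + L * t - s * t) (y + s * t) (y + H * t - s * t) `<=`
      coord_map @^-1` rect x (x + L * t) y (y + H * t) `&` V'.
    move=> p /= /rectE; have [w wE] : exists w, w = toC (T p) by exists (toC (T p)).
    have -> : (T p).1 = Re w by rewrite wE.
    have -> : (T p).2 = Im w by rewrite wE.
    move=> [/andP[q1 q2] /andP[q3 q4]].
    have Nw : N (w - w0) <= (L + H) * t.
      by apply: (box h1 h2 h3 h4); [exact: itv_inner (ltW st) q1 q2|exact: itv_inner (ltW st) q3 q4].
    have zE : toC p - z0 = c * (w - w0).
      by rewrite wE TC addrAC subrr add0r mulrA divff// mul1r.
    have Nz : N (toC p - z0) <= N c * (L + H) * t.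
      by rewrite zE cnormM -mulrA ler_pM2l.
    rewrite mulrC in Nz.
    have Vp : V (toC p) by apply: d3P; exact: le_lt_trans Nz _.
    split => //; apply/rectE; rewrite coord_mapE//.
    have := d2P _ (le_lt_trans Nz td2).
    rewrite subrKC psiK// (_ : _ - w0 - _ = phi (toC p) - w); last first.
      by rewrite zE mulrA mulVf// mul1r; ring.
    move=> hN; have {}hN : N (phi (toC p) - w) <= s * t.
      apply: (le_trans hN); rewrite -ler_pdivlMl ?divr_gt0 ?mulr_gt0//.
      apply: (le_trans Nz); rewrite le_eqVlt; apply/orP; left; apply/eqP.
      by field; rewrite !gt_eqF.
    have := le_trans (ler_Re_cnorm _) hN; have := le_trans (ler_Im_cnorm _) hN.
    rewrite !ReImE !ler_norml => /andP[i1 i2] /andP[j1 j2] /=.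
    by split; [exact: itv_shrink q1 q2 j1 j2|exact: itv_shrink q3 q4 i1 i2].
  apply: (@le_trans _ _ (lam2 (T @^-1` rect (x + s * t) (x + L * t - s * t) (y + s * t) (y + H * t - s * t)))).
    rewrite TE; last exact: measurable_rect.
    rewrite lebesgue2_rect; [|lra|lra].
    rewrite -EFinM lee_fin.
    rewrite [leRHS](_ : _ = (Jac w0 * ((L - 2 * s) * (H - 2 * s))) * t ^+ 2); last by ring.
    rewrite -mulrBl ler_wpM2r ?sqr_ge0//.
    rewrite lerBlDr -lerBlDl -mulrBr (le_trans _ sK)// ler_pM2l//.
    by rewrite /K; nra.
  by apply: le_measure; rewrite ?inE.
have sub : coord_map @^-1` rect x (x + L * t) y (y + H * t) `&` V' `<=`
    T @^-1` rect (x - s * t) (x + L * t + s * t) (y - s * t) (y + H * t + s * t).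
  move=> p [/= + Vp]; rewrite coord_mapE//; set w := phi (toC p) => /rectE /= [/andP[q1 q2] /andP[q3 q4]].
  have Nw : N (w - w0) <= (L + H) * t.
    by apply: (box h1 h2 h3 h4); rewrite ?(ltW q1) ?(ltW q3).
  rewrite mulrC in Nw.
  have := d1P _ (le_lt_trans Nw td1); rewrite subrKC phiK// => hN.
  have [u uE] : exists u, u = toC (T p) by exists (toC (T p)).
  have {}hN : N (u - w) <= s * t.
    rewrite uE (_ : _ - w = c^-1 * (toC p - psi w0 - psi' w0 * (w - w0))); last first.
      by rewrite TC -/z0 [RHS]mulrBr [c^-1 * (psi' w0 * _)]mulrA mulVf// mul1r; ring.
    rewrite cnormM cnormV ler_pdivrMl// (le_trans hN)// -ler_pdivlMl ?divr_gt0 ?mulr_gt0//.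
    apply: (le_trans Nw); rewrite le_eqVlt; apply/orP; left; apply/eqP.
    by field; rewrite !gt_eqF.
  have := le_trans (ler_Re_cnorm _) hN; have := le_trans (ler_Im_cnorm _) hN.
  rewrite !ReImE !ler_norml => /andP[i1 i2] /andP[j1 j2] /=.
  apply/rectE; have -> : (T p).1 = Re u by rewrite uE.
  have -> : (T p).2 = Im u by rewrite uE.
  by split; [exact: itv_grow q1 q2 j1 j2|exact: itv_grow q3 q4 i1 i2].
apply: (@le_trans _ _ (lam2 (T @^-1` rect (x - s * t) (x + L * t + s * t) (y - s * t) (y + H * t + s * t)))).
  by apply: le_measure; rewrite ?inE.
rewrite TE; last exact: measurable_rect.
rewrite lebesgue2_rect; [|lra|lra].
rewrite -EFinM lee_fin.
rewrite [leLHS](_ : _ = (Jac w0 * ((L + 2 * s) * (H + 2 * s))) * t ^+ 2); last by ring.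
rewrite -mulrDl ler_wpM2r ?sqr_ge0//.
rewrite -lerBlDl -mulrBr (le_trans _ sK)// ler_pM2l//.
by rewrite /K; nra.
Qed.

End local.

Let psi_cont w : U w -> {for w, continuous psi}.
Proof. by move=> Uw; exact: cder_cont (dpsi Uw). Qed.

Let inside a b c d := forall x y, a <= x <= b -> c <= y <= d -> U (Complex x y).

Let nu_fin a b c d : inside a b c d -> (nu (rect a b c d) < +oo)%E.
Proof.
move=> rU.
have [B1 B10 B1P] := @closed_rect_bounded R (Re \o psi) a b c d (fun x y hx hy =>
  continuous_comp (psi_cont (rU _ _ hx hy)) (rdiff_cont (rdiff_Re _))).
have [B2 B20 B2P] := @closed_rect_bounded R (Im \o psi) a b c d (fun x y hx hy =>
  continuous_comp (psi_cont (rU _ _ hx hy)) (rdiff_cont (rdiff_Im _))).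
rewrite nuE; last exact: measurable_rect.
apply: (@le_lt_trans _ _ (lam2 (rect (- (B1 + 1)) B1 (- (B2 + 1)) B2))); last first.
  rewrite lebesgue2_rect; [exact: ltry|lra|lra].
apply: le_measure; rewrite ?inE.
- apply: measurableI => //; rewrite -[X in measurable X]setTI.
  by apply: measurable_coord_map => //; exact: measurable_rect.
- exact: measurable_rect.
move=> p [/= + Vp]; rewrite coord_mapE// => /rectE /= [/andP[q1 q2] /andP[q3 q4]].
have hx : a <= Re (phi (toC p)) <= b by rewrite (ltW q1).
have hy : c <= Im (phi (toC p)) <= d by rewrite (ltW q3).
have E : psi (Complex (Re (phi (toC p))) (Im (phi (toC p)))) = toC p.
  rewrite -[RHS]phiK//; congr psi; exact: complex_ext.
have := B1P _ _ hx hy; have := B2P _ _ hx hy; rewrite /= E /= !ler_norml.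
by move=> /andP[r1 r2] /andP[r3 r4]; apply/rectE; split; apply/andP; split=> //; lra.
Qed.

Let mm_fin a b c d : inside a b c d -> a <= b -> c <= d -> (mm (rect a b c d) < +oo)%E.
Proof.
move=> rU ab cd.
have [B B0 BP] := @closed_rect_bounded R Jac a b c d (fun x y hx hy => Jac_cont (rU _ _ hx hy)).
apply: (@le_lt_trans _ _ (\int[lam2]_(p in rect a b c d) B%:E)%E).
  apply: ge0_le_integral => //.
  - exact: measurable_rect.
  - by move=> p _; rewrite lee_fin jac_ge0.
  - by apply: measurable_funTS; apply/measurable_EFinP; exact: measurable_jac.
  - move=> [x y] /rectE /= [/andP[q1 q2] /andP[q3 q4]].
    have hx : a <= x <= b by rewrite (ltW q1).
    have hy : c <= y <= d by rewrite (ltW q3).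
    rewrite lee_fin /jac zextE; last exact: rU.
    by have := BP _ _ hx hy; apply: le_trans; exact: ler_norm.
rewrite integral_cst; last exact: measurable_rect.
by rewrite [lam2 _]lebesgue2_rect// -EFinM ltry.
Qed.

Let nu_mm_rect a b c d : a < b -> c < d -> inside a b c d ->
  nu (rect a b c d) = mm (rect a b c d).
Proof.
move=> ab cd rU; apply: measures_agree_rect => //; [exact: nu_fin|exact: mm_fin rU (ltW ab) (ltW cd)|].
move=> x y hx hy; exists (Jac (Complex x y)); split.
  by apply: density_image; rewrite ?subr_gt0//; exact: rU.
by apply: density_jac; rewrite ?subr_gt0//; exact: rU.
Qed.

Let rect_empty (a b c d : R) : ~~ ((a < b) && (c < d)) -> rect a b c d = set0.
Proof.
move=> nab; apply/seteqP; split=> // p /rectE[/andP[q1 q2] /andP[q3 q4]].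
by move: nab; rewrite (lt_le_trans q1 q2) (lt_le_trans q3 q4).
Qed.

Let nu_mm_cell a b c d : a < b -> c < d -> inside a b c d ->
  forall E, measurable E -> E `<=` rect a b c d -> nu E = mm E.
Proof.
move=> ab cd rU E mE Er; have mr := @measurable_rect R a b c d.
suff : restricted_measure nu mr E = restricted_measure mm mr E by rewrite /restricted_measure /= /mrestr setIidl.
apply: rects_unique => // a' b' c' d'; rewrite /restricted_measure /= /mrestr rectI.
  set a1 := Order.max _ _; set b1 := Order.min _ _.
  set c1 := Order.max _ _; set d1 := Order.min _ _.
  have [/andP[ab1 cd1]|] := boolP ((a1 < b1) && (c1 < d1)); last first.
    by move=> /rect_empty ->; transitivity (0%E : \bar R); [exact: (measure0 nu)|exact/esym/(measure0 mm)].
  apply: nu_mm_rect => // x y /andP[h1 h2] /andP[h3 h4]; apply: rU.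
    by move: h1 h2; rewrite ge_max le_min => /andP[_ ->] /andP[_ ->].
  by move: h3 h4; rewrite ge_max le_min => /andP[_ ->] /andP[_ ->].
rewrite -rectI; apply: le_lt_trans (nu_fin rU).
have mI : measurable (rect a' b' c' d' `&` rect a b c d).
  by apply: measurableI => //; exact: measurable_rect.
by apply: (@le_measure _ _ _ nu); rewrite ?inE.
Qed.

Let nu_mm E : measurable E -> nu E = mm E.
Proof.
move=> mE; have mU : measurable (toC @^-1` U : set P) by exact: open_measurable2.
have -> : nu E = nu (E `&` toC @^-1` U).
  rewrite !nuE//; last exact: measurableI.
  congr (lam2 _); apply/seteqP; split=> p [/= Ep Vp]; split=> //.
    split => //; rewrite coord_mapE//= ofCK; exact: phiU.
  by case: Ep.
have -> : mm E = mm (E `&` toC @^-1` U).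
  rewrite /mm /= /density_measure [LHS]integral_mkcond [RHS]integral_mkcond.
  apply: eq_integral => p _; rewrite !patchE in_setI.
  have [Up|nUp] := pselect (U (toC p)); first by rewrite (mem_set (Up : (toC @^-1` U) p)) andbT.
  by rewrite (memNset (nUp : ~ (toC @^-1` U) p)) andbF /jac zext0//; case: ifP.
apply: (@measures_agree_bigcup R nu mm (ncell U)) => //.
- by move=> n; exact: measurable_ncell.
- move=> n F mF; have [->|[a [b [c [d [ab cd -> rU]]]]]] := ncellP U n.
    by rewrite subset0 => ->; rewrite !measure0.
  exact: nu_mm_cell.
- exact: measurableI.
- by rewrite -(bigcup_ncell oU); exact: subIsetr.
Qed.

(** Equality of the image measure and of the density measure, first on small
    rectangles, then on the cells that cover U, is equality of integrals. *)
Lemma conformal_change (G : P -> \bar R) : measurable_fun setT G -> (forall p, 0 <= G p)%E ->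
  (\int[lam2]_(p in toC @^-1` V) G (coord_map p) =
   \int[lam2]_(p in toC @^-1` U) (G p * (N (psi' (toC p)) ^+ 2)%:E))%E.
Proof.
move=> mG G0.
transitivity (\int[nu]_p G p)%E.
  rewrite [RHS](ge0_integral_pushforward measurable_coord_map)//=.
  rewrite preimage_setT ge0_integral_density//; last exact: measurableT_comp mG measurable_coord_map.
  rewrite [LHS]integral_mkcond; apply: eq_integral => p _ /=.
  rewrite patchE indicE; case: ifP => _; first by rewrite mule1.
  by rewrite mule0.
transitivity (\int[mm]_p G p)%E.
  by apply: eq_measure_integral => A mA _; exact: nu_mm.
rewrite ge0_integral_density// [RHS]integral_mkcond; apply: eq_integral => p _ /=.
rewrite patchE; have [Up|nUp] := pselect (U (toC p)).
  by rewrite (mem_set (Up : (toC @^-1` U) p)) /jac zextE.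
by rewrite (memNset (nUp : ~ (toC @^-1` U) p)) /jac zext0// mule0.
Qed.

End area_formula.

(** * Null sets and bump functions *)

Section null_sets.
Context d (T : measurableType d) (R : realType) (mu : {measure set T -> \bar R}).
Local Open Scope ereal_scope.
Import HBNNSimple.

Lemma ge0_null_le (f g : T -> \bar R) (Z : set T) : measurable Z -> mu Z = 0 ->
  (forall x, 0 <= f x) -> (forall x, 0 <= g x) -> (forall x, ~ Z x -> f x = g x) ->
  \int[mu]_x f x <= \int[mu]_x g x.
Proof.
move=> mZ Z0 f0 g0 fg; rewrite !ge0_integralTE//.
apply: ge_ereal_sup => _ [h /= hf <-].
have mC : measurable (~` Z) by exact: measurableC.
apply: (@le_trans _ _ (sintegral mu (proj_nnsfun h mC))); last first.
  apply: ereal_sup_ubound; exists (proj_nnsfun h mC) => //= x.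
  rewrite mindicE; have [Zx|nZx] := pselect (Z x).
    by rewrite memNset ?mulr0//; apply.
  by rewrite mem_set// mulr1 -fg.
rewrite -!integralT_nnsfun le_eqVlt; apply/orP; left; apply/eqP.
apply: ge0_ae_eq_integral => //.
- by apply/measurable_EFinP; exact: measurable_funP.
- by apply/measurable_EFinP; exact: measurable_funP.
- by move=> x _; rewrite lee_fin.
- by move=> x _; rewrite lee_fin.
exists Z; split => // x /= hx; apply: contrapT => nZx; apply: hx => _ /=.
by rewrite mindicE mem_set// mulr1.
Qed.

(** For arbitrary f and g: the integral is a supremum over simple functions,
    and a simple function can be replaced by 0 on the null set without changing
    its integral. *)
Lemma null_eq_integral (D : set T) (f g : T -> \bar R) (Z : set T) :
  measurable Z -> mu Z = 0 -> (forall x, D x -> ~ Z x -> f x = g x) ->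
  \int[mu]_(x in D) f x = \int[mu]_(x in D) g x.
Proof.
move=> mZ Z0 fg; have key (f' g' : T -> \bar R) : (forall x, 0 <= f' x) -> (forall x, 0 <= g' x) ->
    (forall x, D x -> ~ Z x -> f' x = g' x) ->
    \int[mu]_(x in D) f' x = \int[mu]_(x in D) g' x.
  move=> f0 g0 fg'; rewrite integral_mkcond [RHS]integral_mkcond.
  have r0 (k : T -> \bar R) : (forall x, 0 <= k x) -> forall x, 0 <= (k \_ D) x.
    by move=> k0 x; apply: erestrict_ge0.
  have E x : ~ Z x -> (f' \_ D) x = (g' \_ D) x.
    by move=> nZ; rewrite !patchE; case: ifP => // /set_mem Dx; exact: fg'.
  apply/eqP; rewrite eq_le; apply/andP; split.
    by apply: (ge0_null_le mZ Z0); [exact: r0|exact: r0|exact: E].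
  by apply: (ge0_null_le mZ Z0); [exact: r0|exact: r0|move=> x /E].
rewrite integralE [RHS]integralE; congr (_ - _); apply: key => // x Dx nZ.
  by rewrite !funeposE fg.
by rewrite !funenegE fg.
Qed.

End null_sets.

Section bumps.
Context {R : realType}.
Local Notation C := (Cplane R).
Local Notation Re := (@complex.Re R).
Local Notation Im := (@complex.Im R).

(** The functions t^-k exp (- c / t) on the positive axis, extended by 0; the
    powers of 1/t are there so that the family is closed under derivation. *)
Definition flat (c : R) (k : nat) (t : R) : R :=
  if 0 < t then (t^-1) ^+ k * expR (- (c * t^-1)) else 0.

Lemma rdiff_rder (f : R -> R) t a : rdiff (f \o Re) (Complex t 0) a 0 -> rder f t a.
Proof.
move=> H e /H[d d0 dP]; exists d => // s sd.
have Ns : ComplexField.Normc.normc (Complex s 0) = `|s|.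
  by rewrite cnormE /= expr0n addr0 sqrtr_sqr.
have := dP (Complex s 0); rewrite Ns => /(_ sd); rewrite /= mulr0 addr0.
by [].
Qed.

Lemma rder_near (f g : R -> R) t a : (exists2 r, 0 < r & forall s, `|s - t| < r -> f s = g s) ->
  rder f t a -> rder g t a.
Proof.
move=> [r r0 fg] H e /H[d d0 dP]; exists (Order.min d r); first by rewrite lt_min d0.
move=> s; rewrite lt_min => /andP[sd sr]; rewrite -!fg ?dP//.
  by rewrite subrr normr0.
by rewrite addrAC subrr add0r.
Qed.

Lemma rder_inv (t : R) : 0 < t -> rder (fun x => x^-1) t (- (t^-1) ^+ 2).
Proof.
move=> t0 e e0; exists (Order.min (t / 2) (e * t ^+ 3 / 2)).
  by rewrite lt_min !divr_gt0// mulr_gt0// exprn_gt0.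
move=> s; rewrite lt_min => /andP[st se].
have ts : t / 2 < t + s by move: st; rewrite ltr_norml => /andP[]; lra.
have ts0 : 0 < t + s by apply: le_lt_trans ts; rewrite divr_ge0// ltW.
have -> : (t + s)^-1 - t^-1 - - (t^-1) ^+ 2 * s = s ^+ 2 * (t ^- 2 * (t + s)^-1).
  by field; rewrite !gt_eqF.
rewrite normrM normrX [X in _ * X]ger0_norm; last by rewrite mulr_ge0 ?invr_ge0 ?exprn_ge0 ?ltW.
rewrite expr2 -mulrA mulrC; apply: ler_wpM2r => //.
rewrite mulrA ler_pdivrMr// ler_pdivrMr ?exprn_gt0//.
have h : e * t ^+ 2 * (t / 2) <= e * t ^+ 2 * (t + s).
  by rewrite ler_wpM2l ?(ltW ts)// mulr_ge0 ?exprn_ge0 ?ltW.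
apply: (le_trans (ltW se)); apply: le_trans (le_trans h _).
  by rewrite le_eqVlt; apply/orP; left; apply/eqP; ring.
by rewrite le_eqVlt; apply/orP; left; apply/eqP; ring.
Qed.

(** One term of the exponential series in c / t, the one of degree k + 2, leaves
    a factor t^2, so that the derivative at 0 exists and is 0. *)
Lemma flat_le (c : R) k t : 0 < c -> 0 < t ->
  flat c k t <= ((k + 2)`!%:R / c ^+ (k + 2)) * t ^+ 2.
Proof.
move=> c0 t0; rewrite /flat t0; set u := c * t^-1.
have u0 : 0 < u by rewrite mulr_gt0// invr_gt0.
have := expR_ge1Dxn (k.+1) (ltW u0).
have F0 : 0 < (k + 2)`!%:R :> R by rewrite ltr0n fact_gt0.
rewrite -[k.+2]addn2 => h; have hu : u ^+ (k + 2) / (k + 2)`!%:R <= expR u.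
  by apply: le_trans h; rewrite lerDr.
rewrite expRN ler_pdivrMr ?expR_gt0//.
rewrite mulrAC; apply: le_trans (_ : _ <= (k + 2)`!%:R / c ^+ (k + 2) * (u ^+ (k + 2) / (k + 2)`!%:R) * t ^+ 2) _.
  rewrite le_eqVlt; apply/orP; left; apply/eqP.
  have tn : t != 0 by rewrite gt_eqF.
  have cn : c ^+ (k + 2) != 0 by rewrite expf_neq0// gt_eqF.
  have Fn : (k + 2)`!%:R != 0 :> R by rewrite gt_eqF.
  rewrite /u exprMn (exprD t^-1); move: Fn cn; move: _`!%:R (c ^+ _) (t^-1 ^+ k) => F D w Fn cn.
  by field; rewrite Fn cn tn.
by rewrite ler_wpM2r ?sqr_ge0// ler_wpM2l// divr_ge0 ?ler0n// exprn_ge0// ltW.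
Qed.

Lemma flat_ge0 c k t : 0 <= flat c k t.
Proof.
by rewrite /flat; case: ifPn => // t0; rewrite mulr_ge0 ?expR_ge0// exprn_ge0// invr_ge0 ltW.
Qed.

Definition dflat c k t : R := - k%:R * flat c k.+1 t + c * flat c k.+2 t.

Lemma rder_flat c k t : 0 < c -> rder (flat c k) t (dflat c k t).
Proof.
move=> c0; have [t0|t0|t0] := ltgtP t 0.
- have -> : dflat c k t = 0.
    by rewrite /dflat /flat ltNge (ltW t0)/= !mulr0 addr0.
  apply: (@rder_near (fun=> 0)).
    exists (- t); first by rewrite oppr_gt0.
    move=> s; rewrite ltr_norml => /andP[_ h]; rewrite /flat ltNge.
    by rewrite (_ : s <= 0)//; lra.
  move=> e e0; exists 1 => // s _.
  by rewrite subrr mul0r subrr normr0 mulr_ge0// ltW.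
- have inv : rdiff (GRing.inv \o Re) (Complex t 0) (- (t^-1) ^+ 2 * 1) (- (t^-1) ^+ 2 * 0).
    by apply: (rdiff_fun1 (k := Re) (z := Complex t 0)) (rder_inv t0) (rdiff_Re (Complex t 0)).
  have pow n : rdiff (fun z => (Re z)^-1 ^+ n) (Complex t 0) (- n%:R * (t^-1) ^+ n.+1) 0.
    elim: n => [|n IH]; first by apply: rdiff_val (rdiff_cst 1 _); rewrite ?oppr0 ?mul0r.
    apply: rdiff_ext (rdiff_val _ _ (rdiffM inv IH)) => [z|/=|/=]; first by rewrite /= exprS.
      by rewrite -natr1 !exprS; ring.
    by ring.
  have ex : rdiff (expR \o (fun z => - c * (GRing.inv \o Re) z)) (Complex t 0)
      (expR (- c * t^-1) * (- c * (- (t^-1) ^+ 2 * 1))) (expR (- c * t^-1) * (- c * (- (t^-1) ^+ 2 * 0))).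
    apply: rdiff_fun1; last exact: rdiffZ inv.
    by apply: is_derive_rder; exact: is_derive_expR.
  apply: (@rder_near (fun t => (t^-1) ^+ k * expR (- (c * t^-1)))).
    exists t => // s; rewrite ltr_norml => /andP[h _]; rewrite /flat.
    by rewrite (_ : 0 < s)//; lra.
  apply: rdiff_rder; apply: rdiff_ext (rdiff_val _ _ (rdiffM (pow k) ex)) => [z|/=|/=].
  + by rewrite /= mulNr.
  + by rewrite /dflat /flat t0 !mulNr !exprS; ring.
  + by ring.
- rewrite t0; have -> : dflat c k 0 = 0.
    by rewrite /dflat /flat ltxx/= !mulr0 addr0.
  move=> e e0; set B := ((k + 2)`!%:R / c ^+ (k + 2)).
  have B0 : 0 <= B by rewrite divr_ge0// exprn_ge0// ltW.
  have B1 : 0 < B + 1 by rewrite ltr_wpDl.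
  exists (e / (B + 1)); first by rewrite divr_gt0.
  move=> s; rewrite ltr_pdivlMr// => sd; rewrite add0r mul0r subr0 {2}/flat ltxx subr0.
  rewrite ger0_norm ?flat_ge0//; have [s0|s0] := leP s 0.
    by rewrite /flat ltNge s0/= mulr_ge0// ltW.
  rewrite gtr0_norm// in sd *; apply: (le_trans (flat_le _ c0 s0)); rewrite -/B.
  by rewrite expr2 mulrA ler_wpM2r ?(ltW s0)//; nra.
Qed.

Inductive flat_gen : (C -> R) -> Prop :=
  Flat c k (s t r : R) of 0 < c : flat_gen (fun z => flat c k (s * Re z + t * Im z + r)).

Lemma flat_closed U : closed_system U (alg flat_gen).
Proof.
apply: alg_closed => _ [c k s t r c0].
have aF j : alg flat_gen (fun z => flat c j (s * Re z + t * Im z + r)).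
  by apply: alg_gen; exact: Flat.
pose d z := dflat c k (s * Re z + t * Im z + r).
have ad : alg flat_gen d.
  by apply: alg_add; apply: alg_mul; [exact: alg_cst|exact: aF|exact: alg_cst|exact: aF].
exists (fun z => d z * s), (fun z => d z * t); split.
- by apply: alg_mul => //; exact: alg_cst.
- by apply: alg_mul => //; exact: alg_cst.
move=> z _; apply: (rdiff_fun1 (f := flat c k)); first exact: rder_flat.
apply: rdiff_val (rdiffD (rdiffD (rdiffZ s (rdiff_Re z)) (rdiffZ t (rdiff_Im z))) (rdiff_cst r z)).
  by ring.
by ring.
Qed.

Variables (a b c d : R).

(** Zero outside the open rectangle, and increasing to 1 inside as n grows
    since exp (- 1 / ((n+1) t)) does for t > 0. *)
Definition bump (n : nat) (z : C) : R :=
  flat n.+1%:R^-1 0 (Re z - a) * flat n.+1%:R^-1 0 (b - Re z) *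
  (flat n.+1%:R^-1 0 (Im z - c) * flat n.+1%:R^-1 0 (d - Im z)).

Lemma bump_alg n : alg flat_gen (bump n).
Proof.
have n0 : 0 < n.+1%:R^-1 :> R by rewrite invr_gt0.
have g (s t r : R) (l : C -> R) : (forall z, l z = s * Re z + t * Im z + r) ->
    alg flat_gen (fun z => flat n.+1%:R^-1 0 (l z)).
  by move=> /funext ->; apply: alg_gen; exact: Flat.
apply: alg_mul; apply: alg_mul.
- by apply: (g 1 0 (- a)) => z; ring.
- by apply: (g (-1) 0 b) => z; ring.
- by apply: (g 0 1 (- c)) => z; ring.
- by apply: (g 0 (-1) d) => z; ring.
Qed.

Definition closed_rect : set C := [set z | a <= Re z <= b /\ c <= Im z <= d].

Lemma compact_closed_rect : compact closed_rect.
Proof.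
have -> : closed_rect = @toC R @` (`[a, b] `*` `[c, d]).
  apply/seteqP; split=> [z [h1 h2]|_ [[x y] /= [h1 h2] <-]].
    by exists (Re z, Im z) => /=; [rewrite !in_itv|apply: complex_ext].
  by move: h1 h2; rewrite !in_itv.
apply: continuous_compact; first exact/continuous_subspaceT/toC_continuous.
by apply: compact_setX; exact: segment_compact.
Qed.

Lemma flat_le1 e t : 0 <= e -> flat e 0 t <= 1.
Proof.
move=> e0; rewrite /flat; case: ifPn => // t0; rewrite expr0 mul1r -expR0 ler_expR.
by rewrite oppr_le0 mulr_ge0// invr_ge0 ltW.
Qed.

Lemma bump_ge0 n z : 0 <= bump n z.
Proof. by rewrite !mulr_ge0// flat_ge0. Qed.

Lemma bump_le1 n z : bump n z <= 1.
Proof.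
have n0 : 0 <= n.+1%:R^-1 :> R by rewrite invr_ge0.
by rewrite !mulr_ile1 ?mulr_ge0 ?flat_ge0 ?flat_le1.
Qed.

Lemma flat0 e k t : t <= 0 -> flat e k t = 0.
Proof. by rewrite /flat ltNge => ->. Qed.

Lemma bump_out n z : ~ (a < Re z < b /\ c < Im z < d) -> bump n z = 0.
Proof.
rewrite /bump => H; have [h1|h1] := leP (Re z - a) 0; first by rewrite (flat0 _ _ h1) !mul0r.
have [h2|h2] := leP (b - Re z) 0; first by rewrite (flat0 _ _ h2) mulr0 mul0r.
have [h3|h3] := leP (Im z - c) 0; first by rewrite (flat0 _ _ h3) mul0r mulr0.
have [h4|h4] := leP (d - Im z) 0; first by rewrite (flat0 _ _ h4) !mulr0.
exfalso; apply: H; rewrite !subr_gt0 in h1 h2 h3 h4.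
by rewrite h1 h2 h3 h4.
Qed.

Lemma bump_test U n : open U -> closed_rect `<=` U -> test_function U (bump n).
Proof.
move=> oU rU; apply: (test_function_extend oU compact_closed_rect rU (@flat_closed U) (bump_alg n)) => //.
move=> z nz; apply: bump_out => -[/andP[h1 h2] /andP[h3 h4]]; apply: nz.
by split; rewrite ?(ltW h1) ?(ltW h2) ?(ltW h3) ?(ltW h4).
Qed.

Lemma flat_cvg t : 0 < t -> (fun n : nat => flat n.+1%:R^-1 0 t) @ \oo --> (1 : R).
Proof.
move=> t0; have -> : (fun n : nat => flat n.+1%:R^-1 0 t) = (fun n => expR (- (n.+1%:R^-1 * t^-1))).
  by apply/funext => n; rewrite /flat t0 expr0 mul1r.
suff H : (fun n : nat => expR (- (n.+1%:R^-1 * t^-1))) @ \oo --> expR (- (0 * t^-1)).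
  by move: H; rewrite mul0r oppr0 expR0.
apply: (cvg_comp (fun n : nat => - (n.+1%:R^-1 * t^-1)) (@expR R)); last exact: continuous_expR.
apply: cvgN; apply: cvgM; last exact: cvg_cst.
exact: cvg_harmonic.
Qed.

Lemma bump_cvg z : a < Re z < b -> c < Im z < d -> (fun n => bump n z) @ \oo --> (1 : R).
Proof.
move=> /andP[h1 h2] /andP[h3 h4]; rewrite -[X in _ --> X](mulr1 (1 : R)) -{1 2}(mulr1 (1 : R)).
by apply: cvgM; apply: cvgM; apply: flat_cvg; rewrite subr_gt0.
Qed.

End bumps.

(** * Uniqueness of weak derivatives *)

Section du_bois_reymond.
Context {R : realType}.
Local Notation C := (Cplane R).
Local Notation Re := (@complex.Re R).
Local Notation Im := (@complex.Im R).
Local Notation M := (measurableTypeR R).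
Local Notation P := (M * M)%type.
Local Notation lam := (@lebesgue_measure R).
Local Notation lam2 := (@lebesgue2 R).
Implicit Types (U V A : set C) (f g : C -> R) (h : P -> R).

Lemma null_setU2 (Z1 Z2 : set P) : measurable Z1 -> lam2 Z1 = 0%E -> measurable Z2 -> lam2 Z2 = 0%E ->
  measurable (Z1 `|` Z2) /\ lam2 (Z1 `|` Z2) = 0%E.
Proof.
move=> m1 n1 m2 n2; have mU : measurable (Z1 `|` Z2) by exact: measurableU.
split=> //; apply: (measure_negligible mU); apply: negligibleU; exact/negligibleP.
Qed.

(** The positive and negative parts of h are densities of two finite measures
    that agree on rectangles, hence on all Borel sets. *)
Lemma ae_eq0_of_rect_integrals h a b c d : measurable_fun setT (h : P -> M) ->
  lam2.-integrable (rect a b c d) (EFin \o h) ->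
  (forall a' b' c' d', rect a' b' c' d' `<=` rect a b c d ->
     (\int[lam2]_(p in rect a' b' c' d') (h p)%:E = 0)%E) ->
  exists Z, [/\ measurable Z, lam2 Z = 0%E & forall p, rect a b c d p -> ~ Z p -> h p = 0].
Proof.
move=> mh ih h0; set Q := rect a b c d in ih *; have mQ : measurable Q by exact: measurable_rect.
pose k := h \_ Q.
have mk : measurable_fun setT (k : P -> M).
  by apply/(measurable_restrictT _ mQ); exact: measurable_funS mh.
have kE : EFin \o k = (EFin \o h) \_ Q by rewrite /k restrict_EFin.
have ik : lam2.-integrable setT (EFin \o k) by rewrite kE; exact/(integrable_mkcond _ mQ).
have iks X : measurable X -> lam2.-integrable X (EFin \o k).
  by move=> mX; exact: integrableS ik.
have mp : measurable_fun setT (funrpos k : P -> M) by exact: measurable_funrpos.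
have mn : measurable_fun setT (funrneg k : P -> M) by exact: measurable_funrneg.
pose m1 := density_measure lam2 mp (funrpos_ge0 k) : {measure set P -> \bar R}.
pose m2 := density_measure lam2 mn (funrneg_ge0 k) : {measure set P -> \bar R}.
have m1E X : m1 X = (\int[lam2]_(p in X) (EFin \o k)^\+ p)%E by rewrite funerpos.
have m2E X : m2 X = (\int[lam2]_(p in X) (EFin \o k)^\- p)%E by rewrite funerneg.
have kX X : measurable X -> (\int[lam2]_(p in X) (EFin \o k) p)%E = (m1 X - m2 X)%E.
  by move=> mX; rewrite integralE m1E m2E.
have m12 X : measurable X -> m1 X = m2 X.
  apply: rects_unique => a' b' c' d'; last first.
    have mr := measurable_rect a' b' c' d'.
    by have := integrable_pos_fin_num mr (iks _ mr); rewrite -m1E ltey_eq => ->.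
  have mr := measurable_rect a' b' c' d'.
  have := kX _ mr; rewrite kE -integral_mkcondr rectI /= h0; last first.
    by rewrite -rectI => p [].
  have := integrable_neg_fin_num mr (iks _ mr); rewrite -m2E => fin /esym E.
  by rewrite -[LHS](subeK _ fin) E add0e.
have : ae_eq lam2 setT (EFin \o k) (cst 0%E).
  apply: integral_ae_eq => // X _ mX.
  rewrite kX// m12// integral_cst// mul0e subee//.
  by have := integrable_neg_fin_num mX (iks _ mX); rewrite -m2E.
move=> [Z [mZ Z0 kZ]]; exists Z; split => // p Qp nZp.
apply: contrapT => hp; apply: nZp; apply: kZ => /= /(_ I) [].
by rewrite /k patchE mem_set.
Qed.

(** Dominated convergence; the bumps converge to the indicator of the open
    rectangle, which differs from the half-open one by two segments. *)
Lemma bump_rect_integral h A a b c d : measurable_fun setT (h : P -> M) -> open A ->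
  a < b -> c < d -> closed_rect a b c d `<=` A ->
  lam2.-integrable (rect a b c d) (EFin \o h) ->
  (forall n, (\int[lam2]_(p in toC @^-1` A) (h p * bump a b c d n (toC p))%:E = 0)%E) ->
  (\int[lam2]_(p in rect a b c d) (h p)%:E = 0)%E.
Proof.
move=> mh oA ab cd rA ih h0; set Q := rect a b c d in ih *.
have mQ : measurable Q by exact: measurable_rect.
have bumpT n : test_function A (bump a b c d n) by exact: bump_test.
have bmeas n : measurable_fun setT (bump a b c d n \o toC : P -> M).
  have [/(_ [::])[/= cb _] _ _] := bumpT n.
  have -> : (setT : set P) = toC @^-1` setT by [].
  by apply: cont_measurable; [exact: openT|move=> z _; exact: cb].
have out n p : ~ Q p -> bump a b c d n (toC p) = 0.
  move=> nQ; apply: bump_out => /= -[/andP[x1 x2] /andP[x3 x4]]; apply: nQ.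
  by apply/rectE; rewrite x1 x3 !ltW.
have QA : Q `<=` toC @^-1` A.
  move=> p /rectE[/andP[x1 x2] /andP[x3 x4]]; apply: rA; split => /=.
    by rewrite (ltW x1).
  by rewrite (ltW x3).
have := @dominated_convergence _ _ R lam2 Q mQ (fun n p => (h p * bump a b c d n (toC p))%:E)
  (EFin \o h) (fun p => `|(h p)%:E|%E).
case=> //.
- move=> n; apply/measurable_EFinP; apply: measurable_funTS.
  exact: (measurable_funM mh (bmeas n)).
- by apply/measurable_EFinP; exact: measurable_funTS.
- pose L : set P := ([set b] `*` setT) `|` (setT `*` [set d]).
  have mL1 : measurable ([set b] `*` setT : set P) by exact: measurableX.
  have mL2 : measurable (setT `*` [set d] : set P) by exact: measurableX.
  exists L; split.
  + exact: measurableU.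
  + apply: null_set_setU => //.
    * have -> : lam2 ([set b] `*` setT) = (lam [set b] * lam setT)%E by exact: product_measure1E.
      by rewrite lebesgue_measure_set1 mul0e.
    * have -> : lam2 (setT `*` [set d]) = (lam setT * lam [set d])%E by exact: product_measure1E.
      by rewrite lebesgue_measure_set1 mule0.
  move=> p /=; apply: contra_notP => nL Qp.
  have pb : p.1 != b by apply/eqP => E; apply: nL; left.
  have pd : p.2 != d by apply/eqP => E; apply: nL; right.
  move/rectE: Qp => [/andP[x1 x2] /andP[x3 x4]].
  apply/cvg_EFin; first by near=> n.
  rewrite -[X in _ --> X]mulr1; apply: cvgM; first exact: cvg_cst.
  by apply: bump_cvg => /=; rewrite ?x1 ?x3/= lt_neqAle ?pb ?pd.
- exact: integrable_abse.
- apply: aeW => p n _; rewrite lee_fin normrM ler_piMr//.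
  by rewrite ger0_norm ?bump_ge0 ?bump_le1.
move=> _ _ H; have E : (fun n => \int[lam2]_(p in Q) (h p * bump a b c d n (toC p))%:E)%E = cst 0%E.
  apply/funext => n /=; rewrite -(h0 n) integral_mkcond [RHS]integral_mkcond.
  apply: eq_integral => p _; rewrite !patchE.
  case: ifPn => [/set_mem Qp|]; first by rewrite mem_set//; exact: QA.
  by rewrite notin_setE => nQ; case: ifP => // _; rewrite out// mulr0.
rewrite E in H; apply/esym; apply: cvg_unique H; first exact: ereal_hausdorff.
exact: cvg_cst.
Unshelve. all: by end_near. Qed.

Lemma compact_measurable2 (K : set C) : compact K -> measurable (toC @^-1` K : set P).
Proof.
move=> cK; rewrite -[X in measurable X]setCK preimage_setC; apply: measurableC.
apply: open_measurable2; rewrite openC; apply: compact_closed cK.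
exact: norm_hausdorff.
Qed.

(** A Lebesgue measurable function need not be Borel, so computations are done
    on a Borel representative h; the exceptional null set Z is kept explicit in
    order to be transported by conformal maps. *)
Definition represents A g h (Z : set P) : Prop :=
  [/\ measurable_fun setT (h : P -> M), measurable Z, lam2 Z = 0%E,
      (forall p, A (toC p) -> ~ Z p -> g (toC p) = h p) &
      (forall p, ~ A (toC p) -> h p = 0)].

Lemma borel_representative A g : open A -> lebesgue_measurable_fun A g ->
  exists h Z, represents A g h Z.
Proof.
move=> oA [h mh [Z [mZ Z0 gh]]]; exists (h \_ (toC @^-1` A)), Z; split => //.
- exact/(measurable_restrictT _ (open_measurable2 oA)).
- move=> p Ap nZ; rewrite patchE mem_set//; apply: contrapT => ne; apply: nZ.
  by apply: gh => /= /(_ Ap).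
- by move=> p nA; rewrite patchE memNset.
Qed.

Lemma loc_integrable_on A g h Z K : loc_integrable A g -> represents A g h Z ->
  compact K -> K `<=` A -> lam2.-integrable (toC @^-1` K) (EFin \o h).
Proof.
move=> [_ ig] [mh mZ Z0 gh _] cK KA.
apply/integrableP; split; first by apply/measurable_EFinP; exact: measurable_funTS.
have := ig _ KA cK; rewrite /area_integral.
rewrite (null_eq_integral (g := (fun p => `|(h p)%:E|%E)) mZ Z0)// => p Kp nZ.
by rewrite gh//; exact: KA.
Qed.

(** The integrals in the definition of weak derivatives are finite, so they may
    be split and subtracted. *)
Lemma pairing_integrable A g h Z (k : C -> R) K : loc_integrable A g -> represents A g h Z ->
  continuous k -> compact K -> K `<=` A -> (forall z, ~ K z -> k z = 0) ->
  lam2.-integrable setT (fun p => (h p * k (toC p))%:E).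
Proof.
move=> lg rg ck cK KA k0; have ihK := loc_integrable_on lg rg cK KA; have [mh _ _ _ _] := rg.
have mK := compact_measurable2 cK.
have [B0 [Breal kB]] : bounded_set (k @` K).
  by apply: compact_bounded; apply: continuous_compact => //; exact: continuous_subspaceT.
pose B := `|B0| + 1.
have {}kB z : K z -> `|k z| <= B.
  move=> Kz; apply: kB; last by exists z.
  by rewrite (le_lt_trans (ler_norm _))// ltrDl.
have mk : measurable_fun setT (k \o toC : P -> M).
  have -> : (setT : set P) = toC @^-1` setT by [].
  by apply: cont_measurable; [exact: openT|move=> z _; exact: ck].
have : lam2.-integrable setT (fun p => B%:E * ((EFin \o h) \_ (toC @^-1` K)) p)%E.
  by apply: integrableZl => //; exact/(integrable_mkcond _ mK).
apply: le_integrable => //.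
  by apply/measurable_EFinP; exact: (measurable_funM mh mk).
move=> p _; rewrite patchE; case: ifPn => [/set_mem Kp|].
  change (`|h p * k (toC p)|%:E <= `|B * h p|%:E)%E.
  rewrite lee_fin !normrM mulrC ler_wpM2r//.
  by rewrite (le_trans (kB _ Kp))// ler_norm.
rewrite notin_setE => nK; change (`|(h p * k (toC p))%:E| <= `|B%:E * 0|)%E.
by rewrite k0// mulr0 mule0.
Qed.

Lemma test_support U eta : test_function U eta -> let K := closure [set z : C | eta z != 0] in
  [/\ compact K, K `<=` U, continuous eta, (forall b, continuous (partial b eta)) &
    forall z, ~ K z -> eta z = 0 /\ forall b, partial b eta z = 0].
Proof.
move=> [se cK KU] K; split=> //; first by have [/= ] := se [::].
  by move=> b; have [/= ] := se [:: b].
move=> z nK; have z0 w : ~ K w -> eta w = 0.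
  by move=> nKw; apply/eqP; apply: contrapT => /negP ne; apply: nKw; exact: subset_closure.
split=> [|b]; first exact: z0.
have oK : open (~` K) by rewrite openC; exact: closed_closure.
have : rdiff eta z 0 0.
  apply: (rdiff_near (k := cst 0)); last exact: rdiff_cst.
  apply/cnbhsP; have /open_discP/(_ z nK)[e e0 eK] := oK.
  by exists e => // w /eK nKw; rewrite z0.
move/rdiff_partial => /(_ b)[_ ->]; by case: b.
Qed.

(** Both candidates have the same pairing with every test function, in
    particular with the bumps of every rectangle of A; A is a countable union of
    cells, and on each of them the difference has vanishing integrals over
    rectangles. *)
Lemma weak_partial_unique (b : bool) A f g1 g2 : open A ->
  is_weak_partial b A f g1 -> is_weak_partial b A f g2 ->
  exists Z : set P, [/\ measurable Z, lam2 Z = 0%E & forall p, A (toC p) -> ~ Z p -> g1 (toC p) = g2 (toC p)].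
Proof.
move=> oA [l1 w1] [l2 w2].
have [h1 [Z1 r1]] := borel_representative oA l1.1.
have [h2 [Z2 r2]] := borel_representative oA l2.1.
have [[mh1 mZ1 Z10 gh1 _] [mh2 mZ2 Z20 gh2 _]] := (r1, r2).
have mA := open_measurable2 oA.
suff cells n : exists Z : set P, [/\ measurable Z, lam2 Z = 0%E &
    forall p, ncell A n p -> ~ Z p -> h1 p - h2 p = 0].
  have [Y YP] := choice cells; exists (Z1 `|` Z2 `|` \bigcup_n Y n); split.
  - by apply: measurableU; [exact: measurableU|apply: bigcupT_measurable => n; have [] := YP n].
  - apply: measure_negligible.
      by apply: measurableU; [exact: measurableU|apply: bigcupT_measurable => n; have [] := YP n].
    apply: negligibleU; first by apply: negligibleU; apply/negligibleP.
    by apply: negligible_bigcup => n; have [mY Y0 _] := YP n; apply/negligibleP.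
  move=> p Ap nZ; have : (toC @^-1` A) p by [].
  rewrite (bigcup_ncell oA) => -[n _ np].
  rewrite gh1 ?gh2//; last 2 first.
  - by move=> Zp; apply: nZ; left; right.
  - by move=> Zp; apply: nZ; left; left.
  apply/eqP; rewrite -subr_eq0; apply/eqP; have [_ _] := YP n; apply => // Yp.
  by apply: nZ; right; exists n.
have [->|[a [b' [c [d [ab cd -> rA]]]]]] := ncellP A n; first by exists set0; split.
have cA : closed_rect a b' c d `<=` A by case=> x y [/= x1 y1]; exact: rA.
have sub : rect a b' c d `<=` toC @^-1` closed_rect a b' c d.
  by move=> p /rectE[/andP[x1 x2] /andP[x3 x4]]; split; rewrite /= ?(ltW x1) ?(ltW x3).
have mrect := measurable_rect a b' c d.
have ir g h Z : loc_integrable A g -> represents A g h Z ->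
    lam2.-integrable (rect a b' c d) (EFin \o h).
  move=> lg rg; apply: integrableS (loc_integrable_on lg rg (@compact_closed_rect _ a b' c d) cA) => //.
  by apply: compact_measurable2; exact: compact_closed_rect.
have mh : measurable_fun setT (h1 \- h2 : P -> M) by exact: measurable_funB.
have ih : lam2.-integrable (rect a b' c d) (EFin \o (h1 \- h2)).
  have := integrableB mrect (ir _ _ _ l1 r1) (ir _ _ _ l2 r2).
  by apply: eq_integrable => // p _ /=; rewrite EFinB.
apply: (ae_eq0_of_rect_integrals mh ih) => a1 b1 c1 d1 sub1.
have [ab1|ab1] := ltP a1 b1; last first.
  rewrite (_ : rect _ _ _ _ = set0) ?integral_set0// -subset0 => p /rectE[/andP[x1 x2] _].
  by have := lt_le_trans x1 x2; rewrite ltNge ab1.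
have [cd1|cd1] := ltP c1 d1; last first.
  rewrite (_ : rect _ _ _ _ = set0) ?integral_set0// -subset0 => p /rectE[_ /andP[x1 x2]].
  by have := lt_le_trans x1 x2; rewrite ltNge cd1.
have cA1 : closed_rect a1 b1 c1 d1 `<=` A.
  have in1 x y : a1 < x <= b1 -> c1 < y <= d1 -> (a < x <= b') /\ (c < y <= d).
    by move=> x1 y1; apply/(rectE a b' c d (x, y))/sub1/rectE.
  have [] := in1 b1 d1; rewrite ?ab1 ?cd1 ?lexx// => /andP[_ bb] /andP[_ dd].
  have aa : a <= a1.
    rewrite leNgt; apply/negP => lt; have [] := in1 (Order.min a b1) d1.
    - by rewrite lt_min lt ab1 ge_min lexx orbT.
    - by rewrite cd1 lexx.
    by rewrite lt_min ltxx.
  have cc : c <= c1.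
    rewrite leNgt; apply/negP => lt; have [] := in1 b1 (Order.min c d1).
    - by rewrite ab1 lexx.
    - by rewrite lt_min lt cd1 ge_min lexx orbT.
    by move=> _; rewrite lt_min ltxx.
  move=> [x y] [/= /andP[x1 x2] /andP[y1 y2]]; apply: rA.
    by rewrite (le_trans aa x1) (le_trans x2 bb).
  by rewrite (le_trans cc y1) (le_trans y2 dd).
apply: (bump_rect_integral mh oA ab1 cd1 cA1).
  by apply: integrableS sub1 ih => //; exact: measurable_rect.
move=> m; have bt : test_function A (bump a1 b1 c1 d1 m) by exact: bump_test.
have [/= cK KA ceta _ eta0] := test_support bt.
have ip g h Z : loc_integrable A g -> represents A g h Z ->
    lam2.-integrable (toC @^-1` A) (fun p => (h p * bump a1 b1 c1 d1 m (toC p))%:E).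
  move=> lg rg; apply: (integrableS measurableT mA) => //.
  by apply: (pairing_integrable lg rg ceta cK KA) => z /eta0[].
transitivity (\int[lam2]_(p in toC @^-1` A) ((h1 p * bump a1 b1 c1 d1 m (toC p))%:E -
    (h2 p * bump a1 b1 c1 d1 m (toC p))%:E))%E.
  by apply: eq_integral => p _; rewrite -EFinB -mulrBl.
rewrite integralB//; [|exact: (ip _ _ _ l1 r1)|exact: (ip _ _ _ l2 r2)].
have eqh g h Z : represents A g h Z ->
    (\int[lam2]_(p in toC @^-1` A) (h p * bump a1 b1 c1 d1 m (toC p))%:E)%E =
    area_integral A (fun z => (g z * bump a1 b1 c1 d1 m z)%:E).
  by move=> [_ mZ Z0 gh _]; apply: (null_eq_integral mZ Z0) => p Ap nZ; rewrite gh.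
have := w1 _ bt; rewrite w2// => /oppe_inj E.
rewrite (eqh _ _ _ r1) (eqh _ _ _ r2) E subee// -(eqh _ _ _ r1).
exact: integrable_fin_num (ip _ _ _ l1 r1).
Qed.

End du_bois_reymond.

(** * Conformal maps and their inverses *)

Section conformal_pairs.
Context {R : realType}.
Local Notation C := (Cplane R).
Local Notation Re := (@complex.Re R).
Local Notation Im := (@complex.Im R).
Local Notation N := (@ComplexField.Normc.normc R).
Local Notation M := (measurableTypeR R).
Local Notation P := (M * M)%type.
Implicit Types (U V A : set C) (f g : C -> R) (h : P -> R).

(** If k is the increment of psi for the increment h, then h = c k + o(k); hence
    |k| <= 2 |h| / |c| for h small and k - h / c = o(h). *)
Lemma cder_inverse V (phi psi : C -> C) w c : open V -> V w -> {for w, continuous psi} ->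
  (forall v, V v -> phi (psi v) = v) -> cder phi (psi w) c -> c != 0 -> cder psi w c^-1.
Proof.
move=> oV Vw cpsi psiK dphi c0 e e0.
have c1 : 0 < N c by rewrite cnorm_gt0.
pose e' := Order.min (N c / 2) (e * N c ^+ 2 / 2).
have e'0 : 0 < e' by rewrite lt_min !divr_gt0// mulr_gt0// exprn_gt0.
have [d d0 dP] := dphi _ e'0.
have [d1 d10 d1P] : exists2 d1 : R, 0 < d1 & forall v, N (v - w) < d1 -> N (psi v - psi w) < d.
  by move/continuousCP : cpsi => /(_ _ d0)[d1 d10 H]; exists d1.
have /open_discP/(_ w Vw)[d2 d20 d2P] := oV.
exists (Order.min d1 d2); first by rewrite lt_min d10.
move=> h; rewrite lt_min => /andP[h1 h2].
have wh : w + h - w = h by rewrite addrAC subrr add0r.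
set k := psi (w + h) - psi w.
have kd : N k < d by apply: d1P; rewrite wh.
have := dP _ kd; rewrite /k [psi w + _]addrC subrK psiK ?psiK//; last by apply: d2P; rewrite wh.
rewrite wh -/k => Hk.
have kE : k - c^-1 * h = - c^-1 * (h - c * k) by rewrite mulrBr !mulNr mulrA mulVf// mul1r opprK addrC.
have ck : N c * N k <= N h + e' * N k.
  rewrite -cnormM (_ : c * k = h - (h - c * k)); last by rewrite opprB addrC subrK.
  by apply: le_trans (ler_cnormD _ _) _; rewrite cnormN lerD2l.
rewrite kE cnormM cnormN cnormV mulrC ler_pdivrMr//; apply: (le_trans Hk).
have e1 : e' <= N c / 2 by rewrite /e' ge_min lexx.
have e2 : e' <= e * N c ^+ 2 / 2 by rewrite /e' ge_min lexx orbT.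
have k0 := cnorm_ge0 k; have k1 : N c * N k <= 2 * N h.
  have := ler_wpM2r k0 e1; move: ck; move: (e' * N k) (N k) (N c) (N h) => x y z t; nra.
apply: (le_trans (ler_wpM2r k0 e2)).
have -> : e * N c ^+ 2 / 2 * N k = e * N c / 2 * (N c * N k) by field.
have h0 : 0 <= e * N c / 2 by rewrite divr_ge0// mulr_ge0 ?ltW.
apply: (le_trans (ler_wpM2l h0 k1)); rewrite le_eqVlt; apply/orP; left; apply/eqP; by field.
Qed.

(** A symmetric description of a conformal map together with its inverse: every
    statement about phi gives one about psi by [conformal_pair_sym]. *)
Record conformal_pair U V (phi psi phi' psi' : C -> C) : Prop := ConformalPair {
  pair_openl : open U;
  pair_openr : open V;
  pair_maps : forall z, U z -> V (phi z);
  pair_mapsV : forall w, V w -> U (psi w);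
  pairK : forall z, U z -> psi (phi z) = z;
  pairKV : forall w, V w -> phi (psi w) = w;
  pair_der : forall z, U z -> cder phi z (phi' z);
  pair_derV : forall w, V w -> cder psi w (psi' w);
  pair_der_inv : forall z, U z -> phi' z * psi' (phi z) = 1 }.

Lemma conformal_pair_sym U V phi psi phi' psi' :
  conformal_pair U V phi psi phi' psi' -> conformal_pair V U psi phi psi' phi'.
Proof.
case=> oU oV UV VU K KV d dV di; split => // w Vw.
by rewrite mulrC -{2}(KV _ Vw); apply: di; exact: VU.
Qed.

Section homeomorphisms.
Variables (U V : set C) (phi : C -> C).
Hypotheses (oU : open U) (oV : open V) (cphi : conformal_homeomorphism U V phi).
Local Notation psi := (inv_on U phi).

Let phiV z : U z -> V (phi z).
Proof. by have [[[+ _ _] _ _] _] := cphi => /[apply]. Qed.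

Let phi_img : phi @` U = V.
Proof.
have [[[UV _ VU] _ _] _] := cphi; apply/seteqP; split=> [_ [z Uz <-]|]; first exact: UV.
exact: VU.
Qed.

Let inj : {in U &, injective phi}.
Proof. by have [[[_ + _] _ _] _] := cphi. Qed.

Let psiK z : U z -> psi (phi z) = z.
Proof. by move=> Uz; apply: pinvKV; [exact: inj|exact: mem_set]. Qed.

Let psi_bij : set_bij V U psi.
Proof. by apply: bijpinv_bij; have [[]] := cphi. Qed.

Let psiU w : V w -> U (psi w).
Proof. by have [+ _ _] := psi_bij => /[apply]. Qed.

Let phiK w : V w -> phi (psi w) = w.
Proof. by move=> Vw; apply: pinvK; rewrite phi_img inE. Qed.

Let dphi z : U z -> cder phi z (derive1 phi z).
Proof. by have [_ H] := cphi => /H[dz _]; exact: cder_derive1. Qed.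

Let dphi0 z : U z -> derive1 phi z != 0.
Proof. by have [_ H] := cphi => /H[]. Qed.

Let psi_cont w : V w -> {for w, continuous psi}.
Proof.
have [[_ _ +] _] := cphi; rewrite continuous_open_subspace// => H Vw.
by apply: H; rewrite inE.
Qed.

Let dpsi w : V w -> cder psi w (derive1 phi (psi w))^-1.
Proof.
by move=> Vw; apply: (cder_inverse oV Vw (psi_cont Vw) phiK (dphi (psiU Vw))); exact/dphi0/psiU.
Qed.

Let dpsiE w : V w -> derive1 psi w = (derive1 phi (psi w))^-1.
Proof. by move=> /dpsi/derive1_cder[]. Qed.

Lemma conformal_homeomorphism_pair : conformal_pair U V phi psi (derive1 phi) (derive1 psi).
Proof.
split=> //; first by move=> w Vw; rewrite dpsiE//; exact: dpsi.
by move=> z Uz; rewrite (dpsiE (phiV Uz)) (psiK Uz) mulfV//; exact: dphi0.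
Qed.

Lemma conformal_homeomorphism_inv : conformal_homeomorphism V U psi.
Proof.
split; last first.
  move=> w Vw; have [dw ->] := derive1_cder (dpsi Vw).
  by split=> //; rewrite invr_eq0; exact/dphi0/psiU.
have [[_ c1 c2] _] := cphi; split; [exact: psi_bij|exact: c2|].
apply: (subspace_eq_continuous _ c1) => z /set_mem Uz.
have inj' : {in V &, injective psi} by have [] := psi_bij.
by rewrite -[in RHS](psiK Uz); apply/esym/pinvKV => //; exact/mem_set/phiV.
Qed.

End homeomorphisms.

End conformal_pairs.

(** * Change of variables and local integrability *)

Section pullback.
Context {R : realType}.
Local Notation C := (Cplane R).
Local Notation Re := (@complex.Re R).
Local Notation Im := (@complex.Im R).
Local Notation N := (@ComplexField.Normc.normc R).
Local Notation M := (measurableTypeR R).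
Local Notation P := (M * M)%type.
Local Notation lam2 := (@lebesgue2 R).
Implicit Types (A : set C) (f g m : C -> R) (h : P -> R).

Section integrals.
Variables (U V : set C) (phi psi phi' psi' : C -> C).
Hypothesis cp : conformal_pair U V phi psi phi' psi'.
Let oU := pair_openl cp.
Let oV := pair_openr cp.
Let U' : set P := toC @^-1` U.
Let V' : set P := toC @^-1` V.
Let mV' : measurable V' := open_measurable2 oV.
Let mU' : measurable U' := open_measurable2 oU.

Lemma pair_holo : holo U phi.
Proof. by move=> z Uz; exists (phi' z); exact: pair_der cp _ Uz. Qed.

Lemma pair_holo_der : holo U phi'.
Proof. by move=> z Uz; exact: cder_deriv oU (pair_der cp) _ Uz. Qed.

Lemma pair_derV_eq w : V w -> psi' w = (phi' (psi w))^-1.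
Proof.
move=> Vw; have Uw := pair_mapsV cp Vw; have := pair_der_inv cp Uw.
rewrite (pairKV cp Vw) => H; have n0 : phi' (psi w) != 0.
  by apply/eqP => E; move: H; rewrite E mul0r => /esym/eqP; rewrite oner_eq0.
by rewrite -[LHS]mul1r -(mulVf n0) -mulrA H mulr1.
Qed.

Lemma pair_der_neq0 z : U z -> phi' z != 0.
Proof.
move=> /(pair_der_inv cp) H; apply/eqP => E; move: H.
by rewrite E mul0r => /esym/eqP; rewrite oner_eq0.
Qed.

Definition jacobian (z : C) : R := N (phi' z) ^+ 2.

Lemma pair_change (G : P -> \bar R) : measurable_fun setT G -> (forall p, (0 <= G p)%E) ->
  (\int[lam2]_(p in V') G (coord_map V psi p) = \int[lam2]_(p in U') (G p * (jacobian (toC p))%:E))%E.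
Proof.
move=> mG G0; apply: (conformal_change oU oV (pair_maps cp) (pairK cp) (pair_mapsV cp) (pairKV cp)
  (pair_der cp)) => //.
- by move=> w Vw; rewrite -pair_derV_eq//; exact: pair_derV cp _ Vw.
- exact: pair_der_neq0.
- by move=> z /pair_holo_der[c /cder_cont].
Qed.

Let mphit : measurable_fun setT (coord_map V psi).
Proof. apply: (@measurable_coord_map R V psi phi' oV) => w Vw.
by rewrite -pair_derV_eq//; exact: pair_derV cp _ Vw. Qed.

(** The Jacobian is nonnegative, so positive and negative parts can be
    transformed separately. *)
Lemma pair_change_signed h : measurable_fun setT (h : P -> M) ->
  (\int[lam2]_(p in V') (h (coord_map V psi p))%:E =
   \int[lam2]_(p in U') (h p * jacobian (toC p))%:E)%E.
Proof.
move=> mh; have j0 z : 0 <= jacobian z by exact: sqr_ge0.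
rewrite integralE [RHS]integralE; congr (_ - _)%E.
- transitivity (\int[lam2]_(p in V') (EFin \o h)^\+ (coord_map V psi p))%E.
    by apply: eq_integral => p _; rewrite !funeposE.
  rewrite pair_change//; first last.
    by apply: measurable_funepos; exact/measurable_EFinP.
  by apply: eq_integral => p _; rewrite !funeposE /= -!EFin_max -EFinM maxr_pMl// mul0r.
- transitivity (\int[lam2]_(p in V') (EFin \o h)^\- (coord_map V psi p))%E.
    by apply: eq_integral => p _; rewrite !funenegE.
  rewrite pair_change//; first last.
    by apply: measurable_funeneg; exact/measurable_EFinP.
  by apply: eq_integral => p _; rewrite !funenegE /= -!EFin_max -EFinM maxr_pMl// mul0r mulNr.
Qed.

(** Conformal maps preserve null sets; this makes f o psi measurable for f
    Lebesgue measurable. *)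
Lemma null_pullback (Z : set P) : measurable Z -> lam2 Z = 0%E ->
  lam2 (V' `&` coord_map V psi @^-1` Z) = 0%E.
Proof.
move=> mZ Z0; have mpre : measurable (coord_map V psi @^-1` Z).
  by rewrite -[X in measurable X]setTI; exact: mphit.
have H := @pair_change (fun p => (\1_Z p)%:E).
transitivity (\int[lam2]_(p in V') (\1_Z (coord_map V psi p))%:E)%E.
  transitivity (\int[lam2]_(p in V') (\1_(coord_map V psi @^-1` Z) p)%:E)%E.
    by rewrite integral_indic// setIC.
  by apply: eq_integral => p _; rewrite !indicE.
rewrite H; last 2 first.
- by apply/measurable_EFinP; exact: measurable_indic.
- by move=> p; rewrite lee_fin.
rewrite (null_eq_integral (g := cst 0%E) mZ Z0) ?integral0//.
by move=> p _ nZ; rewrite indicE memNset// mul0e.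
Qed.

Lemma coord_map_psi p : V' p -> toC (coord_map V psi p) = psi (toC p).
Proof. by move=> Vp; rewrite coord_mapE// ofCK. Qed.

Lemma represents_pullback f h Z : represents U f h Z ->
  represents V (f \o psi) ((h \o coord_map V psi) \_ V') (V' `&` coord_map V psi @^-1` Z).
Proof.
move=> [mh mZ Z0 fh h0]; split.
- apply/(measurable_restrictT _ mV'); apply: measurable_funTS.
  exact: measurableT_comp mh mphit.
- by apply: measurableI => //; rewrite -[X in measurable X]setTI; exact: mphit.
- exact: null_pullback.
- move=> p Vp nZ; rewrite patchE mem_set//= -coord_map_psi// fh//.
    by rewrite coord_map_psi//; exact: pair_mapsV cp _ Vp.
  by move=> Zp; apply: nZ.
- by move=> p nV; rewrite patchE memNset.
Qed.

Lemma bounded_on_compact (K : set C) m : compact K -> (forall z, K z -> {for z, continuous m}) ->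
  exists2 B, 0 <= B & forall z, K z -> `|m z| <= B.
Proof.
move=> cK cm; have [B0 [_ kB]] : bounded_set (m @` K).
  apply: compact_bounded; apply: continuous_compact => //.
  by apply: continuous_in_subspaceT => z /set_mem; exact: cm.
exists (`|B0| + 1) => // z Kz; apply: kB; last by exists z.
by rewrite (le_lt_trans (ler_norm _))// ltrDl.
Qed.

Lemma compact_image_cont (K : set C) (f : C -> C) : compact K ->
  (forall z, K z -> {for z, continuous f}) -> compact (f @` K).
Proof.
move=> cK cf; apply: continuous_compact => //.
by apply: continuous_in_subspaceT => z /set_mem; exact: cf.
Qed.

Lemma jacobian_continuous z : U z -> {for z, continuous jacobian}.
Proof.
move=> /pair_holo_der[c /cderP[dr di]].
have jE : (fun w => (Re \o phi') w * (Re \o phi') w + (Im \o phi') w * (Im \o phi') w) =1 jacobian.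
  by move=> w; rewrite /jacobian sqr_cnorm /= !expr2.
exact: rdiff_cont (rdiff_ext jE (rdiffD (rdiffM dr dr) (rdiffM di di))).
Qed.

(** The integral over a compact set K becomes an integral over the compact set
    psi K, with an additional factor that is continuous, hence bounded
    there. *)
Lemma loc_integrable_pullback f m : loc_integrable U f ->
  (forall w, V w -> {for w, continuous m}) -> loc_integrable V (fun w => f (psi w) * m w).
Proof.
move=> lf cm; have [h [Z rf]] := borel_representative oU lf.1.
have [mh mZ Z0 fh h0] := rf; have [mh' mZ' Z0' fh' _] := represents_pullback rf.
have mzm : measurable_fun setT (zext V m : P -> M) by exact: measurable_zext.
split.
  exists (fun p => ((h \o coord_map V psi) \_ V') p * zext V m p).
    by apply: measurable_funTS; exact: measurable_funM.
  exists (V' `&` coord_map V psi @^-1` Z); split => // p /=; apply: contra_notP => nZ Vp.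
  by rewrite zextE// -fh'.
move=> K KV cK.
have KU : psi @` K `<=` U by move=> _ [w /KV Vw <-]; exact: pair_mapsV cp _ Vw.
have cKU : compact (psi @` K).
  by apply: compact_image_cont => // w /KV Vw; exact: cder_cont (pair_derV cp Vw).
pose J := jacobian.
have cJ := jacobian_continuous.
have [B B0 mB] : exists2 B, 0 <= B & forall z, (psi @` K) z -> `|m (phi z) * J z| <= B.
  apply: bounded_on_compact => // z /KU Uz.
  have c1 : {for z, continuous (m \o phi)}.
    apply: continuous_comp; first exact: cder_cont (pair_der cp Uz).
    by apply: cm; exact: pair_maps cp _ Uz.
  exact: (continuousM c1 (cJ _ Uz)).
have mK := compact_measurable2 cK; have mKU := compact_measurable2 cKU.
pose G p := (`|h p| * `|zext V m (coord_map U phi p)| * \1_(toC @^-1` (psi @` K)) p)%:E.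
have mPhi : measurable_fun setT (coord_map U phi).
  apply: (@measurable_coord_map R U phi psi' oU) => z Uz.
  have := pair_der_inv cp Uz => H; apply: cder_val (pair_der cp Uz).
  have n0 : psi' (phi z) != 0.
    by apply/eqP => E; move: H; rewrite E mulr0 => /esym/eqP; rewrite oner_eq0.
  by rewrite -[RHS]mul1r -H -mulrA mulfV// mulr1.
have mG : measurable_fun setT G.
  apply/measurable_EFinP; apply: measurable_funM; last exact: measurable_indic.
  apply: measurable_funM; first exact: (measurableT_comp (@normr_measurable R setT) mh).
  apply: (measurableT_comp (@normr_measurable R setT)).
  exact: measurableT_comp mzm mPhi.
have G0 p : (0 <= G p)%E by rewrite lee_fin !mulr_ge0.
have VK p : V' p -> (toC @^-1` (psi @` K)) (coord_map V psi p) -> K (toC p).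
  move=> Vp [w Kw]; rewrite coord_map_psi// => E.
  by rewrite -(pairKV cp Vp) -E (pairKV cp)//; exact: KV.
have E1 : area_integral K (fun z => `|f (psi z) * m z|%:E) = (\int[lam2]_(p in V') G (coord_map V psi p))%E.
  transitivity (\int[lam2]_(p in toC @^-1` K) (`|h (coord_map V psi p)| * `|zext V m p|)%:E)%E.
    apply: (null_eq_integral mZ' Z0') => p Kp nZ; have Vp : V' p by exact: KV.
    have := fh' _ Vp nZ; rewrite /= => ->.
    by rewrite patchE mem_set// normrM zextE.
  rewrite integral_mkcond [RHS]integral_mkcond; apply: eq_integral => p _; rewrite !patchE.
  case: ifPn => [/set_mem Kp|].
    have Vp : V' p by exact: KV.
    rewrite mem_set// /G indicE mem_set; last by exists (toC p); rewrite ?coord_map_psi.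
    have Upp : U (toC (coord_map V psi p)) by rewrite coord_map_psi//; exact: pair_mapsV cp _ Vp.
    by rewrite mulr1 (coord_mapE _ Upp) coord_map_psi// (pairKV cp Vp) toCK.
  rewrite notin_setE => nK; case: ifPn => // /set_mem Vp.
  by rewrite /G indicE memNset ?mulr0// => /(VK _ Vp).
rewrite E1 pair_change//.
have mKh : measurable_fun setT (fun p => (`|(h p)%:E| * (\1_(toC @^-1` (psi @` K)) p)%:E)%E).
  by apply: emeasurable_funM; [apply: measurableT_comp => //; exact/measurable_EFinP|apply/measurable_EFinP; exact: measurable_indic].
apply: (@le_lt_trans _ _ (\int[lam2]_(p in U') (B%:E * (`|(h p)%:E| * (\1_(toC @^-1` (psi @` K)) p)%:E)))%E).
  apply: ge0_le_integral => //.
  - by move=> p _; rewrite mule_ge0// lee_fin sqr_ge0.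
  - apply: emeasurable_funM; first exact: measurable_funTS.
    by apply/measurable_EFinP; exact: cont_measurable.
  - apply: measurable_funTS; apply: emeasurable_funM => //.
  - move=> p Up; rewrite /G -!EFinM lee_fin.
    have [Kp|nKp] := pselect ((toC @^-1` (psi @` K)) p); last first.
      by rewrite indicE memNset// !mulr0 mul0r.
    rewrite indicE mem_set// !mulr1 mulrAC -mulrA mulrC.
    rewrite coord_mapE// zextE ?ofCK//; last exact: pair_maps cp _ Up.
    apply: ler_wpM2r => //; apply: le_trans (mB _ Kp).
    by rewrite normrM mulrC ler_wpM2l// ler_norm.
rewrite ge0_integralZl//; last exact: measurable_funTS.
rewrite lte_mul_pinfty ?lee_fin//.
have /integrableP[_] := loc_integrable_on lf rf cKU KU.
apply: le_lt_trans; rewrite integral_mkcond [leRHS]integral_mkcond le_eqVlt; apply/orP; left; apply/eqP.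
apply: eq_integral => p _; rewrite !patchE indicE.
have [Kp|nKp] := pselect ((toC @^-1` (psi @` K)) p).
  by rewrite mem_set; [rewrite mem_set// mule1|exact: KU].
by rewrite (memNset nKp) mule0; case: ifP.
Qed.

End integrals.

End pullback.

(** * The weak chain rule *)

Section chain_rule.
Context {R : realType}.
Local Notation C := (Cplane R).
Local Notation Re := (@complex.Re R).
Local Notation Im := (@complex.Im R).
Local Notation M := (measurableTypeR R).
Local Notation P := (M * M)%type.
Local Notation lam2 := (@lebesgue2 R).
Implicit Types (A : set C) (f g m eta : C -> R) (h : P -> R).

Lemma lebesgue_measurable_funD A g1 g2 :
  lebesgue_measurable_fun A g1 -> lebesgue_measurable_fun A g2 ->
  lebesgue_measurable_fun A (fun z => g1 z + g2 z).
Proof.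
move=> [h1 m1 e1] [h2 m2 e2]; exists (h1 \+ h2); first exact: measurable_funD.
apply: (negligibleS _ (negligibleU e1 e2)) => p /=; apply: contra_notP => /not_orP[].
by move=> /contrapT H1 /contrapT H2 Ap; rewrite H1// H2.
Qed.

Lemma loc_integrableD A g1 g2 : open A -> loc_integrable A g1 -> loc_integrable A g2 ->
  loc_integrable A (fun z => g1 z + g2 z).
Proof.
move=> oA l1 l2; split; first exact: lebesgue_measurable_funD l1.1 l2.1.
move=> K KA cK; have [h1 [Z1 r1]] := borel_representative oA l1.1.
have [h2 [Z2 r2]] := borel_representative oA l2.1.
have [[_ mZ1 Z10 e1 _] [_ mZ2 Z20 e2 _]] := (r1, r2).
have mK := compact_measurable2 cK.
have := integrableD mK (loc_integrable_on l1 r1 cK KA) (loc_integrable_on l2 r2 cK KA).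
move=> /integrableP[_]; congr (_ < _)%E.
have [mZ Z0] := null_setU2 mZ1 Z10 mZ2 Z20.
apply: (null_eq_integral mZ Z0) => p Kp nZ.
have nZ1 : ~ Z1 p by move=> Zp; apply: nZ; left.
have nZ2 : ~ Z2 p by move=> Zp; apply: nZ; right.
by rewrite e1 ?e2//; exact: KA.
Qed.

Variables (U V : set C) (phi psi phi' psi' : C -> C).
Hypothesis cp : conformal_pair U V phi psi phi' psi'.
Let oU := pair_openl cp.
Let oV := pair_openr cp.
Let U' : set P := toC @^-1` U.
Let V' : set P := toC @^-1` V.
Let mV' : measurable V' := open_measurable2 oV.
Let mU' : measurable U' := open_measurable2 oU.

Section test_functions.
Variables (eta : C -> R) (eta_test : test_function V eta).
Let eta_smooth : smooth eta. Proof. by have [] := eta_test. Qed.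
Let K := closure [set z : C | eta z != 0].
Let supp : [/\ compact K, K `<=` V, continuous eta, (forall b, continuous (partial b eta)) &
    forall z, ~ K z -> eta z = 0 /\ forall b, partial b eta z = 0].
Proof. exact: test_support eta_test. Qed.

(** The test function on U obtained from eta and a factor k; outside U, where
    phi is meaningless, it is 0. *)
Definition pulled_test k (z : C) : R := if `[< U z >] then k z * eta (phi z) else 0.

Lemma pulled_testE k z : U z -> pulled_test k z = k z * eta (phi z).
Proof. by rewrite /pulled_test; case: asboolP. Qed.

Let psiK_compact : compact (psi @` K).
Proof.
have [cK KV _ _ _] := supp; apply: (compact_image_cont cK) => w Kw.
exact: cder_cont (pair_derV cp (KV _ Kw)).
Qed.

Lemma pulled_test_function k : pullback_gen U phi eta k -> test_function U (pulled_test k).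
Proof.
have [cK KV _ _ eta0] := supp => pk.
apply: (@test_function_extend R U (psi @` K) (fun z => k z * eta (phi z)) _
  (alg (pullback_gen U phi eta)) oU psiK_compact).
- by move=> _ [w Kw <-]; exact: pair_mapsV cp _ (KV _ Kw).
- by apply: pullback_closed; [exact: oU|exact: pair_holo cp|exact: eta_smooth].
- by apply: alg_mul; apply: alg_gen => //; exact: (pb_comp U phi eta [::]).
- exact: pulled_testE.
move=> z nK; rewrite /pulled_test; case: asboolP => // Uz.
rewrite (eta0 (phi z) _).1 ?mulr0// => Kz; apply: nK.
by exists (phi z) => //; exact: pairK cp _ Uz.
Qed.

Lemma pulled_test_rdiff k z a b : U z -> rdiff k z a b ->
  rdiff (pulled_test k) z
   (a * eta (phi z) + k z * (partial false eta (phi z) * Re (phi' z) + partial true eta (phi z) * Im (phi' z)))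
   (b * eta (phi z) + k z * (partial true eta (phi z) * Re (phi' z) - partial false eta (phi z) * Im (phi' z))).
Proof.
move=> Uz rk.
have rc := rdiff_compc (pair_der cp Uz) (smooth_rdiff eta_smooth [::] (phi z)).
apply: (rdiff_near (k := fun z => k z * eta (phi z))).
  have /open_discP/(_ z Uz)[e e0 eP] := oU; apply/cnbhsP; exists e => // w /eP Uw.
  by rewrite pulled_testE.
by apply: rdiff_val (rdiffM rk rc) => /=; ring.
Qed.

(** The holomorphic function g attached to the direction b of derivation:
    phi' for the x-derivative and - i phi' for the y-derivative. *)
Definition dirder (b : bool) (z : C) : C := if b then (Complex 0 (-1) : C) * phi' z else phi' z.

Lemma holo_dirder b : holo U (dirder b).
Proof.
move=> z Uz; have [c dc] := pair_holo_der cp Uz; case: b; last by exists c.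
by exists (Complex 0 (-1) * c); exact: cderZ.
Qed.

Let cRe b := pulled_test (Re \o dirder b).
Let cIm b := pulled_test (Im \o dirder b).

(** With phi' = r + i s, the right-hand side is
    eta_x (r Re g + s Im g) + eta_y (s Re g - r Im g), the derivatives of g
    cancelling by the Cauchy-Riemann equations; for the two choices of g one
    coefficient is r^2 + s^2 and the other 0. *)
Lemma chain_rule_pointwise b z : U z ->
  partial b eta (phi z) * jacobian phi' z = partial false (cRe b) z - partial true (cIm b) z.
Proof.
move=> Uz; have [c /cderP[dr di]] := holo_dirder b Uz.
have [_ ->] := rdiff_partial false (pulled_test_rdiff Uz dr).
have [_ ->] := rdiff_partial true (pulled_test_rdiff Uz di).
by rewrite /jacobian sqr_cnorm /dirder /=; case: b c dr di => c _ _ /=; rewrite ?ReImE /=; ring.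
Qed.

(** The coefficients of the gradient of f in the derivative of f o psi in the
    direction b. *)
Definition dircoef1 (b : bool) (w : C) : R := if b then - Im (psi' w) else Re (psi' w).
Definition dircoef2 (b : bool) (w : C) : R := if b then Re (psi' w) else Im (psi' w).

(** psi' = conj phi' / |phi'|^2, so the coefficients of the chain rule are, up to
    the Jacobian, those of the transported test functions. *)
Lemma dircoef_jacobian b z : U z ->
  dircoef1 b (phi z) * jacobian phi' z = Re (dirder b z) /\
  dircoef2 b (phi z) * jacobian phi' z = - Im (dirder b z).
Proof.
move=> Uz; have := pair_der_inv cp Uz; have n0 := pair_der_neq0 cp Uz.
rewrite /dircoef1 /dircoef2 /dirder /jacobian sqr_cnorm => H.
have [hr hi] : Re (psi' (phi z)) * (Re (phi' z) ^+ 2 + Im (phi' z) ^+ 2) = Re (phi' z) /\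
    Im (psi' (phi z)) * (Re (phi' z) ^+ 2 + Im (phi' z) ^+ 2) = - Im (phi' z).
  have h1 : Re (phi' z) * Re (psi' (phi z)) - Im (phi' z) * Im (psi' (phi z)) = 1.
    by rewrite -cReM H.
  have h2 : Re (phi' z) * Im (psi' (phi z)) + Im (phi' z) * Re (psi' (phi z)) = 0.
    by rewrite -cImM H.
  move: h1 h2; move: (Re (phi' z)) (Im (phi' z)) (Re (psi' (phi z))) (Im (psi' (phi z))).
  move=> r s c d h1 h2; split.
    transitivity (r * (r * c - s * d) + s * (r * d + s * c)); first by ring.
    by rewrite h1 h2; ring.
  transitivity (r * (r * d + s * c) - s * (r * c - s * d)); first by ring.
  by rewrite h1 h2; ring.
case: b; rewrite ?ReImE /=; split; rewrite ?mulNr ?hr ?hi; ring.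
Qed.

Lemma dircoef_continuous b w : V w ->
  {for w, continuous (dircoef1 b)} /\ {for w, continuous (dircoef2 b)}.
Proof.
move=> Vw; have [c /cderP[dr di]] := pair_holo_der (conformal_pair_sym cp) Vw.
rewrite /dircoef1 /dircoef2; case: b; split.
- apply: (rdiff_cont (rdiff_ext _ (rdiffZ (-1) di))) => v; exact: mulN1r.
- exact: rdiff_cont dr.
- exact: rdiff_cont dr.
- exact: rdiff_cont di.
Qed.

Variables (f g1 g2 : C -> R).
Hypotheses (lf : loc_integrable U f) (w1 : is_weak_partial false U f g1)
  (w2 : is_weak_partial true U f g2).

Definition pull_partial b (w : C) : R := g1 (psi w) * dircoef1 b w + g2 (psi w) * dircoef2 b w.

Let cutU_pairing (d : bool) g hf Zf hg Zg zeta : is_weak_partial d U f g ->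
  represents U f hf Zf -> represents U g hg Zg -> test_function U zeta ->
  [/\ lam2.-integrable U' (fun p => (hf p * partial d zeta (toC p))%:E),
      lam2.-integrable U' (fun p => (hg p * zeta (toC p))%:E) &
      (\int[lam2]_(p in U') (hf p * partial d zeta (toC p))%:E =
       - \int[lam2]_(p in U') (hg p * zeta (toC p))%:E)%E].
Proof.
move=> [lg wg] rf rg tz; have [cK KU cz cpz z0] := test_support tz; split.
- apply: (integrableS measurableT) => //.
  by apply: (pairing_integrable lf rf (cpz d) cK KU) => z /z0[_].
- apply: (integrableS measurableT) => //.
  by apply: (pairing_integrable lg rg cz cK KU) => z /z0[].
have [[_ mZf Zf0 ef _] [_ mZg Zg0 eg _]] := (rf, rg).
have := wg _ tz; rewrite /area_integral => H.
transitivity (\int[lam2]_(p in U') (f (toC p) * partial d zeta (toC p))%:E)%E.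
  by apply: (null_eq_integral mZf Zf0) => p Up nZ; rewrite ef.
rewrite H; congr (- _)%E.
by apply: (null_eq_integral mZg Zg0) => p Up nZ; rewrite eg.
Qed.

(** Both sides are moved to U by the change of variables; there the left one
    splits, by [chain_rule_pointwise], into two pairings of f with derivatives
    of test functions, which the weak derivatives of f transform into the right
    one. *)
Lemma pull_partial_pairing b :
  area_integral V (fun w => (f (psi w) * partial b eta w)%:E) =
  (- area_integral V (fun w => (pull_partial b w * eta w)%:E))%E.
Proof.
have [hf [Zf rf]] := borel_representative oU lf.1.
have [h1 [Z1 r1]] := borel_representative oU w1.1.1.
have [h2 [Z2 r2]] := borel_representative oU w2.1.1.
have [_ _ ceta cpeta _] := supp.
have cphi z : U z -> {for z, continuous phi} by move=> Uz; exact: cder_cont (pair_der cp Uz).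
have czU (k : C -> R) : (forall w, V w -> {for w, continuous k}) ->
    measurable_fun setT (zext U (k \o phi) : P -> M).
  move=> ck; apply: measurable_zext => // z Uz.
  by apply: continuous_comp; [exact: cphi|apply: ck; exact: pair_maps cp _ Uz].
have tRe : test_function U (cRe b) by apply: pulled_test_function; apply: pb_Re; exact: holo_dirder.
have tIm : test_function U (cIm b) by apply: pulled_test_function; apply: pb_Im; exact: holo_dirder.
have [i1 j1 E1] := cutU_pairing w1 rf r1 tRe.
have [i2 j2 E2] := cutU_pairing w2 rf r2 tIm.
have [mhf mZf Zf0 ef _] := rf; have [mh1 mZ1 Z10 e1 _] := r1; have [mh2 mZ2 Z20 e2 _] := r2.
have Vphi p : V' p -> U (toC (coord_map V psi p)) by move=> Vp; rewrite coord_map_psi//; exact: pair_mapsV cp _ Vp.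
have Vpp p : V' p -> phi (toC (coord_map V psi p)) = toC p by move=> Vp; rewrite coord_map_psi// (pairKV cp Vp).
have [_ mYf Yf0 _ _] := represents_pullback cp rf.
have [_ mY1 Y10 _ _] := represents_pullback cp r1.
have [_ mY2 Y20 _ _] := represents_pullback cp r2.
have pE (k : C -> R) p : V' p -> zext U (k \o phi) (coord_map V psi p) = k (toC p).
  by move=> Vp; rewrite (zextE _ (Vphi _ Vp)) /= (Vpp _ Vp).
pose Hf p := hf p * zext U (partial b eta \o phi) p.
have mHf : measurable_fun setT (Hf : P -> M).
  by apply: measurable_funM => //; apply: czU => w _; exact: cpeta.
transitivity (\int[lam2]_(p in V') (Hf (coord_map V psi p))%:E)%E.
  apply: (null_eq_integral mYf Yf0) => p Vp nZ.
  by rewrite /Hf pE// -(ef _ (Vphi _ Vp)) ?coord_map_psi// => Zp; apply: nZ.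
pose c1 w := dircoef1 b w * eta w; pose c2 w := dircoef2 b w * eta w.
have cc1 w : V w -> {for w, continuous c1}.
  by move=> Vw; have [H _] := dircoef_continuous b Vw; exact: (continuousM H (ceta w)).
have cc2 w : V w -> {for w, continuous c2}.
  by move=> Vw; have [_ H] := dircoef_continuous b Vw; exact: (continuousM H (ceta w)).
pose Hg p := h1 p * zext U (c1 \o phi) p + h2 p * zext U (c2 \o phi) p.
have mHg : measurable_fun setT (Hg : P -> M).
  by apply: measurable_funD; apply: measurable_funM => //; exact: czU.
rewrite (_ : area_integral V (fun w => (pull_partial b w * eta w)%:E) =
    (\int[lam2]_(p in V') (Hg (coord_map V psi p))%:E)%E); last first.
  have [mY Y0] := null_setU2 mY1 Y10 mY2 Y20.
  apply: (null_eq_integral mY Y0) => p Vp nZ.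
  have n1 : ~ Z1 (coord_map V psi p) by move=> Zp; apply: nZ; left.
  have n2 : ~ Z2 (coord_map V psi p) by move=> Zp; apply: nZ; right.
  rewrite /Hg !pE// -(e1 _ (Vphi _ Vp) n1) -(e2 _ (Vphi _ Vp) n2) coord_map_psi//.
  by rewrite /pull_partial /c1 /c2; congr EFin; ring.
rewrite !(pair_change_signed cp)//.
transitivity (\int[lam2]_(p in U') ((hf p * partial false (cRe b) (toC p))%:E -
    (hf p * partial true (cIm b) (toC p))%:E))%E.
  apply: eq_integral => p /set_mem Up; rewrite -EFinB; congr EFin.
  by rewrite /Hf zextE//= -mulrA chain_rule_pointwise// mulrBr.
transitivity (- \int[lam2]_(p in U') ((h1 p * cRe b (toC p))%:E -
    (h2 p * cIm b (toC p))%:E))%E; last first.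
  congr (- _)%E; apply: eq_integral => p /set_mem Up; rewrite -EFinB; congr EFin.
  have [d1 d2] := dircoef_jacobian b Up.
  have {}d2 : Im (dirder b (toC p)) = - (dircoef2 b (phi (toC p)) * jacobian phi' (toC p)).
    by rewrite d2 opprK.
  by rewrite /Hg !zextE//= /cRe /cIm !pulled_testE//= /c1 /c2 -d1 d2; ring.
rewrite (integralB mU' i1 i2) (integralB mU' j1 j2) E1 E2 fin_num_oppeB ?oppeK//.
exact: (integrable_fin_num mU' j2).
Qed.

End test_functions.

Lemma is_weak_partial_pullback f g1 g2 b : loc_integrable U f ->
  is_weak_partial false U f g1 -> is_weak_partial true U f g2 ->
  is_weak_partial b V (f \o psi) (pull_partial g1 g2 b).
Proof.
move=> lf w1 w2; split; last by move=> eta teta; exact: pull_partial_pairing.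
apply: loc_integrableD => //.
  by apply: (loc_integrable_pullback cp w1.1) => w /(dircoef_continuous b)[].
by apply: (loc_integrable_pullback cp w2.1) => w /(dircoef_continuous b)[].
Qed.

Lemma is_weak_gradient_pullback f (g : C -> R * R) : is_weak_gradient U f g ->
  is_weak_gradient V (f \o psi) (fun w => (pull_partial (fst \o g) (snd \o g) false w,
     pull_partial (fst \o g) (snd \o g) true w)).
Proof.
move=> [lf w1 w2]; split; [|exact: is_weak_partial_pullback|exact: is_weak_partial_pullback].
have c1 (w : C) : V w -> {for w, continuous (cst 1 : C -> R)} by move=> _; exact: cst_continuous.
have := loc_integrable_pullback cp lf c1.
by congr loc_integrable; apply/funext => w; rewrite /= mulr1.
Qed.

End chain_rule.

(** * The energy estimate *)

(** Hoelder's inequality for u^q and v^q with the conjugate exponents p/q and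
    p/(p - q), raised to the power 1/q. *)
Lemma hoelder_lower_exponent d (T : measurableType d) (R : realType) (mu : {measure set T -> \bar R})
    (u v : T -> R) (p q : R) :
  measurable_fun setT u -> measurable_fun setT v -> (forall x, 0 <= u x) -> (forall x, 0 <= v x) ->
  0 < q < p ->
  ((\int[mu]_x ((u x * v x) `^ q)%:E) `^ q^-1 <=
   (\int[mu]_x (u x `^ p)%:E) `^ p^-1 *
   (\int[mu]_x (v x `^ (p * q / (p - q)))%:E) `^ ((p - q) / (p * q)))%E.
Proof.
move=> mu' mv u0 v0 /andP[q0 qp]; have p0 : 0 < p by exact: lt_trans qp.
have pq0 : 0 < p - q by rewrite subr_gt0.
have [qn pn pqn] : [/\ q != 0, p != 0 & p - q != 0] by rewrite !gt_eqF.
have mpow (w : T -> R) r : measurable_fun setT w -> measurable_fun setT (fun x => w x `^ r).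
  by move=> mw; exact: (measurableT_comp (measurable_powR r) mw).
have r0 : 0 < p / q by rewrite divr_gt0.
have s0 : 0 < p / (p - q) by rewrite divr_gt0.
have rs : (p / q)^-1 + (p / (p - q))^-1 = 1 by field; rewrite pn pqn qn.
have := hoelder mu (mpow u q mu') (mpow v q mv) r0 s0 rs.
rewrite Lnorm1 unlock => H.
set A := (\int[mu]_x ((u x * v x) `^ q)%:E)%E; set B := (\int[mu]_x (u x `^ p)%:E)%E.
set D := (\int[mu]_x (v x `^ (p * q / (p - q)))%:E)%E.
have pos (w : T -> R) r : (0 <= \int[mu]_x (w x `^ r)%:E)%E.
  by apply: integral_ge0 => x _; rewrite lee_fin powR_ge0.
have {}H : (A <= B `^ (q / p) * D `^ ((p - q) / p))%E.
  apply: (le_trans _ (le_trans H _)); rewrite le_eqVlt; apply/orP; left; apply/eqP.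
    apply: eq_integral => x _ /=; rewrite ger0_norm ?powRM//.
    by rewrite mulr_ge0// powR_ge0.
  rewrite (invf_div p q) (invf_div p (p - q)).
  have EB : (\int[mu]_x (`|(EFin \o (fun x => u x `^ q)%R) x| `^ (p / q)))%E = B.
    apply: eq_integral => x _ /=.
    by rewrite ger0_norm ?powR_ge0// -powRrM mulrCA mulfV// mulr1.
  have ED : (\int[mu]_x (`|(EFin \o (fun x => v x `^ q)%R) x| `^ (p / (p - q))))%E = D.
    apply: eq_integral => x _ /=.
    by rewrite ger0_norm ?powR_ge0// -powRrM mulrCA mulrA.
  rewrite -EB.
  rewrite -ED.
  by [].
have -> : ((B `^ p^-1) * (D `^ ((p - q) / (p * q))) = (B `^ (q / p) * D `^ ((p - q) / p)) `^ q^-1)%E.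
  rewrite poweRM ?poweR_ge0// -!poweRrM; congr (_ `^ _ * _ `^ _)%E; field.
    by rewrite pn qn.
  by rewrite pn qn.
apply: gt0_ler_poweR => //.
- by rewrite invr_ge0 ltW.
- by rewrite in_itv/= pos leey.
- by rewrite in_itv/= leey mule_ge0 ?poweR_ge0.
Qed.

(** Here a stands for |alpha0|. *)
Section exponents.
Variables (R : realType) (a p : R).
Hypotheses (a_range : 0 < a < 2) (p_range : (a + 2) / (a + 1) < p < 2).

Let a0 : 0 < a. Proof. by case/andP: a_range. Qed.
Let a2 : a < 2. Proof. by case/andP: a_range. Qed.
Let p2 : p < 2. Proof. by case/andP: p_range. Qed.
Let ap : a + 2 < p * (a + 1).
Proof. by case/andP: p_range; rewrite ltr_pdivrMr// addr_gt0. Qed.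

Lemma p_gt1 : 1 < p.
Proof. have h1 := a0; have h2 := ap; nra. Qed.

(** After clearing denominators the difference of the two sides is
    p (2 - a) (2 - p). *)
Lemma critical_exponent_lt : p * a / (2 + a - p) < 2 * p / (4 - p).
Proof.
have h1 := a0; have h2 := a2; have h3 := p2; have h4 := p_gt1.
rewrite ltr_pdivrMr; last by lra.
rewrite mulrAC ltr_pdivlMr; last by lra.
rewrite -subr_gt0 (_ : _ - _ = p * ((2 - a) * (2 - p))); last by ring.
by rewrite !mulr_gt0 ?subr_gt0//; lra.
Qed.

(** q (2 - p) <= a (p - q) is the same as q (2 + a - p) <= p a. *)
Lemma exponent_bounds q : 1 <= q <= p * a / (2 + a - p) ->
  0 < q < p /\ - a <= q * (p - 2) / (p - q) < 0.
Proof.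
have h1 := a0; have h2 := a2; have h3 := p2; have h4 := p_gt1.
have d0 : 0 < 2 + a - p by lra.
rewrite ler_pdivlMr// => /andP[q1 qle].
have q0 : 0 < q by lra.
have qp : q < p by nra.
have pq0 : 0 < p - q by lra.
split; first by rewrite q0.
rewrite ler_pdivlMr// ltr_pdivrMr// mul0r; apply/andP; split; first by lra.
by nra.
Qed.

End exponents.

Section energies.
Context {R : realType}.
Local Notation C := (Cplane R).
Local Notation Re := (@complex.Re R).
Local Notation Im := (@complex.Im R).
Local Notation N := (@ComplexField.Normc.normc R).
Local Notation M := (measurableTypeR R).
Local Notation P := (M * M)%type.
Local Notation lam2 := (@lebesgue2 R).
Implicit Types (A : set C) (f : C -> R) (g : C -> R * R).

Lemma weak_gradientP A f : weakly_differentiable A f -> is_weak_gradient A f (weak_gradient A f).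
Proof. by move=> wf; exact: xgetPex. Qed.

(** By [weak_partial_unique] the weak gradient selected in the definition may
    be replaced by any other one, whose formula is known. *)
Lemma sobolev_energyE A f g q : open A -> is_weak_gradient A f g ->
  sobolev_energy A q f = area_integral A (fun z => (euclidean_norm (g z) `^ q)%:E).
Proof.
move=> oA wg; have [_ w1 w2] := wg; have [_ w1' w2'] := weak_gradientP (ex_intro _ g wg).
have [Z1 [mZ1 Z10 e1]] := weak_partial_unique oA w1' w1.
have [Z2 [mZ2 Z20 e2]] := weak_partial_unique oA w2' w2.
  have [mZ Z0] := null_setU2 mZ1 Z10 mZ2 Z20.
apply: (null_eq_integral mZ Z0) => p Ap nZ.
have n1 : ~ Z1 p by move=> Zp; apply: nZ; left.
have n2 : ~ Z2 p by move=> Zp; apply: nZ; right.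
by have /= := e1 p Ap n1; have /= := e2 p Ap n2; rewrite /euclidean_norm => -> ->.
Qed.

Variables (U V : set C) (phi psi phi' psi' : C -> C).
Hypothesis cp : conformal_pair U V phi psi phi' psi'.
Let oU := pair_openl cp.
Let oV := pair_openr cp.
Let U' : set P := toC @^-1` U.
Let V' : set P := toC @^-1` V.
Let mV' : measurable V' := open_measurable2 oV.
Let mU' : measurable U' := open_measurable2 oU.

(** The derivative of a conformal map is a similarity of ratio |psi'|. *)
Lemma euclidean_norm_pull (g1 g2 : C -> R) w :
  euclidean_norm (pull_partial psi psi' g1 g2 false w, pull_partial psi psi' g1 g2 true w) =
  euclidean_norm (g1 (psi w), g2 (psi w)) * N (psi' w).
Proof.
rewrite /euclidean_norm cnormE -sqrtrM ?addr_ge0 ?sqr_ge0//; congr Num.sqrt.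
by rewrite /pull_partial /dircoef1 /dircoef2 /=; ring.
Qed.

Variables (f : C -> R) (g : C -> R * R).
Hypothesis wg : is_weak_gradient U f g.
Variables (p q : R).
Hypothesis (q_range : 0 < q < p) (p2 : p < 2).

Lemma energy_pullback :
  (sobolev_seminorm V q (f \o psi) <=
   area_integral U (fun z => (euclidean_norm (g z) `^ p)%:E) `^ p^-1 *
   area_integral V (fun w => (N (psi' w) `^ (q * (p - 2) / (p - q)))%:E) `^ ((p - q) / (p * q)))%E.
Proof.
have [lf w1 w2] := wg; have /andP[q0 qp] := q_range.
have p0 : 0 < p by exact: lt_trans qp.
have [qn pn pqn] : [/\ q != 0, p != 0 & p - q != 0] by rewrite !gt_eqF// subr_gt0.
have n2p : 2 / p != 0 by rewrite mulf_neq0 ?invr_neq0.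
have np2 : (p - 2) / p != 0 by rewrite mulf_neq0 ?invr_neq0// lt_eqF// subr_lt0.
have npq : p * q / (p - q) != 0 by rewrite !mulf_neq0 ?invr_neq0.
have sum1 : 2 / p + (p - 2) / p = 1 by field.
have twop : 2 / p * p = 2%:R by field.
have expE : (p - 2) / p * (p * q / (p - q)) = q * (p - 2) / (p - q) by field; rewrite pn pqn.
have [h1 [Z1 r1]] := borel_representative oU w1.1.1.
have [h2 [Z2 r2]] := borel_representative oU w2.1.1.
have [mh1 mZ1 Z10 e1 _] := r1; have [mh2 mZ2 Z20 e2 _] := r2.
have [_ mY1 Y10 _ _] := represents_pullback cp r1.
have [_ mY2 Y20 _ _] := represents_pullback cp r2.
have Vphi x : V' x -> U (toC (coord_map V psi x)) by move=> Vx; rewrite coord_map_psi//; exact: pair_mapsV cp _ Vx.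
pose e x := euclidean_norm (h1 x, h2 x).
have e0 x : 0 <= e x by exact: sqrtr_ge0.
pose W := zext V (N \o psi').
have W0 x : 0 <= W x by rewrite /W /zext patchE; case: ifP => // _; exact: cnorm_ge0.
have mphit : measurable_fun setT (coord_map V psi).
  apply: (@measurable_coord_map R V psi phi' oV) => w Vw.
  by rewrite -(pair_derV_eq cp)//; exact: pair_derV cp _ Vw.
(* Since 2 / p and (p - 2) / p are nonzero, u and v vanish outside V, where W is
   0, although the second exponent is negative. *)
pose u x := e (coord_map V psi x) * W x `^ (2 / p).
pose v x := W x `^ ((p - 2) / p).
have msqrt : measurable_fun setT (@Num.sqrt R) by apply: continuous_measurable_fun; exact: sqrt_continuous.
have me : measurable_fun setT (e : P -> M).
  by apply: (measurableT_comp msqrt); apply: measurable_funD; apply: measurable_funX.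
have mW : measurable_fun setT (W : P -> M).
  have -> : W = Num.sqrt \o zext V (jacobian psi').
    apply/funext => x; rewrite /W /zext /= !patchE; case: ifP => _; last by rewrite sqrtr0.
    by rewrite /= /jacobian sqrtr_sqr ger0_norm// cnorm_ge0.
  apply: (measurableT_comp msqrt); apply: measurable_zext => // w Vw.
  exact: (jacobian_continuous (conformal_pair_sym cp) Vw).
have mpow (w : P -> R) r : measurable_fun setT (w : P -> M) -> measurable_fun setT ((fun x => w x `^ r) : P -> M).
  by move=> mw; exact: (measurableT_comp (measurable_powR r) mw).
have mu : measurable_fun setT (u : P -> M).
  by apply: measurable_funM; [exact: measurableT_comp me mphit|exact: mpow].
have mv : measurable_fun setT (v : P -> M) by exact: mpow.
have u0 x : 0 <= u x by rewrite mulr_ge0// powR_ge0.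
have v0 x : 0 <= v x by exact: powR_ge0.
have outW x : ~ V' x -> W x = 0 by move=> nV; exact: zext0.
have outu x : ~ V' x -> u x = 0 by move=> nV; rewrite /u (outW _ nV) (powR0 n2p) mulr0.
have outv x : ~ V' x -> v x = 0 by move=> nV; rewrite /v (outW _ nV) (powR0 np2).
have onV (k : P -> R) : (forall x, ~ V' x -> k x = 0) ->
    (\int[lam2]_x (k x)%:E = \int[lam2]_(x in V') (k x)%:E)%E.
  move=> k0; rewrite [RHS]integral_mkcond; apply: eq_integral => x _; rewrite patchE.
  by case: ifPn => //; rewrite notin_setE => /k0 ->.
have H := hoelder_lower_exponent lam2 mu mv u0 v0 q_range.
have E1 : sobolev_energy V q (f \o psi) = (\int[lam2]_x ((u x * v x) `^ q)%:E)%E.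
  rewrite (sobolev_energyE _ oV (is_weak_gradient_pullback cp wg)) onV; last first.
    by move=> x nV; rewrite (outu _ nV) mul0r (powR0 qn).
  have [mY Y0] := null_setU2 mY1 Y10 mY2 Y20.
  apply: (null_eq_integral mY Y0) => x Vx nZ.
  have n1 : ~ Z1 (coord_map V psi x) by move=> Zp; apply: nZ; left.
  have n2 : ~ Z2 (coord_map V psi x) by move=> Zp; apply: nZ; right.
  rewrite euclidean_norm_pull; congr (_ `^ _)%:E; rewrite /u /v -mulrA -powRD ?sum1 ?oner_eq0//.
  by rewrite (powRr1 (W0 x)) /W (zextE _ Vx) /e -(e1 _ (Vphi _ Vx) n1) -(e2 _ (Vphi _ Vx) n2) (coord_map_psi _ Vx).
have E2 : area_integral U (fun z => (euclidean_norm (g z) `^ p)%:E) = (\int[lam2]_x (u x `^ p)%:E)%E.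
  rewrite onV; last first.
    by move=> x nV; rewrite (outu _ nV) (powR0 pn).
  transitivity (\int[lam2]_(x in U') (e x `^ p)%:E)%E.
    have [mZ Z0] := null_setU2 mZ1 Z10 mZ2 Z20.
    apply: (null_eq_integral mZ Z0) => x Ux nZ.
    have n1 : ~ Z1 x by move=> Zp; apply: nZ; left.
    have n2 : ~ Z2 x by move=> Zp; apply: nZ; right.
    by rewrite /e -(e1 _ Ux n1) -(e2 _ Ux n2).
  have := @pair_change _ _ _ _ _ _ _ (conformal_pair_sym cp) (fun x => (e (coord_map V psi x) `^ p)%:E).
  move=> Hc; transitivity (\int[lam2]_(x in U') (e (coord_map V psi (coord_map U phi x)) `^ p)%:E)%E.
    apply: eq_integral => x /set_mem Ux; congr (e _ `^ _)%:E.
    have Vx : V (phi (toC x)) by exact: pair_maps cp _ Ux.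
    have E : coord_map U phi x = ofC (phi (toC x)) := coord_mapE phi Ux.
    have E' : coord_map V psi (ofC (phi (toC x))) = ofC (psi (phi (toC x))) by rewrite coord_mapE ofCK.
    by rewrite E E' (pairK cp Ux) toCK.
  rewrite Hc; last 2 first.
  - by apply/measurable_EFinP; apply: mpow; exact: measurableT_comp me mphit.
  - by move=> x; rewrite lee_fin powR_ge0.
  apply: eq_integral => x /set_mem Vx; rewrite -EFinM; congr EFin.
  rewrite /u (powRM _ (e0 _) (powR_ge0 _ _)) -powRrM twop (powR_mulrn _ (W0 x)).
  by rewrite /W (zextE _ Vx).
have E3 : area_integral V (fun w => (N (psi' w) `^ (q * (p - 2) / (p - q)))%:E) =
    (\int[lam2]_x (v x `^ (p * q / (p - q)))%:E)%E.
  rewrite onV; last by move=> x nV; rewrite (outv _ nV) (powR0 npq).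
  apply: eq_integral => x /set_mem Vx.
  by rewrite /v -powRrM expE /W (zextE _ Vx).
by rewrite /sobolev_seminorm E1 E2 E3.
Qed.

End energies.

Lemma open_unit_disc (R : realType) : open (@unit_disc R).
Proof.
apply/open_discP => z /= z1; exists (1 - ComplexField.Normc.normc z); first by rewrite subr_gt0.
move=> w wz; rewrite /unit_disc /= -(subrK z w).
by apply: (le_lt_trans (ler_cnormD _ _)); rewrite -ltrBrDr.
Qed.

Theorem theorem4p5 (R : realType) (Omega : set (Cplane R))
    (phi : Cplane R -> Cplane R) (alpha0 p : R)
    (Omega_sc : simply_connected_domain Omega)
    (Omega_bd : frontier Omega !=set0)
    (phi_conf : conformal_homeomorphism Omega unit_disc phi)
    (alpha0_range : -2 < alpha0 < 0)
    (brennan : inverse_brennan alpha0)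
    (p_range : (`|alpha0| + 2) / (`|alpha0| + 1) < p < 2) :
  p * `|alpha0| / (2 + `|alpha0| - p) < 2 * p / (4 - p) /\
  forall q : R, 1 <= q <= p * `|alpha0| / (2 + `|alpha0| - p) ->
    bounded_composition Omega unit_disc p q (inv_on Omega phi).
Proof.
have a_range : 0 < `|alpha0| < 2.
  by case/andP: alpha0_range => h1 h2; rewrite ltr0_norm//; apply/andP; split; lra.
split; first exact: critical_exponent_lt a_range p_range.
move=> q q_range; have [qp beta_range] := exponent_bounds a_range p_range q_range.
have p2 : p < 2 by case/andP: p_range.
have oU : open Omega by have [[]] := Omega_sc.
have cp := conformal_homeomorphism_pair oU (@open_unit_disc R) phi_conf.
set psi := inv_on Omega phi in cp *; set beta := q * (p - 2) / (p - q) in beta_range.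
have Bfin : (area_integral unit_disc
    (fun w => (ComplexField.Normc.normc (derive1 psi w) `^ beta)%:E) < +oo)%E.
  apply: (brennan _ _ Omega_sc Omega_bd).
    exact: (conformal_homeomorphism_inv (@open_unit_disc R) phi_conf).
  case/andP: beta_range => h1 h2; apply/andP; split.
    by case/andP: alpha0_range => _ h3; move: h1; rewrite ltr0_norm// opprK.
  by apply: (lt_trans h2); rewrite divr_gt0.
set I := area_integral _ _ in Bfin.
have I0 : (0 <= I)%E by apply: integral_ge0 => x _; rewrite lee_fin powR_ge0.
have fin : (I `^ ((p - q) / (p * q)))%E \is a fin_num.
  by apply: fin_num_poweR; rewrite ge0_fin_numE.
exists (fine (I `^ ((p - q) / (p * q)))%E) => f [wf Sf].
have wg := weak_gradientP wf.
have bound : (sobolev_seminorm unit_disc q (f \o psi) <=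
    (fine (I `^ ((p - q) / (p * q)))%E)%:E * sobolev_seminorm Omega p f)%E.
  by rewrite fineK// muleC; exact: (energy_pullback cp wg qp p2).
split=> //; split; first by eexists; exact: (is_weak_gradient_pullback cp wg).
apply: (le_lt_trans bound); rewrite lte_mul_pinfty ?lee_fin//.
by rewrite fine_ge0// poweR_ge0.
Qed.
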